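(* There is an algorithm that, given an instance $\mathcal{K}$ of the budgeted matroid independent set (BMI) problem and a parameter $0<\varepsilon<\frac{1}{2}$, outputs a solution for $\mathcal{K}$ of profit at least $(1-\varepsilon)\cdot \mathrm{OPT}(\mathcal{K})$ in time $2^{O\left(\varepsilon^{-2}\log\frac{1}{\varepsilon}\right)}\cdot \mathrm{poly}(|\mathcal{K}|)$.
   Context: A BMI instance is a tuple $\mathcal{K}=(E,\mathcal{I},c,p,\beta)$: a finite ground set $E$, a collection $\mathcal{I}\subseteq 2^E$ given by a membership oracle such that $(E,\mathcal{I})$ is a matroid, a budget $\beta>0$, a cost function $c:E\to[0,\beta]$ and a profit function $p:E\to\mathbb{R}_{\ge 0}$. A solution is a set $X\in\mathcal{I}$ with $c(X)=\sum_{e\in X}c(e)\le\beta$; its profit is $p(X)=\sum_{e\in X}p(e)$. $\mathrm{OPT}(\mathcal{K})$ denotes the maximum profit of a solution, and $|\mathcal{K}|$ the bit-length encoding size of the instance. *)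

(* Defs.v *)
From Corelib Require Import BinNums.
From mathcomp Require Import all_boot all_order all_algebra.
From mathcomp Require Import reals exp.

Set Implicit Arguments.
Unset Strict Implicit.
Unset Printing Implicit Defensive.

Import Order.TTheory GRing.Theory Num.Theory.
Local Open Scope ring_scope.

Definition is_matroid (E : finType) (I : {set {set E}}) : Prop :=
  [/\ set0 \in I,
      forall A B : {set E}, A \subset B -> B \in I -> A \in I
    & forall A B : {set E}, A \in I -> B \in I -> (#|A| < #|B|)%N ->
        exists2 e, e \in B :\: A & e |: A \in I].

(* The numbers are rational so that instances have a bit length. *)
Record bmi := BMI {
  ground : finType;
  indep : {set {set ground}};
  cost : ground -> rat;
  profit : ground -> rat;
  budget : rat;
  indep_matroid : is_matroid indep;
  budget_gt0 : 0 < budget;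
  cost_bounds : forall e, 0 <= cost e <= budget;
  profit_ge0 : forall e, 0 <= profit e }.

Definition set_cost (K : bmi) (X : {set ground K}) : rat :=
  \sum_(e in X) cost e.

Definition set_profit (K : bmi) (X : {set ground K}) : rat :=
  \sum_(e in X) profit e.

Definition solution (K : bmi) (X : {set ground K}) : bool :=
  (X \in indep K) && (set_cost X <= budget K).

(* The default value 0 is harmless: set0 is a solution of profit 0 and all
   profits are nonnegative. *)
Definition OPT (K : bmi) : rat :=
  \big[Num.max/0]_(X : {set ground K} | solution X) set_profit X.

(* Algorithms are programs of a first-order, call-by-value functional language
   over binary trees, with general recursion.  With trees stored as shared heap
   cells every operation is a constant-time pointer operation, so the cost
   below agrees with Turing machine time up to a polynomial. *)
Inductive data := Leaf | Node of data & data.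

(* The number of bits of the preorder bit string of the tree, in which a leaf
   is written 0 and an inner node 1. *)
Fixpoint data_size (d : data) : nat :=
  if d is Node a b then (data_size a + data_size b).+1 else 1%N.

Definition enc_bool (b : bool) : data := if b then Node Leaf Leaf else Leaf.

Definition enc_seq (s : seq data) : data := foldr Node Leaf s.

(* Binary digits, least significant first. *)
Fixpoint pos_bits (q : positive) : seq bool :=
  match q with
  | xH => [:: true]
  | xO q' => false :: pos_bits q'
  | xI q' => true :: pos_bits q'
  end.

Definition nat_bits (n : nat) : seq bool :=
  if bin_of_nat n is Npos q then pos_bits q else [::].

Definition enc_nat (n : nat) : data := enc_seq (map enc_bool (nat_bits n)).

(* Only used for nonnegative q, hence no sign. *)
Definition enc_rat (q : rat) : data :=
  Node (enc_nat `|numq q|) (enc_nat `|denq q|).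

(* Characteristic vector, in the order of enum E. *)
Definition enc_set (E : finType) (X : {set E}) : data :=
  enc_seq [seq enc_bool (e \in X) | e <- enum E].

(* The independent sets are not part of the input: they are only available
   through the membership oracle. *)
Definition enc_bmi (K : bmi) : data :=
  Node (enc_rat (budget K))
    (enc_seq [seq Node (enc_rat (cost e)) (enc_rat (profit e))
                | e <- enum (ground K)]).

Definition bmi_size (K : bmi) : nat := data_size (enc_bmi K).

Inductive expr :=
  | EVar of nat                     (* de Bruijn index *)
  | ELeaf
  | ENode of expr & expr
  | ELeft of expr
  | ERight of expr
  | EIf of expr & expr & expr       (* a leaf is false, a node is true *)
  | ELet of expr & expr
  | ECall of nat & expr
  | EIndep of expr                  (* membership oracle *)
  | ELeEps of expr.                 (* comparison of a rational with eps *)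

(* The bodies of mutually recursive unary functions; function 0 is the main
   one. *)
Definition program := seq expr.

Definition body (A : program) (f : nat) : expr := nth ELeaf A f.

Definition left_of (d : data) : data := if d is Node a _ then a else Leaf.
Definition right_of (d : data) : data := if d is Node _ b then b else Leaf.

(* eval A K eps env e v t: e evaluates to v in t steps.  The parameter eps is
   an arbitrary real number and has no finite encoding; a program accesses it
   by asking whether a / b <= eps.  An oracle call is charged the size of its
   argument, and is stuck on an ill-formed argument. *)
Inductive eval (R : realType) (A : program) (K : bmi) (eps : R) :
    seq data -> expr -> data -> nat -> Prop :=
  | eval_var env i :
      eval A K eps env (EVar i) (nth Leaf env i) 1
  | eval_leaf env :
      eval A K eps env ELeaf Leaf 1
  | eval_node env e1 e2 v1 v2 t1 t2 :
      eval A K eps env e1 v1 t1 -> eval A K eps env e2 v2 t2 ->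
      eval A K eps env (ENode e1 e2) (Node v1 v2) (t1 + t2).+1
  | eval_left env e v t :
      eval A K eps env e v t ->
      eval A K eps env (ELeft e) (left_of v) t.+1
  | eval_right env e v t :
      eval A K eps env e v t ->
      eval A K eps env (ERight e) (right_of v) t.+1
  | eval_if_true env e e1 e2 a b v t t1 :
      eval A K eps env e (Node a b) t -> eval A K eps env e1 v t1 ->
      eval A K eps env (EIf e e1 e2) v (t + t1).+1
  | eval_if_false env e e1 e2 v t t2 :
      eval A K eps env e Leaf t -> eval A K eps env e2 v t2 ->
      eval A K eps env (EIf e e1 e2) v (t + t2).+1
  | eval_let env e1 e2 v1 v2 t1 t2 :
      eval A K eps env e1 v1 t1 -> eval A K eps (v1 :: env) e2 v2 t2 ->
      eval A K eps env (ELet e1 e2) v2 (t1 + t2).+1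
  | eval_call env f e v w t1 t2 :
      eval A K eps env e v t1 -> eval A K eps [:: v] (body A f) w t2 ->
      eval A K eps env (ECall f e) w (t1 + t2).+1
  | eval_indep env e (X : {set ground K}) t :
      eval A K eps env e (enc_set X) t ->
      eval A K eps env (EIndep e) (enc_bool (X \in indep K))
        (t + data_size (enc_set X)).+1
  | eval_le_eps env e (a b : nat) t :
      eval A K eps env e (Node (enc_nat a) (enc_nat b)) t ->
      eval A K eps env (ELeEps e) (enc_bool (a%:R <= eps * b%:R))
        (t + data_size (Node (enc_nat a) (enc_nat b))).+1.

Definition outputs (R : realType) (A : program) (K : bmi) (eps : R)
    (X : {set ground K}) (t : nat) : Prop :=
  eval A K eps [:: enc_bmi K] (body A 0) (enc_set X) t.

(* Evaluation is deterministic, so the output and the running time of a program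
   are well defined. *)
Lemma enc_bool_inj : injective enc_bool.
Proof. by case; case. Qed.

Lemma enc_seq_inj : injective enc_seq.
Proof. by elim=> [|x s IH] [|y r] //= [-> /IH ->]. Qed.

Lemma pos_bits_neq0 q : pos_bits q != [::].
Proof. by case: q. Qed.

Lemma pos_bits_inj : injective pos_bits.
Proof.
elim=> [q IH|q IH|] [r|r|] //=.
- by case=> /IH ->.
- by case=> q0; have := pos_bits_neq0 q; rewrite q0.
- by case=> /IH ->.
- by case=> r0; have := pos_bits_neq0 r; rewrite -r0.
Qed.

Lemma nat_bits_inj : injective nat_bits.
Proof.
move=> m n; rewrite /nat_bits => mn; apply: (can_inj bin_of_natK).
case: (bin_of_nat m) (bin_of_nat n) mn => [|q] [|r] //.
- by move=> r0; have := pos_bits_neq0 r; rewrite -r0.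
- by move=> q0; have := pos_bits_neq0 q; rewrite q0.
- by move/pos_bits_inj=> ->.
Qed.

Lemma enc_nat_inj : injective enc_nat.
Proof. by move=> m n /enc_seq_inj/(inj_map enc_bool_inj)/nat_bits_inj. Qed.

Lemma enc_set_inj (E : finType) : injective (@enc_set E).
Proof.
move=> X Y /enc_seq_inj XY; apply/setP=> e; apply: enc_bool_inj.
by move/eq_in_map: XY; apply; rewrite mem_enum.
Qed.

Lemma eval_det (R : realType) (A : program) (K : bmi) (eps : R) env e v t :
  eval A K eps env e v t ->
  forall v' t', eval A K eps env e v' t' -> v = v' /\ t = t'.
Proof.
elim=> {env e v t} [env i|env|env e1 e2 v1 v2 t1 t2 _ IH1 _ IH2
  |env e v t _ IH|env e v t _ IH|env e e1 e2 a b v t t1 _ IH _ IH1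
  |env e e1 e2 v t t2 _ IH _ IH2|env e1 e2 v1 v2 t1 t2 _ IH1 _ IH2
  |env f e v w t1 t2 _ IH1 _ IH2|env e X t _ IH|env e a b t _ IH] v' t' H;
  inversion H; subst => //;
  repeat match goal with
  | IH : forall v' t', eval _ _ _ ?env ?e v' t' -> _ = v' /\ _ = t',
    H : eval _ _ _ ?env ?e _ _ |- _ =>
      let E := fresh "E" in
      case: (IH _ _ H) => E ?; clear IH H;
      first [discriminate E | injection E; intros; subst | subst]
  end => //.
- match goal with
  | E : enc_set _ = enc_set _ |- _ => by move/enc_set_inj: E => ->
  end.
- match goal with
  | E1 : enc_nat a = enc_nat _, E2 : enc_nat b = enc_nat _ |- _ =>
    by move/enc_nat_inj: E1 => ->; move/enc_nat_inj: E2 => ->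
  end.
Qed.

(* Main.v *)
(* Guess the optimal profit up to a factor 2 by a value V, and let l be about
   12/eps. An optimal solution has at most l elements of profit above V/l. Split
   these elements into l^2 classes by profit; from each class keep the first l^2
   elements of a basis of minimum cost, found greedily. By matroid exchange every
   profitable element of an optimal solution can be replaced by a kept one that
   is not more expensive, at the cost of profit 2V/l^2, so the profitable
   elements can be guessed among poly(l)^l sets H. Given H, the elements of
   profit at most V/l are chosen by Lagrangian relaxation: for a multiplier x,
   the greedy algorithm over the matroid contracted by H maximises p - x c. Along
   the path of greedy orders obtained by lowering x through its critical values,
   and within a tie by moving one element at a time from the order by increasing
   cost to the order by decreasing cost, the solution becomes infeasible in a
   single step that inserts one element. Dropping that element makes it feasible
   again and loses at most V/l. Running time is bounded by showing that the
   functions computed in time and output size polynomial in res, the input size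
   plus a bound on the number of guesses, are closed under composition and list
   recursion. *)
Require Import Defs.
From Corelib Require Import BinNums.
From mathcomp Require Import all_boot all_order all_algebra.
From mathcomp Require Import reals exp.
From mathcomp Require Import zify ring lra.

Set Implicit Arguments.
Unset Strict Implicit.
Unset Printing Implicit Defensive.

Import Order.TTheory GRing.Theory Num.Theory.
Local Open Scope nat_scope.

(** The algorithm forms a candidate for every combination of guesses and keeps the best one that
    passes the feasibility test. Wrong guesses are therefore harmless, and correctness reduces to
    the existence of one good candidate. Its loss is [2V/l] from the replacements and [V/l] from the
    dropped element, with [V] at most twice the optimum: altogether [6/l] times the optimum. Hence
    [l] is the least power of two with [6 <= eps * l]. There are at most [(l^4 + 1)^l <= 2^(4 l^2)]
    guessed sets, the only quantity that is not polynomial in the input. The running time refers to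
    an embedded language, so the algorithm is given by total functions on [data], each accompanied
    by the existence of code for it. This shapes the functions. Without closures, every loop passes
    its parameters explicitly. Time bounds must hold on ill-formed data as well. Only nonnegative
    fractions are encoded, so subtraction and division are avoided: a multiplier is represented by a
    pair of elements, and values are compared after cross-multiplication. *)

(** * Polynomial bounds on natural numbers *)

(** One parameter serves as shift and exponent, so a polynomial bound is a single existential over a
    family that is monotone in [x]. *)
Definition bd (c x : nat) : nat := (x + c) ^ c.

Definition polyb (f : nat -> nat) : Prop := exists c, forall x, f x <= bd c x.

Lemma leq_exp m n e : m <= n -> m ^ e <= n ^ e.
Proof. by case: e => // e; rewrite leq_exp2r. Qed.

Lemma bd_mono c x y : x <= y -> bd c x <= bd c y.
Proof. by move=> xy; rewrite /bd leq_exp // leq_add2r. Qed.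

Lemma bd_le a c e x : a <= c -> a <= e -> 0 < c -> bd a x <= (x + c) ^ e.
Proof.
move=> ac ae c0; apply: (@leq_trans ((x + c) ^ a)).
  by rewrite leq_exp // leq_add2l.
by rewrite leq_pexp2l // addn_gt0 c0 orbT.
Qed.

Lemma poly_bd c : polyb (bd c).
Proof. by exists c. Qed.

Lemma poly_add f h : polyb f -> polyb h -> polyb (fun x => f x + h x).
Proof.
move=> [a fa] [b hb]; exists (a + b).+2 => x.
apply: leq_trans (leq_add (fa x) (hb x)) _.
have h1 : bd a x <= (x + (a + b).+2) ^ (a + b) by apply: bd_le; lia.
have h2 : bd b x <= (x + (a + b).+2) ^ (a + b) by apply: bd_le; lia.
rewrite {3}/bd !expnS; move: (bd a x) (bd b x) h1 h2 => u v.
by move: (_ ^ _) => z h1 h2; nia.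
Qed.

Lemma poly_mul f h : polyb f -> polyb h -> polyb (fun x => f x * h x).
Proof.
move=> [a fa] [b hb]; exists (a + b).+1 => x.
apply: leq_trans (leq_mul (fa x) (hb x)) _.
have h1 : bd a x <= (x + (a + b).+1) ^ a by apply: bd_le; lia.
have h2 : bd b x <= (x + (a + b).+1) ^ b by apply: bd_le; lia.
apply: leq_trans (leq_mul h1 h2) _.
by rewrite -expnD /bd leq_pexp2l; lia.
Qed.

Lemma poly_comp f h : polyb f -> polyb h -> polyb (fun x => f (h x)).
Proof.
(* [c] exceeds [a] and [b] and also the exponent [(b + 1) * a] of the composite. *)
move=> [a fa] [b hb]; set c := (a + 2) * (b + 2); exists c => x.
apply: leq_trans (fa _) _; apply: leq_trans (bd_mono _ (hb x)) _.
have h1 : bd b x <= (x + c) ^ b by apply: bd_le; rewrite /c; nia.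
have h2 : bd b x + a <= (x + c) ^ b.+1.
  have z0 : 0 < (x + c) ^ b by rewrite expn_gt0 addn_gt0 /c; lia.
  have ac : a < x + c by rewrite /c; nia.
  rewrite expnS; move: (bd b x) ((x + c) ^ b) (x + c) h1 z0 ac => u v z.
  by nia.
apply: leq_trans (leq_exp a h2) _.
by rewrite -expnM /bd leq_pexp2l // /c; nia.
Qed.

Lemma poly_id : polyb (fun x => x).
Proof. by exists 1 => x; rewrite /bd expn1 leq_addr. Qed.

Lemma poly_const n : polyb (fun=> n).
Proof.
exists n.+1 => x; rewrite /bd; apply: (@leq_trans (x + n.+1)); first by lia.
by rewrite -{1}[x + n.+1]expn1 leq_pexp2l; lia.
Qed.

Ltac polyt := repeat first
  [ assumption | exact: poly_id | exact: poly_const | apply: poly_bd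
  | apply: poly_add | apply: poly_mul
  | match goal with
    | |- polyb (fun x => bd ?c (@?h x)) => apply: (poly_comp (poly_bd c))
    | H : polyb ?f |- polyb (fun x => ?f (@?h x)) => apply: (poly_comp H)
    end ].

Notation dsz := data_size.

Lemma dsz_gt0 d : 0 < dsz d.
Proof. by case: d. Qed.

Lemma dsz_left d : dsz (left_of d) <= dsz d.
Proof. by case: d => //= a b; lia. Qed.

Lemma dsz_right d : dsz (right_of d) <= dsz d.
Proof. by case: d => //= a b; lia. Qed.

(** * Programs with polynomial running time *)

Section Programs.
Variable R : realType.

Record world :=
  World { wK : bmi; weps : R; weps_bounds : (0 < weps < 2^-1)%R }.

(** A power of two allows a search that doubles by prefixing a zero digit, with one comparison
    against [eps] per round. *)
Lemma eps_exp (w : world) : exists t, (6 <= weps w * (2 ^ t)%:R)%R.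
Proof.
have /andP[e0 _] := weps_bounds w.
exists (Num.bound (6 / weps w)%R).
rewrite mulrC -ler_pdivrMr //.
apply: le_trans (ltW (archi_boundP _)) _; first by rewrite divr_ge0 // ltW.
by rewrite ler_nat ltnW // ltn_expl.
Qed.

Definition logell (w : world) : nat := ex_minn (eps_exp w).

Definition ell (w : world) : nat := 2 ^ logell w.

(* The resource in terms of which all running times are polynomial; the second
   summand bounds the number of guessed sets of profitable elements. *)
Definition res (w : world) : nat := bmi_size (wK w) + 2 ^ (4 * ell w ^ 2).

Definition ctx (w : world) : data := enc_bmi (wK w).

(** Calls use absolute positions, so a block of code has a meaning only relative to its place. The
    rest of the program stays arbitrary, which lets blocks be concatenated. *)
Definition frag (B : program) (k : nat) (s : seq expr) : Prop :=
  forall i, i < size s -> body B (k + i) = nth ELeaf s i.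

Lemma frag_cat B k s1 s2 :
  frag B k (s1 ++ s2) -> frag B k s1 /\ frag B (k + size s1) s2.
Proof.
move=> h; split=> i hi.
  by rewrite h ?size_cat ?nth_cat ?hi //; lia.
rewrite -addnA h ?size_cat; last by lia.
by rewrite nth_cat; case: ltnP => [|_]; [lia | congr nth; lia].
Qed.

Lemma frag_cons B k e s :
  frag B k (e :: s) -> body B k = e /\ frag B k.+1 s.
Proof.
move=> h; split; first by rewrite -{1}(addn0 k) h.
by move=> i hi; rewrite addSnnS h.
Qed.

Notation ev B w := (eval B (wK w) (weps w)).

(* F is computed, on pairs of the encoded instance and d, by code that can be
   placed at any position k of a program, in polynomial time and with output of
   polynomial size. *)
Definition pt (F : world -> data -> data) : Prop :=
  exists c n (mk : nat -> seq expr),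
    [/\ forall k, size (mk k) = n,
        forall w d, dsz (F w d) <= bd c (res w + dsz d)
      & forall B k, frag B k (mk k) -> forall w d, exists2 t,
          t <= bd c (res w + dsz d)
          & ev B w [:: Node (ctx w) d] (body B k) (F w d) t].

Lemma pt_intro F f g n (mk : nat -> seq expr) :
  polyb f -> polyb g ->
  (forall k, size (mk k) = n) ->
  (forall w d, dsz (F w d) <= f (res w + dsz d)) ->
  (forall B k, frag B k (mk k) -> forall w d, exists2 t,
     t <= g (res w + dsz d)
     & ev B w [:: Node (ctx w) d] (body B k) (F w d) t) ->
  pt F.
Proof.
move=> pf pg smk sF tF; case: (poly_add pf pg) => c hc; exists c, n, mk.
split=> // [w d|B k fr w d].
  by apply: leq_trans (sF w d) _; apply: leq_trans (hc _); apply: leq_addr.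
case: (tF B k fr w d) => t ht et; exists t => //.
by apply: leq_trans ht _; apply: leq_trans (hc _); apply: leq_addl.
Qed.

Lemma ev_var B w v : ev B w [:: v] (EVar 0) v 1.
Proof. exact: (@eval_var R B (wK w) (weps w) [:: v] 0). Qed.

Lemma ev_ctx B w c d : ev B w [:: Node c d] (ELeft (EVar 0)) c 2.
Proof. exact: (eval_left (ev_var B w (Node c d))). Qed.

Lemma ev_arg B w c d : ev B w [:: Node c d] (ERight (EVar 0)) d 2.
Proof. exact: (eval_right (ev_var B w (Node c d))). Qed.

Lemma ev_call0 B w v k r t :
  ev B w [:: v] (body B k) r t -> ev B w [:: v] (ECall k (EVar 0)) r (1 + t).+1.
Proof. by move=> h; apply: eval_call (ev_var B w v) h. Qed.

Lemma res_gt0 w : 0 < res w.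
Proof. by rewrite addn_gt0 dsz_gt0. Qed.

Lemma pt_id : pt (fun _ d => d).
Proof.
apply: (@pt_intro _ id (fun=> 2) 1 (fun=> [:: ERight (EVar 0)])).
- exact: poly_id.
- exact: poly_const.
- by [].
- by move=> w d; apply: leq_addl.
- move=> B k /frag_cons[-> _] w d; exists 2 => //; exact: ev_arg.
Qed.

Lemma pt_ctx : pt (fun w _ => ctx w).
Proof.
apply: (@pt_intro _ id (fun=> 2) 1 (fun=> [:: ELeft (EVar 0)])).
- exact: poly_id.
- exact: poly_const.
- by [].
- by move=> w d; rewrite /res /bmi_size /ctx; lia.
- move=> B k /frag_cons[-> _] w d; exists 2 => //; exact: ev_ctx.
Qed.

Lemma pt_leaf : pt (fun _ _ => Leaf).
Proof.
apply: (@pt_intro _ (fun=> 1) (fun=> 1) 1 (fun=> [:: ELeaf])).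
- exact: poly_const.
- exact: poly_const.
- by [].
- by [].
- move=> B k /frag_cons[-> _] w d; exists 1 => //; exact: eval_leaf.
Qed.

Lemma pt_node F G :
  pt F -> pt G -> pt (fun w d => Node (F w d) (G w d)).
Proof.
move=> [c1 [n1 [mk1 [s1 z1 t1]]]] [c2 [n2 [mk2 [s2 z2 t2]]]].
apply: (@pt_intro _ (fun x => bd c1 x + bd c2 x + 1)
  (fun x => bd c1 x + bd c2 x + 5) (n1 + n2).+1
  (fun k => ENode (ECall k.+1 (EVar 0)) (ECall (k.+1 + n1) (EVar 0))
    :: mk1 k.+1 ++ mk2 (k.+1 + n1))); try by polyt.
- by move=> k; rewrite /= size_cat s1 s2.
- by move=> w d /=; have := z1 w d; have := z2 w d; lia.
- move=> B k /frag_cons[-> /frag_cat[f1]]; rewrite s1 => f2 w d.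
  have [u1 b1 e1] := t1 _ _ f1 w d; have [u2 b2 e2] := t2 _ _ f2 w d.
  exists ((1 + u1).+1 + (1 + u2).+1).+1; first by lia.
  by apply: eval_node; apply: ev_call0.
Qed.

Lemma pt_left F : pt F -> pt (fun w d => left_of (F w d)).
Proof.
move=> [c1 [n1 [mk1 [s1 z1 t1]]]].
apply: (@pt_intro _ (bd c1) (fun x => bd c1 x + 5) n1.+1
  (fun k => ELeft (ECall k.+1 (EVar 0)) :: mk1 k.+1)); try by polyt.
- by move=> k; rewrite /= s1.
- by move=> w d; apply: leq_trans (dsz_left _) (z1 w d).
- move=> B k /frag_cons[-> f1] w d.
  have [u1 b1 e1] := t1 _ _ f1 w d; exists (1 + u1).+2; first by lia.
  by apply: eval_left; apply: ev_call0.
Qed.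

Lemma pt_right F : pt F -> pt (fun w d => right_of (F w d)).
Proof.
move=> [c1 [n1 [mk1 [s1 z1 t1]]]].
apply: (@pt_intro _ (bd c1) (fun x => bd c1 x + 5) n1.+1
  (fun k => ERight (ECall k.+1 (EVar 0)) :: mk1 k.+1)); try by polyt.
- by move=> k; rewrite /= s1.
- by move=> w d; apply: leq_trans (dsz_right _) (z1 w d).
- move=> B k /frag_cons[-> f1] w d.
  have [u1 b1 e1] := t1 _ _ f1 w d; exists (1 + u1).+2; first by lia.
  by apply: eval_right; apply: ev_call0.
Qed.

Definition dif (c a b : data) : data := if c is Node _ _ then a else b.

Lemma pt_if C F G :
  pt C -> pt F -> pt G -> pt (fun w d => dif (C w d) (F w d) (G w d)).
Proof.
move=> [c0 [n0 [mk0 [s0 z0 t0]]]].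
move=> [c1 [n1 [mk1 [s1 z1 t1]]]] [c2 [n2 [mk2 [s2 z2 t2]]]].
apply: (@pt_intro _ (fun x => bd c1 x + bd c2 x)
  (fun x => bd c0 x + bd c1 x + bd c2 x + 9) (n0 + (n1 + n2)).+1
  (fun k => EIf (ECall k.+1 (EVar 0)) (ECall (k.+1 + n0) (EVar 0))
                (ECall (k.+1 + n0 + n1) (EVar 0))
    :: mk0 k.+1 ++ mk1 (k.+1 + n0) ++ mk2 (k.+1 + n0 + n1))); try by polyt.
- by move=> k; rewrite /= !size_cat s0 s1 s2.
- by move=> w d /=; have := z1 w d; have := z2 w d; case: (C w d) => /=; lia.
- move=> B k /frag_cons[-> /frag_cat[f0]]; rewrite s0.
  move=> /frag_cat[f1]; rewrite s1 => f2 w d.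
  have [u0 b0 e0] := t0 _ _ f0 w d.
  have [u1 b1 e1] := t1 _ _ f1 w d; have [u2 b2 e2] := t2 _ _ f2 w d.
  case: (C w d) e0 => [|a b] e0 /=.
    exists ((1 + u0).+1 + (1 + u2).+1).+1; first by lia.
    by apply: eval_if_false; apply: ev_call0.
  exists ((1 + u0).+1 + (1 + u1).+1).+1; first by lia.
  by apply: eval_if_true; apply: ev_call0; first exact: e0.
Qed.

Lemma pt_comp G F : pt G -> pt F -> pt (fun w d => G w (F w d)).
Proof.
move=> [c1 [n1 [mk1 [s1 z1 t1]]]] [c2 [n2 [mk2 [s2 z2 t2]]]].
apply: (@pt_intro _ (fun x => bd c1 (x + bd c2 x))
  (fun x => bd c1 (x + bd c2 x) + bd c2 x + 9) (n1 + n2).+1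
  (fun k => ECall k.+1 (ENode (ELeft (EVar 0)) (ECall (k.+1 + n1) (EVar 0)))
    :: mk1 k.+1 ++ mk2 (k.+1 + n1))); try by polyt.
- by move=> k; rewrite /= size_cat s1 s2.
- move=> w d /=; apply: leq_trans (z1 w _) (bd_mono _ _).
  by have := z2 w d; lia.
- move=> B k /frag_cons[-> /frag_cat[f1]]; rewrite s1 => f2 w d.
  have [u2 b2 e2] := t2 _ _ f2 w d; have [u1 b1 e1] := t1 _ _ f1 w (F w d).
  exists ((2 + (1 + u2).+1).+1 + u1).+1; last first.
    apply: eval_call e1; apply: eval_node; [exact: ev_ctx | exact: ev_call0].
  have : bd c1 (res w + dsz (F w d))
       <= bd c1 (res w + dsz d + bd c2 (res w + dsz d)).
    by apply: bd_mono; have := z2 w d; lia.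
  lia.
Qed.

(* Recursion over the list l with a parameter p that n updates on the way down;
   all loops of the algorithm are instances. *)
Fixpoint rec (b n s : data -> data) (l p : data) : data :=
  if l is Node a l' then
    s (Node p (Node l (rec b n s l' (n (Node p l)))))
  else b p.

(** Iterating a polynomial function may produce exponential growth. The invariant that prevents it:
    all parameters and partial results met during the recursion have size at most [N]. *)
Fixpoint recb (b n s : data -> data) (N : nat) (l p : data) : Prop :=
  [/\ dsz p <= N, dsz (rec b n s l p) <= N
    & if l is Node a l' then recb b n s N l' (n (Node p l)) else True].

Lemma recb_le b n s N l p : recb b n s N l p ->
  dsz p <= N /\ dsz (rec b n s l p) <= N.
Proof. by case: l => [|a l] /= []. Qed.

Definition loop_code k kb kn ks :=
  let c := ELeft (EVar 0) in
  let p := ELeft (ERight (EVar 0)) in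
  let l := ERight (ERight (EVar 0)) in
  EIf l
    (ECall ks (ENode c (ENode p (ENode l
      (ECall k (ENode c (ENode (ECall kn (ENode c (ENode p l)))
                               (ERight l))))))))
    (ECall kb (ENode c p)).

Lemma ev_p B w c p l :
  ev B w [:: Node c (Node p l)] (ELeft (ERight (EVar 0))) p 3.
Proof. exact: (eval_left (ev_arg B w c (Node p l))). Qed.

Lemma ev_l B w c p l :
  ev B w [:: Node c (Node p l)] (ERight (ERight (EVar 0))) l 3.
Proof. exact: (eval_right (ev_arg B w c (Node p l))). Qed.

Lemma loop_ev B w k kb kn ks (b n s : data -> data) (Tb Tn Ts : nat -> nat) N M :
  body B k = loop_code k kb kn ks ->
  {homo Tb : x y / x <= y} -> {homo Tn : x y / x <= y} ->
  {homo Ts : x y / x <= y} ->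
  (forall d, exists2 t, t <= Tb (dsz d)
     & ev B w [:: Node (ctx w) d] (body B kb) (b d) t) ->
  (forall d, exists2 t, t <= Tn (dsz d)
     & ev B w [:: Node (ctx w) d] (body B kn) (n d) t) ->
  (forall d, exists2 t, t <= Ts (dsz d)
     & ev B w [:: Node (ctx w) d] (body B ks) (s d) t) ->
  forall l p, recb b n s N l p -> dsz l <= M ->
  exists2 t, t <= dsz l * (Tb N + Tn (N + M).+1 + Ts (N + M + N).+2 + 50)
     & ev B w [:: Node (ctx w) (Node p l)] (body B k) (rec b n s l p) t.
Proof.
move=> Bk mb mn ms hb hn hs; elim=> [|a _ l IH] p H lM.
  have [pN _ _] := H; have [u bu eu] := hb p.
  exists (3 + ((2 + 3).+1 + u).+1).+1; last first.
    rewrite Bk; apply: eval_if_false; first exact: ev_l.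
    apply: eval_call eu; apply: eval_node; [exact: ev_ctx | exact: ev_p].
  have := mb _ _ pN; rewrite /=; lia.
have [pN rN H'] := H; have [p'N r'N] := recb_le H'.
have [| u1 b1 e1] := IH _ H'; first by rewrite /= in lM; lia.
have [u2 b2 e2] := hn (Node p (Node a l)).
have [u3 b3 e3] :=
  hs (Node p (Node (Node a l) (rec b n s l (n (Node p (Node a l)))))).
eexists; last first.
  rewrite Bk; apply: eval_if_true; first exact: ev_l.
  apply: eval_call e3; apply: eval_node; first exact: ev_ctx.
  apply: eval_node; first exact: ev_p.
  apply: eval_node; first exact: ev_l.
  apply: eval_call e1; apply: eval_node; first exact: ev_ctx.
  apply: eval_node; last exact: (eval_right (ev_l _ _ _ _ _)).
  apply: eval_call e2; apply: eval_node; first exact: ev_ctx.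
  by apply: eval_node; [exact: ev_p | exact: ev_l].
have B2 : u2 <= Tn (N + M).+1.
  by apply: leq_trans b2 (mn _ _ _); rewrite /= in lM *; lia.
have B3 : u3 <= Ts (N + M + N).+2.
  by apply: leq_trans b3 (ms _ _ _); rewrite /= in lM *; lia.
rewrite [dsz (Node a l)]/= mulSn mulnDl; lia.
Qed.

Lemma pt_rec (b n s L P : world -> data -> data) f :
  pt b -> pt n -> pt s -> pt L -> pt P -> polyb f ->
  (forall w d, recb (b w) (n w) (s w) (f (res w + dsz d)) (L w d) (P w d)) ->
  pt (fun w d => rec (b w) (n w) (s w) (L w d) (P w d)).
Proof.
move=> [c1 [n1 [mk1 [s1 z1 t1]]]] [c2 [n2 [mk2 [s2 z2 t2]]]].
move=> [c3 [n3 [mk3 [s3 z3 t3]]]] [c4 [n4 [mk4 [s4 z4 t4]]]].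
move=> [c5 [n5 [mk5 [s5 z5 t5]]]] pf H.
apply: (@pt_intro _ f
  (fun x => bd c4 x * (bd c1 (x + f x) + bd c2 (x + (f x + bd c4 x + 1))
     + bd c3 (x + (f x + bd c4 x + f x + 2)) + 50) + bd c4 x + bd c5 x + 20)
  (n1 + (n2 + (n3 + (n4 + n5)))).+2
  (fun k => let k1 := k.+2 in let k2 := k1 + n1 in let k3 := k2 + n2 in
    let k4 := k3 + n3 in let k5 := k4 + n4 in
    ECall k.+1 (ENode (ELeft (EVar 0))
      (ENode (ECall k5 (EVar 0)) (ECall k4 (EVar 0))))
    :: loop_code k.+1 k1 k2 k3
    :: mk1 k1 ++ mk2 k2 ++ mk3 k3 ++ mk4 k4 ++ mk5 k5)).
- by [].
- by polyt.
- by move=> k; rewrite /= !size_cat s1 s2 s3 s4 s5.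
- by move=> w d; have [] := recb_le (H w d).
- move=> B k /frag_cons[-> /frag_cons[Bk /frag_cat[f1]]]; rewrite s1.
  move=> /frag_cat[f2]; rewrite s2 => /frag_cat[f3]; rewrite s3.
  move=> /frag_cat[f4]; rewrite s4 => f5 w d.
  have [u4 b4 e4] := t4 _ _ f4 w d; have [u5 b5 e5] := t5 _ _ f5 w d.
  set x := res w + dsz d in b4 b5 *.
  have [] := @loop_ev B w k.+1 _ _ _ (b w) (n w) (s w)
    (fun y => bd c1 (x + y)) (fun y => bd c2 (x + y)) (fun y => bd c3 (x + y))
    (f x) (bd c4 x) Bk _ _ _ _ _ _ (L w d) (P w d) (H w d) (z4 w d).
  + by move=> y z yz; apply: bd_mono; lia.
  + by move=> y z yz; apply: bd_mono; lia.
  + by move=> y z yz; apply: bd_mono; lia.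
  + move=> d'; have [t ht et] := t1 _ _ f1 w d'; exists t => //.
    by apply: leq_trans ht (bd_mono _ _); rewrite /x; lia.
  + move=> d'; have [t ht et] := t2 _ _ f2 w d'; exists t => //.
    by apply: leq_trans ht (bd_mono _ _); rewrite /x; lia.
  + move=> d'; have [t ht et] := t3 _ _ f3 w d'; exists t => //.
    by apply: leq_trans ht (bd_mono _ _); rewrite /x; lia.
  move=> u bu eu.
  exists ((2 + ((1 + u5).+1 + (1 + u4).+1).+1).+1 + u).+1; last first.
    apply: eval_call eu; apply: eval_node; first exact: ev_ctx.
    by apply: eval_node; apply: ev_call0.
  have : u <= bd c4 x * (bd c1 (x + f x) + bd c2 (x + (f x + bd c4 x + 1))
     + bd c3 (x + (f x + bd c4 x + f x + 2)) + 50).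
    rewrite addn1 addn2; apply: leq_trans bu _.
    by rewrite leq_mul2r z4 orbT.
  lia.
Qed.

Lemma recb_bound (b n s : data -> data) N M Q A :
  (forall p l, dsz l <= M -> dsz (n (Node p l)) <= dsz p + A) ->
  (forall l p, dsz l <= M -> dsz p <= Q -> dsz p + dsz l * A <= Q ->
     dsz (rec b n s l p) <= N) ->
  Q <= N ->
  forall l p, dsz l <= M -> dsz p + dsz l * A <= Q -> recb b n s N l p.
Proof.
move=> hn hr QN; elim=> [|a _ l IH] p lM pQ; split=> //.
- by lia.
- by apply: hr => //; lia.
- by lia.
- by apply: hr => //; lia.
have np := hn p (Node a l) lM.
by rewrite /= in lM pQ; apply: IH; nia.
Qed.

(** For loops whose result is bounded a priori, such as products and sums, where sizes are
    controlled through digit counts. The parameter may grow only additively, hence stays polynomial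
    along the list. *)
Lemma pt_recI (b n s L P : world -> data -> data) h0 h1 :
  pt b -> pt n -> pt s -> pt L -> pt P ->
  polyb h0 -> {homo h0 : x y / x <= y} -> polyb h1 -> {homo h1 : x y / x <= y} ->
  (forall w p l, dsz (n w (Node p l)) <= dsz p + h0 (res w + dsz l)) ->
  (forall w l p, dsz (rec (b w) (n w) (s w) l p) <= h1 (res w + dsz l + dsz p)) ->
  pt (fun w d => rec (b w) (n w) (s w) (L w d) (P w d)).
Proof.
move=> pb pn ps pL pP q0 m0 q1 m1 hn hr.
have [cL [nL [mL [sL zL tL]]]] := pL; have [cP [nP [mP [sP zP tP]]]] := pP.
pose q x := bd cP x + bd cL x * h0 (x + bd cL x).
apply: (@pt_rec _ _ _ _ _ (fun x => q x + h1 (x + bd cL x + q x))) => //.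
  apply: poly_add; first by rewrite /q; polyt.
  by apply: (poly_comp q1); rewrite /q; polyt.
move=> w d; set x := res w + dsz d; have rx : res w <= x by apply: leq_addr.
have ML : dsz (L w d) <= bd cL x by apply: zL.
apply: (@recb_bound _ _ _ _ (bd cL x) (q x) (h0 (x + bd cL x))) => //.
- by move=> p l lM; apply: leq_trans (hn _ _ _) _; rewrite leq_add2l m0; lia.
- move=> l p lM pQ _; apply: leq_trans (hr _ _ _) _.
  by apply: leq_trans (leq_addl _ _); apply: m1; lia.
- exact: leq_addr.
- by rewrite /q leq_add ?zP // leq_mul2r ML orbT.
Qed.

(** The usual case: each step adds to the result an amount that does not depend on the result
    itself, so the bound follows from the steps alone. *)
Lemma pt_recS (b n s L P : world -> data -> data) h0 h1 :
  pt b -> pt n -> pt s -> pt L -> pt P ->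
  polyb h0 -> {homo h0 : x y / x <= y} -> polyb h1 -> {homo h1 : x y / x <= y} ->
  (forall w p l, dsz (n w (Node p l)) <= dsz p + h0 (res w + dsz l)) ->
  (forall w p l r, dsz (s w (Node p (Node l r)))
     <= dsz r + h1 (res w + dsz l + dsz p)) ->
  pt (fun w d => rec (b w) (n w) (s w) (L w d) (P w d)).
Proof.
move=> pb pn ps pL pP q0 m0 q1 m1 hn hs.
have [cb [nb [mb [sb zb tb]]]] := pb.
pose q x := x + x * h0 x.
apply: (@pt_recI _ _ _ _ _ h0
  (fun x => bd cb (x + q x) + x * h1 (x + q x))) => //.
- by rewrite /q; polyt.
- move=> x y xy; have m := m0 _ _ xy.
  have qq : q x <= q y by rewrite /q leq_add // leq_mul.
  have xq : x + q x <= y + q y by apply: leq_add.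
  by apply: leq_add; [apply: bd_mono | apply: leq_mul => //; apply: m1].
move=> w l0 p0; set x := res w + dsz l0 + dsz p0.
have [rx lx px] : [/\ res w <= x, dsz l0 <= x & dsz p0 <= x] by rewrite /x; split; lia.
suff H l p : dsz l <= dsz l0 -> dsz p + dsz l * h0 x <= q x ->
    dsz (rec (b w) (n w) (s w) l p) <= bd cb (x + q x) + dsz l * h1 (x + q x).
  have q0x : dsz p0 + dsz l0 * h0 x <= q x by rewrite leq_add ?leq_mul.
  by apply: leq_trans (H l0 p0 (leqnn _) q0x) _; rewrite leq_add2l leq_mul.
elim: l p => [|a _ l IH] p lM pQ.
  by apply: leq_trans (zb w p) _; apply: leq_trans (leq_addr _ _); apply: bd_mono;
     lia.
have np := hn w p (Node a l).
have m1' : h0 (res w + dsz (Node a l)) <= h0 x by apply: m0; lia.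
rewrite [rec _ _ _ _ _]/=; apply: leq_trans (hs _ _ _ _) _.
have m2 : h1 (res w + dsz (Node a l) + dsz p) <= h1 (x + q x).
  by apply: m1; lia.
have la : dsz l < dsz (Node a l) by rewrite /=; lia.
apply: leq_trans (leq_add (IH _ _ _) m2) _.
- by lia.
- have np' := leq_trans np (leq_add (leqnn (dsz p)) m1').
  apply: leq_trans pQ; apply: leq_trans (leq_add np' (leqnn _)) _.
  by rewrite -addnA -mulSn leq_add2l leq_mul2r la orbT.
- by rewrite -addnA -mulSnr leq_add2l leq_mul2r la orbT.
Qed.

End Programs.

(** * The algorithm *)

(* The suffix D marks functions on encoded data; they are total and behave as
   intended on encodings. *)
Definition dtrue : data := Node Leaf Leaf.

Definition xorD a b := dif a (dif b Leaf dtrue) (dif b dtrue Leaf).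
Definition andD a b := dif a (dif b dtrue Leaf) Leaf.
Definition majD a b c := dif a (dif b dtrue (dif c dtrue Leaf)) (andD b c).

(* Components of the arguments Node p l and Node p (Node l r) of the functions
   iterated by rec. *)
Notation par d := (left_of d).
Notation lst d := (left_of (right_of d)).
Notation hd d := (left_of (left_of (right_of d))).
Notation acc d := (right_of (right_of d)).
Notation nhd d := (left_of (right_of d)).

Definition catD x y :=
  rec id (fun d => par d) (fun d => Node (hd d) (acc d)) x y.

(** The results of [f] are lists and are concatenated, so mapping, filtering and nested loops are
    all instances. The parameter [p] plays the role of a closure. *)
Definition fmap (f : data -> data) p l :=
  rec (fun _ => Leaf) (fun d => par d)
    (fun d => catD (f (Node (par d) (hd d))) (acc d)) l p.

(* Numbers are lists of binary digits, least significant first. *)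
Definition incD y c :=
  rec (fun c => dif c (Node dtrue Leaf) Leaf)
    (fun d => andD (par d) (nhd d))
    (fun d => Node (xorD (par d) (hd d)) (acc d)) y c.

Definition addD x y c :=
  rec (fun p => incD (left_of p) (right_of p))
    (fun d => Node (right_of (left_of (par d)))
       (majD (nhd d) (left_of (left_of (par d))) (right_of (par d))))
    (fun d => Node (xorD (hd d)
       (xorD (left_of (left_of (par d))) (right_of (par d)))) (acc d))
    x (Node y c).

Definition mulD x y :=
  rec (fun _ => Leaf) (fun d => par d)
    (fun d => dif (hd d) (addD (Node Leaf (acc d)) (par d) Leaf)
                (Node Leaf (acc d))) x y.

Definition nzD y :=
  rec (fun _ => Leaf) (fun d => par d) (fun d => dif (hd d) dtrue (acc d))
    y Leaf.

(** Digits arrive least significant first, so the verdict on the digits read travels in the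
    parameter and each later difference overrides it. It starts with [dtrue] because equality
    counts. *)
Definition leD x y :=
  rec (fun p => dif (nzD (left_of p)) dtrue (right_of p))
    (fun d => Node (right_of (left_of (par d)))
       (dif (nhd d)
          (dif (left_of (left_of (par d))) (right_of (par d)) Leaf)
          (dif (left_of (left_of (par d))) dtrue (right_of (par d)))))
    (fun d => acc d) x (Node y dtrue).

(** Fractions are never reduced; [dsz_sum] shows that the denominators remain polynomial. *)
Definition qaddD x y :=
  Node (addD (mulD (left_of x) (right_of y)) (mulD (right_of x) (left_of y))
          Leaf)
    (mulD (right_of x) (right_of y)).

Definition qmulD x y :=
  Node (mulD (left_of x) (left_of y)) (mulD (right_of x) (right_of y)).

Definition qleD x y :=
  leD (mulD (left_of x) (right_of y)) (mulD (left_of y) (right_of x)).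

Definition zeroD : data := Node Leaf (Node dtrue Leaf).
Definition oneD : data := Node (Node dtrue Leaf) (Node dtrue Leaf).

Definition sumD l :=
  rec (fun _ => zeroD) (fun d => par d) (fun d => qaddD (hd d) (acc d)) l Leaf.

Definition numD l :=
  rec (fun _ => Leaf) (fun d => par d) (fun d => incD (acc d) dtrue) l Leaf.

(* Sets are characteristic vectors. *)
Definition vorD x y :=
  rec (fun _ => Leaf) (fun d => right_of (par d))
    (fun d => Node (dif (hd d) dtrue (dif (left_of (par d)) dtrue Leaf))
                (acc d)) x y.

Definition vdiffD x y :=
  rec (fun _ => Leaf) (fun d => right_of (par d))
    (fun d => Node (dif (left_of (par d)) Leaf (dif (hd d) dtrue Leaf))
                (acc d)) x y.

Definition disjD x y :=
  rec (fun _ => dtrue) (fun d => right_of (par d))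
    (fun d => dif (andD (hd d) (left_of (par d))) Leaf (acc d)) x y.

(* All splittings of a list into a reversed prefix and a nonempty suffix. *)
Definition splitsD l :=
  rec (fun _ => Leaf) (fun d => Node (nhd d) (par d))
    (fun d => Node (Node (par d) (lst d)) (acc d)) l Leaf.

Definition firstD k l :=
  rec (fun _ => Leaf) (fun d => right_of (par d))
    (fun d => dif (par d) (Node (hd d) (acc d)) Leaf) l k.

(* An element is represented by its singleton, its cost and its profit. *)
Notation dvec e := (left_of e).
Notation dcost e := (left_of (right_of e)).
Notation dprof e := (right_of (right_of e)).

Definition botD : data := Node Leaf (Node zeroD zeroD).
Definition ucostD : data := Node Leaf (Node oneD zeroD).
Definition uprofD : data := Node Leaf (Node zeroD oneD).

(* A pair q of elements stands for the direction (c_e - c_f, p_e - p_f). *)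
Definition cmpD q a b :=
  let e := left_of q in let f := right_of q in
  qleD
    (qaddD (qaddD (qmulD (dprof a) (dcost f)) (qmulD (dprof b) (dcost e)))
           (qaddD (qmulD (dcost a) (dprof e)) (qmulD (dcost b) (dprof f))))
    (qaddD (qaddD (qmulD (dprof a) (dcost e)) (qmulD (dprof b) (dcost f)))
           (qaddD (qmulD (dcost a) (dprof f)) (qmulD (dcost b) (dprof e)))).

Definition insD q x l :=
  rec (fun p => Node (right_of p) Leaf) (fun d => par d)
    (fun d => dif (cmpD (left_of (par d)) (right_of (par d)) (hd d))
       (Node (right_of (par d)) (lst d)) (Node (hd d) (acc d))) l (Node q x).

Definition sortD q l :=
  rec (fun _ => Leaf) (fun d => par d) (fun d => insD (par d) (hd d) (acc d))
    l q.

Definition cutD l :=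
  rec (fun _ => Leaf) (fun d => par d)
    (fun d => dif (dvec (hd d)) (Node (hd d) (acc d)) Leaf) l Leaf.

Arguments catD : simpl never.
Arguments fmap : simpl never.
Arguments incD : simpl never.
Arguments addD : simpl never.
Arguments mulD : simpl never.
Arguments nzD : simpl never.
Arguments leD : simpl never.
Arguments qaddD : simpl never.
Arguments qmulD : simpl never.
Arguments qleD : simpl never.
Arguments sumD : simpl never.
Arguments numD : simpl never.
Arguments vorD : simpl never.
Arguments vdiffD : simpl never.
Arguments disjD : simpl never.
Arguments splitsD : simpl never.
Arguments firstD : simpl never.
Arguments cmpD : simpl never.
Arguments insD : simpl never.
Arguments sortD : simpl never.
Arguments cutD : simpl never.

Lemma map_index_iota (T : eqType) (s : seq T) :
  uniq s -> [seq index e s | e <- s] = iota 0 (size s).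
Proof.
case: s => // e0 s us; apply: (@eq_from_nth _ 0).
  by rewrite size_map size_iota.
move=> i; rewrite size_map => hi.
by rewrite nth_iota // (nth_map e0) // index_uniq.
Qed.

Section Worlds.
Variable R : realType.
Implicit Type w : world R.

(** The parameter collects a zero for every element passed, which gives the part of the singleton in
    front of its one. As a list, [dtrue] is a single [Leaf], so mapping to [dtrue] produces a list
    of zeros. *)
Definition elemsD w :=
  rec (fun _ => Leaf) (fun d => Node Leaf (par d))
    (fun d => Node (Node (catD (par d)
         (Node dtrue (fmap (fun _ => dtrue) Leaf (right_of (lst d)))))
       (hd d)) (acc d)) (right_of (ctx w)) Leaf.

Definition zerosD w := fmap (fun _ => dtrue) Leaf (elemsD w).

(** The oracle is stuck on arguments that are not characteristic vectors. Padding or cutting to the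
    length of the ground set makes the oracle call total. *)
Definition normD w d :=
  rec (fun _ => Leaf) (fun d => right_of (par d))
    (fun d => Node (dif (left_of (par d)) dtrue Leaf) (acc d))
    (right_of (ctx w)) d.

Definition isn (d : data) : bool := if d is Node _ _ then true else false.

Definition dnth (d : data) (i : nat) : data := left_of (iter i right_of d).

Definition decset w (d : data) : {set ground (wK w)} :=
  [set e | isn (dnth d (index e (enum (ground (wK w)))))].

Definition indepD w (d : data) : data :=
  enc_bool (decset w d \in indep (wK w)).

Definition greedyD w l X :=
  rec id (fun d => dif (indepD w (vorD (par d) (dvec (nhd d))))
            (vorD (par d) (dvec (nhd d))) (par d)) (fun d => acc d) l X.

Definition costD w X :=
  sumD (fmap (fun d => dif (disjD (dvec (right_of d)) (left_of d)) Leaf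
                         (Node (dcost (right_of d)) Leaf)) X (elemsD w)).

Definition profD w X :=
  sumD (fmap (fun d => dif (disjD (dvec (right_of d)) (left_of d)) Leaf
                         (Node (dprof (right_of d)) Leaf)) X (elemsD w)).

Definition findD w : data := iter (logell w) (Node Leaf) (Node dtrue Leaf).

(** In unary, as a loop counter. After its first digit, the binary form of [2 ^ logell] has [logell]
    digits, and each doubles the list. *)
Definition ellD w : data :=
  rec (fun _ => dtrue) (fun d => par d) (fun d => catD (acc d) (acc d))
    (right_of (findD w)) Leaf.

Definition unitsD w : data :=
  fmap (fun _ => fmap (fun _ => dtrue) Leaf (ellD w)) Leaf (ellD w).

(** [Node uprofD botD] is the direction [(0, 1)], for which sorting means increasing cost. *)
Definition basisD w (th : data) : data :=
  let s := sortD (Node uprofD botD)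
    (fmap (fun d => dif (qleD (left_of d) (dprof (right_of d)))
                      (Node (right_of d) Leaf) Leaf) th (elemsD w)) in
  firstD (unitsD w)
    (fmap (fun d => dif (disjD (dvec (right_of d)) (left_of d)) Leaf
                      (Node (right_of d) Leaf)) (greedyD w s (zerosD w)) s).

(** The nonempty suffixes of the unary list of length [ell ^ 2] supply the numerators [j] of the
    thresholds [j V / ell ^ 2]. *)
Definition reprD w (V : data) : data :=
  fmap (fun d => basisD w
      (Node (mulD (numD (right_of (right_of d))) (left_of (left_of d)))
            (mulD (numD (unitsD w)) (right_of (left_of d)))))
    V (splitsD (unitsD w)).

Definition guessD w (l : data) : data :=
  rec (fun _ => Node (zerosD w) Leaf) (fun d => par d)
    (fun d => catD (acc d)
       (fmap (fun d1 => fmap (fun d2 =>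
             Node (vorD (dvec (left_of d2)) (right_of d2)) Leaf)
           (right_of d1) (left_of d1)) (acc d) (par d)))
    (ellD w) l.

Definition lightD w V H : data :=
  fmap (fun d => let e := right_of d in let V := left_of (left_of d) in
      dif (qleD (dprof e)
             (Node (left_of V) (mulD (numD (ellD w)) (right_of V))))
        (dif (disjD (dvec e) (right_of (left_of d))) (Node e Leaf) Leaf) Leaf)
    (Node V H) (elemsD w).

(** Sorting is stable, so the two inner sorts fix the order within ties: the reversed prefix with
    [x] by decreasing cost, then the suffix by increasing cost. The final difference drops [x]; it
    removes nothing if [x] is [botD], whose vector is empty. *)
Definition candD w H q s : data :=
  let x := left_of (right_of s) in
  vdiffD
    (greedyD w (cutD (sortD q (catD
        (sortD (Node botD uprofD) (Node x (left_of s)))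
        (sortD (Node uprofD botD) (right_of (right_of s)))))) H)
    (dvec x).

(** All multiples of a single profit by [1] up to the size of the ground set, the factor being the
    length of a suffix. *)
Definition valuesD w : data :=
  fmap (fun d => fmap (fun d1 =>
      Node (Node (mulD (numD (right_of (right_of d1)))
                       (left_of (dprof (left_of d1))))
                 (right_of (dprof (left_of d1)))) Leaf)
    (right_of d) (splitsD (elemsD w))) Leaf (elemsD w).

(** The pair of [ucostD] and [botD] represents the multiplier 0. Pairs that represent no multiplier
    merely contribute further candidates. *)
Definition dirsD w : data :=
  let l := Node botD (Node ucostD (elemsD w)) in
  fmap (fun d => fmap (fun d1 => Node d1 Leaf) (right_of d) (left_of d)) l l.

Definition candsVHD w V H : data :=
  fmap (fun d => fmap (fun d1 =>
        Node (candD w (left_of (left_of d1)) (right_of (left_of d1))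
                (right_of d1)) Leaf)
      (Node (left_of (left_of d)) (right_of d))
      (splitsD (right_of (left_of d))))
    (Node H (Node botD (lightD w V H))) (dirsD w).

Definition candsD w : data :=
  fmap (fun d => fmap (fun d1 => candsVHD w (left_of d1) (right_of d1))
      (right_of d) (guessD w (reprD w (right_of d)))) Leaf (valuesD w).

Definition bestD w l : data :=
  rec (fun _ => zerosD w) (fun d => par d)
    (fun d => dif (indepD w (hd d))
       (dif (qleD (costD w (hd d)) (left_of (ctx w)))
         (dif (qleD (profD w (acc d)) (profD w (hd d))) (hd d) (acc d))
         (acc d)) (acc d)) l Leaf.

Definition mainD w : data := bestD w (candsD w).

Arguments elemsD : simpl never.
Arguments zerosD : simpl never.
Arguments normD : simpl never.
Arguments indepD : simpl never.
Arguments greedyD : simpl never.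
Arguments costD : simpl never.
Arguments profD : simpl never.
Arguments findD : simpl never.
Arguments ellD : simpl never.
Arguments unitsD : simpl never.
Arguments basisD : simpl never.
Arguments reprD : simpl never.
Arguments guessD : simpl never.
Arguments lightD : simpl never.
Arguments candD : simpl never.
Arguments valuesD : simpl never.
Arguments dirsD : simpl never.
Arguments candsVHD : simpl never.
Arguments candsD : simpl never.
Arguments bestD : simpl never.
Arguments mainD : simpl never.

(** * Polynomial running time of the functions *)

Implicit Types F G X Y Z L P : world R -> data -> data.

(** [pt_call] is rebound whenever more functions are known to be polynomial, so later proofs stop
    unfolding at them. *)
Ltac pt_call := fail.
Ltac pts := repeat (cbv beta; lazymatch goal with
  | |- pt (fun _ d => d) => exact: pt_id
  | |- pt (fun _ _ => Leaf) => exact: pt_leaf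
  | |- pt (fun w _ => ctx w) => exact: pt_ctx
  | |- pt (fun _ _ => dif _ _ _) => apply: pt_if
  | |- pt (fun _ _ => Node _ _) => apply: pt_node
  | |- pt (fun _ _ => left_of _) => apply: pt_left
  | |- pt (fun _ _ => right_of _) => apply: pt_right
  | |- pt (fun _ => id) => exact: pt_id
  | |- pt (fun _ _ => dtrue) => rewrite /dtrue
  | |- pt (fun _ _ => xorD _ _) => rewrite /xorD
  | |- pt (fun _ _ => majD _ _ _) => rewrite /majD
  | |- pt (fun _ _ => andD _ _) => rewrite /andD
  | |- pt _ => first [assumption | pt_call]
  end).
Ltac mono := let x := fresh in let y := fresh in let xy := fresh in
  move=> x y xy; try nia.

Lemma dsz_cat x y : dsz (catD x y) = (dsz x + dsz y).-1.
Proof. by elim: x => [|a _ x IH] //=; move: IH; rewrite /catD /= => ->; have := dsz_gt0 x; lia. Qed.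

Lemma pt_cat X Y : pt X -> pt Y -> pt (fun w d => catD (X w d) (Y w d)).
Proof.
move=> pX pY; apply: (pt_recS (h0 := fun=> 0) (h1 := fun x => x + 1)); pts.
- by polyt.
- by mono.
- by polyt.
- by mono.
- by move=> w p l /=; lia.
- by move=> w p l r /=; have := dsz_left l; lia.
Qed.

Ltac pt_call1 := lazymatch goal with
  | |- pt (fun _ _ => catD _ _) => apply: pt_cat
  end.
Ltac pt_call ::= pt_call1.

Ltac bits := rewrite /= /xorD /majD /andD;
  repeat match goal with
  | |- context [dif ?a _ _] => let h := fresh in
      have h := dsz_gt0 a; destruct a
  end => /=.

Lemma dsz_fmap_le (f : data -> data) p l B :
  (forall a, dsz a <= dsz l -> dsz (f (Node p a)) <= B) ->
  dsz (fmap f p l) <= dsz l * B.+1.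
Proof.
rewrite /fmap; elim: l => [|a _ l IH] h; first by rewrite /=; lia.
rewrite [rec _ _ _ _ _]/= dsz_cat.
have h1 : dsz (f (Node p a)) <= B by apply: h => /=; lia.
have h2 := IH (fun b bl => h b (leq_trans bl (leq_trans (leq_addl _ _) (leqnSn _)))).
by rewrite /=; nia.
Qed.

Lemma pt_fmap F P L : pt F -> pt P -> pt L ->
  pt (fun w d => fmap (F w) (P w d) (L w d)).
Proof.
move=> pF pP pL; have [c [n [mk [_ z _]]]] := pF.
have pF' : pt (fun w d => F w (Node (par d) (hd d))).
  by apply: pt_comp => //; pts.
apply: (pt_recS (h0 := fun=> 0) (h1 := fun x => bd c (x + 1))); pts.
- by polyt.
- by mono.
- by polyt.
- by mono; apply: bd_mono; lia.
- by move=> w p l /=; lia.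
- move=> w p l r /=; rewrite dsz_cat.
  have := z w (Node p (left_of l)).
  have : bd c (res w + dsz (Node p (left_of l)))
      <= bd c (res w + dsz l + dsz p + 1).
    by apply: bd_mono => /=; have := dsz_left l; lia.
  lia.
Qed.

Ltac pt_call2 := lazymatch goal with
  | |- pt (fun _ _ => fmap _ _ _) => apply: pt_fmap
  | |- _ => pt_call1
  end.
Ltac pt_call ::= pt_call2.

Lemma dsz_inc y c : dsz (incD y c) <= dsz y + 4.
Proof.
suff: dsz (incD y c) <= dsz y + (if c is Leaf then 0 else 4) by case: c; lia.
rewrite /incD; elim: y c => [|a _ y IH] c /=; first by case: c.
have := IH (andD c a); case: c => [|c1 c2]; case: a => [|a1 a2] /=;
  try (have := dsz_gt0 a1; have := dsz_gt0 a2); lia.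
Qed.

Lemma pt_inc X Y : pt X -> pt Y -> pt (fun w d => incD (X w d) (Y w d)).
Proof.
move=> pX pY; apply: (pt_recS (h0 := fun=> 3) (h1 := fun=> 4)); pts.
- by polyt.
- by mono.
- by polyt.
- by mono.
- by move=> w p l; bits; lia.
- by move=> w p l r; bits; lia.
Qed.

Ltac pt_call3 := lazymatch goal with
  | |- pt (fun _ _ => incD _ _) => apply: pt_inc
  | |- _ => pt_call2
  end.
Ltac pt_call ::= pt_call3.

Lemma pt_add X Y Z :
  pt X -> pt Y -> pt Z -> pt (fun w d => addD (X w d) (Y w d) (Z w d)).
Proof.
move=> pX pY pZ; apply: (pt_recS (h0 := fun=> 4) (h1 := fun=> 4)); pts.
- by polyt.
- by mono.
- by polyt.
- by mono.
- move=> w p l /=; have h : dsz (right_of (left_of p)) <= dsz p.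
    exact: leq_trans (dsz_right _) (dsz_left _).
  have : dsz (majD (left_of l) (left_of (left_of p)) (right_of p)) <= 3.
    by bits; lia.
  lia.
- move=> w p l r /=.
  have : dsz (xorD (left_of l) (xorD (left_of (left_of p)) (right_of p))) <= 3.
    by bits; lia.
  lia.
Qed.

(** The number of digits. Digits of an input can be arbitrary trees, but those written by addition
    have size at most 3, so sizes of results are linear in this length. *)
Fixpoint dlen d := if d is Node _ b then (dlen b).+1 else 0.

Lemma dlen_dsz d : dlen d <= dsz d.
Proof. by elim: d => //= a _ b IH; lia. Qed.

Lemma dlen_inc y c : dlen (incD y c) <= (dlen y).+1.
Proof.
rewrite /incD; elim: y c => [|a _ y IH] c /=; first by case: c.
by have := IH (andD c a); lia.
Qed.

Lemma dlen_add x y c : dlen (addD x y c) <= (maxn (dlen x) (dlen y)).+1.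
Proof.
rewrite /addD; elim: x y c => [|a _ x IH] y c /=.
  by rewrite max0n; apply: dlen_inc.
by case: y => [|b y] /=; apply: leq_ltn_trans (IH _ _) _ => /=; lia.
Qed.

Lemma dsz_inc_len y c : dsz (incD y c) <= 4 * dlen (incD y c) + 1.
Proof.
rewrite /incD; elim: y c => [|a _ y IH] c /=; first by case: c.
have h := IH (andD c a).
have : dsz (xorD c a) <= 3 by bits.
lia.
Qed.

Lemma dsz_add_len x y c : dsz (addD x y c) <= 4 * dlen (addD x y c) + 1.
Proof.
rewrite /addD; elim: x y c => [|a _ x IH] y c /=; first exact: dsz_inc_len.
have h := IH (right_of y) (majD a (left_of y) c).
have : dsz (xorD a (xorD (left_of y) c)) <= 3 by bits.
lia.
Qed.

Lemma mulD_cons a x y : mulD (Node a x) y =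
  if a is Leaf then Node Leaf (mulD x y)
  else addD (Node Leaf (mulD x y)) y Leaf.
Proof. by case: a. Qed.

Lemma dlen_mul x y : dlen (mulD x y) <= dlen y + 2 * dlen x.
Proof.
elim: x => [|a _ x IH] //; rewrite mulD_cons [dlen (Node a x)]/=.
case: a => [|a1 a2]; first by rewrite [dlen (Node _ _)]/=; lia.
have := dlen_add (Node Leaf (mulD x y)) y Leaf.
by rewrite [dlen (Node _ _)]/=; lia.
Qed.

Lemma dsz_mul_len x y : dsz (mulD x y) <= 4 * dlen (mulD x y) + 1.
Proof.
elim: x => [|a _ x IH] //; rewrite mulD_cons.
case: a => [|a1 a2]; last exact: dsz_add_len.
by rewrite [dsz (Node _ _)]/= [dlen (Node _ _)]/=; lia.
Qed.

Ltac pt_call4 := lazymatch goal with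
  | |- pt (fun _ _ => addD _ _ _) => apply: pt_add
  | |- _ => pt_call3
  end.
Ltac pt_call ::= pt_call4.

Lemma pt_mul X Y : pt X -> pt Y -> pt (fun w d => mulD (X w d) (Y w d)).
Proof.
move=> pX pY; apply: (pt_recI (h0 := fun=> 0) (h1 := fun x => 8 * x + 1)); pts.
- by polyt.
- by mono.
- by polyt.
- by mono.
- by move=> w p l /=; lia.
- move=> w l p; apply: leq_trans (dsz_mul_len _ _) _.
  by have := dlen_mul l p; have := dlen_dsz l; have := dlen_dsz p; lia.
Qed.

Lemma pt_nz X : pt X -> pt (fun w d => nzD (X w d)).
Proof.
move=> pX; apply: (pt_recS (h0 := fun=> 0) (h1 := fun=> 3)); pts.
- by polyt.
- by mono.
- by polyt.
- by mono.
- by move=> w p l /=; lia.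
- by move=> w p l r; bits; lia.
Qed.

Ltac pt_call5 := lazymatch goal with
  | |- pt (fun _ _ => mulD _ _) => apply: pt_mul
  | |- pt (fun _ _ => nzD _) => apply: pt_nz
  | |- _ => pt_call4
  end.
Ltac pt_call ::= pt_call5.

Lemma pt_leD X Y : pt X -> pt Y -> pt (fun w d => leD (X w d) (Y w d)).
Proof.
move=> pX pY; apply: (pt_recS (h0 := fun=> 4) (h1 := fun=> 3)); pts.
- by polyt.
- by mono.
- by polyt.
- by mono.
- move=> w [|y c] l /=; first by bits; lia.
  by have := dsz_right y; bits; lia.
- by move=> w p l r /=; lia.
Qed.

Ltac pt_call6 := lazymatch goal with
  | |- pt (fun _ _ => leD _ _) => apply: pt_leD
  | |- _ => pt_call5
  end.
Ltac pt_call ::= pt_call6.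

Lemma pt_qadd X Y : pt X -> pt Y -> pt (fun w d => qaddD (X w d) (Y w d)).
Proof. by move=> pX pY; rewrite /qaddD; pts. Qed.

Lemma pt_qmul X Y : pt X -> pt Y -> pt (fun w d => qmulD (X w d) (Y w d)).
Proof. by move=> pX pY; rewrite /qmulD; pts. Qed.

Lemma pt_qle X Y : pt X -> pt Y -> pt (fun w d => qleD (X w d) (Y w d)).
Proof. by move=> pX pY; rewrite /qleD; pts. Qed.

Ltac pt_call7 := lazymatch goal with
  | |- pt (fun _ _ => qaddD _ _) => apply: pt_qadd
  | |- pt (fun _ _ => qmulD _ _) => apply: pt_qmul
  | |- pt (fun _ _ => qleD _ _) => apply: pt_qle
  | |- _ => pt_call6
  end.
Ltac pt_call ::= pt_call7.

Lemma pt_zero : pt (fun (_ : world R) _ => zeroD).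
Proof. by rewrite /zeroD; pts. Qed.

Lemma pt_one : pt (fun (_ : world R) _ => oneD).
Proof. by rewrite /oneD; pts. Qed.

Lemma dsz_sum l : dsz (sumD l) <= 24 * dsz l + 8.
Proof.
(* A product is no longer than its second factor plus twice the first. The accumulated fraction is
   always the second factor, so lengths grow additively. *)
suff [ha hb] : [/\ dsz (sumD l) <= 4 * dlen (left_of (sumD l))
      + 4 * dlen (right_of (sumD l)) + 5
    & maxn (dlen (left_of (sumD l))) (dlen (right_of (sumD l)))
      <= 3 * dsz l] by lia.
rewrite /sumD; elim: l => [|a _ l [IH1 IH2]] /=; first by split; lia.
set r := rec _ _ _ l Leaf in IH1 IH2 *; split.
  have := dsz_mul_len (right_of a) (right_of r).
  have := dsz_add_len (mulD (left_of a) (right_of r))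
     (mulD (right_of a) (left_of r)) Leaf.
  by lia.
have h1 := dlen_mul (left_of a) (right_of r).
have h2 := dlen_mul (right_of a) (left_of r).
have h3 := dlen_mul (right_of a) (right_of r).
have h4 := dlen_add (mulD (left_of a) (right_of r))
     (mulD (right_of a) (left_of r)) Leaf.
have h5 := dlen_dsz (left_of a); have h6 := dlen_dsz (right_of a).
have [h7 h8] : dsz (left_of a) <= dsz a /\ dsz (right_of a) <= dsz a.
  by split; [exact: dsz_left | exact: dsz_right].
lia.
Qed.

Lemma pt_sum X : pt X -> pt (fun w d => sumD (X w d)).
Proof.
move=> pX; have pz := pt_zero.
apply: (pt_recI (h0 := fun=> 0) (h1 := fun x => 24 * x + 8)); pts.
- by polyt.
- by mono.
- by polyt.
- by mono.
- by move=> w p l /=; lia.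
- move=> w l p; suff -> : forall p', rec (fun _ => zeroD) (fun d => par d)
    (fun d => qaddD (hd d) (acc d)) l p' = sumD l by have := dsz_sum l; lia.
  by rewrite /sumD; elim: l => //= a _ l IH p'; rewrite !IH.
Qed.

Lemma pt_num X : pt X -> pt (fun w d => numD (X w d)).
Proof.
move=> pX; apply: (pt_recS (h0 := fun=> 0) (h1 := fun=> 4)); pts.
- by polyt.
- by mono.
- by polyt.
- by mono.
- by move=> w p l /=; lia.
- by move=> w p l r /=; apply: dsz_inc.
Qed.

Ltac recSt a b := apply: (pt_recS (h0 := a) (h1 := b)); pts;
  [by polyt | by mono | by polyt | by mono | move=> w p l /= | move=> w p l r /=].

Lemma vorD_cons a x y : vorD (Node a x) y =
  Node (dif a dtrue (dif (left_of y) dtrue Leaf)) (vorD x (right_of y)).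
Proof. by []. Qed.

Lemma dsz_vor x y : dsz (vorD x y) <= dsz x + dsz y.
Proof.
elim: x y => [|a _ x IH] y; first by rewrite leq_addr.
rewrite vorD_cons [dsz (Node _ _)]/= [dsz (Node a x)]/=.
have := IH (right_of y); case: y => [|b y] /=.
  by case: a => [|a1 a2] /=; have := dsz_gt0 x; try (have := dsz_gt0 a1; have := dsz_gt0 a2); lia.
case: a => [|a1 a2] /=; last by have := dsz_gt0 a1; have := dsz_gt0 a2; lia.
by case: b => [|b1 b2] /=; try (have := dsz_gt0 b1; have := dsz_gt0 b2); lia.
Qed.

Lemma pt_vor X Y : pt X -> pt Y -> pt (fun w d => vorD (X w d) (Y w d)).
Proof.
move=> pX pY; recSt (fun _ : nat => 0) (fun _ : nat => 4).
- by have := dsz_right p; lia.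
- by case: (left_of l); case: (left_of p) => /=; lia.
Qed.

Lemma pt_vdiff X Y : pt X -> pt Y -> pt (fun w d => vdiffD (X w d) (Y w d)).
Proof.
move=> pX pY; recSt (fun _ : nat => 0) (fun _ : nat => 4).
- by have := dsz_right p; lia.
- by case: (left_of l); case: (left_of p) => /=; lia.
Qed.

Lemma pt_disj X Y : pt X -> pt Y -> pt (fun w d => disjD (X w d) (Y w d)).
Proof.
move=> pX pY; recSt (fun _ : nat => 0) (fun _ : nat => 4).
- by have := dsz_right p; lia.
- by have := dsz_gt0 r; case: (left_of l); case: (left_of p) => /=; lia.
Qed.

Lemma pt_splits X : pt X -> pt (fun w d => splitsD (X w d)).
Proof.
move=> pX; recSt (fun x => x + 1) (fun x => x + 2).
- by have := dsz_left l; lia.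
- by lia.
Qed.

Lemma pt_take X Y : pt X -> pt Y -> pt (fun w d => firstD (X w d) (Y w d)).
Proof.
move=> pX pY; recSt (fun _ : nat => 0) (fun x => x + 1).
- by have := dsz_right p; lia.
- by have := dsz_left l; case: p => /=; lia.
Qed.

Ltac pt_call8 := lazymatch goal with
  | |- pt (fun _ _ => zeroD) => exact: pt_zero
  | |- pt (fun _ _ => oneD) => exact: pt_one
  | |- pt (fun _ _ => sumD _) => apply: pt_sum
  | |- pt (fun _ _ => numD _) => apply: pt_num
  | |- pt (fun _ _ => vorD _ _) => apply: pt_vor
  | |- pt (fun _ _ => vdiffD _ _) => apply: pt_vdiff
  | |- pt (fun _ _ => disjD _ _) => apply: pt_disj
  | |- pt (fun _ _ => splitsD _) => apply: pt_splits
  | |- pt (fun _ _ => firstD _ _) => apply: pt_take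
  | |- _ => pt_call7
  end.
Ltac pt_call ::= pt_call8.

Lemma pt_cmp Q X Y : pt Q -> pt X -> pt Y ->
  pt (fun w d => cmpD (Q w d) (X w d) (Y w d)).
Proof. by move=> pQ pX pY; rewrite /cmpD; pts. Qed.

Lemma pt_bot : pt (fun (_ : world R) _ => botD).
Proof. by rewrite /botD; pts. Qed.

Lemma pt_ucost : pt (fun (_ : world R) _ => ucostD).
Proof. by rewrite /ucostD; pts. Qed.

Lemma pt_uprof : pt (fun (_ : world R) _ => uprofD).
Proof. by rewrite /uprofD; pts. Qed.

Ltac pt_call9 := lazymatch goal with
  | |- pt (fun _ _ => cmpD _ _ _) => apply: pt_cmp
  | |- pt (fun _ _ => botD) => exact: pt_bot
  | |- pt (fun _ _ => ucostD) => exact: pt_ucost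
  | |- pt (fun _ _ => uprofD) => exact: pt_uprof
  | |- _ => pt_call8
  end.
Ltac pt_call ::= pt_call9.

Lemma insD_cons q x a l : insD q x (Node a l) =
  dif (cmpD q x a) (Node x (Node a l)) (Node a (insD q x l)).
Proof. by []. Qed.

Lemma dsz_ins q x l : dsz (insD q x l) <= dsz l + (dsz x).+1.
Proof.
elim: l => [|a _ l IH]; first by rewrite /insD /=; lia.
by rewrite insD_cons; case: (cmpD q x a) => [|? ?] /=; lia.
Qed.

Lemma pt_ins Q X Y : pt Q -> pt X -> pt Y ->
  pt (fun w d => insD (Q w d) (X w d) (Y w d)).
Proof.
move=> pQ pX pY; recSt (fun _ : nat => 0) (fun x => x + 1).
- by lia.
- have := dsz_left l; have := dsz_right p; have := dsz_gt0 r.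
  by case: (cmpD _ _ _) => /=; lia.
Qed.

Ltac pt_call10 := lazymatch goal with
  | |- pt (fun _ _ => insD _ _ _) => apply: pt_ins
  | |- _ => pt_call9
  end.
Ltac pt_call ::= pt_call10.

Lemma pt_sort Q X : pt Q -> pt X -> pt (fun w d => sortD (Q w d) (X w d)).
Proof.
move=> pQ pX; recSt (fun _ : nat => 0) (fun x => x + 1).
- by lia.
- by apply: leq_trans (dsz_ins _ _ _) _; have := dsz_left l; lia.
Qed.

Lemma pt_cut X : pt X -> pt (fun w d => cutD (X w d)).
Proof.
move=> pX; recSt (fun _ : nat => 0) (fun x => x + 1).
- by lia.
- have := dsz_left l; have := dsz_gt0 r.
  by case: (left_of (left_of l)) => /=; lia.
Qed.

Lemma pt_elems : pt (fun w _ => elemsD w).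
Proof.
recSt (fun _ : nat => 2) (fun x => 3 * x * x + 10 * x + 10).
- by lia.
- rewrite dsz_cat /=.
  have h : dsz (fmap (fun _ => dtrue) Leaf (right_of l)) <= dsz (right_of l) * 4.
    exact: dsz_fmap_le.
  by have := dsz_left l; have := dsz_right l; nia.
Qed.

Ltac pt_call11 := lazymatch goal with
  | |- pt (fun _ _ => sortD _ _) => apply: pt_sort
  | |- pt (fun _ _ => cutD _) => apply: pt_cut
  | |- pt (fun w _ => elemsD w) => exact: pt_elems
  | |- _ => pt_call10
  end.
Ltac pt_call ::= pt_call11.

Lemma pt_zeros : pt (fun w _ => zerosD w).
Proof. by rewrite /zerosD; pts. Qed.

Lemma pt_norm X : pt X -> pt (fun w d => normD w (X w d)).
Proof.
move=> pX; recSt (fun _ : nat => 0) (fun _ : nat => 4).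
- by have := dsz_right p; lia.
- by case: (left_of p) => /=; lia.
Qed.

Lemma normDE w d : normD w d = enc_set (decset w d).
Proof.
have H (h : ground (wK w) -> data) s y :
    rec (fun _ => Leaf) (fun d => right_of (par d))
      (fun d => Node (dif (left_of (par d)) dtrue Leaf) (acc d))
      (enc_seq [seq h e | e <- s]) y =
    enc_seq [seq enc_bool (isn (dnth y i)) | i <- iota 0 (size s)].
  elim: s y => [|e s IH] y //=; congr Node; first by rewrite /dnth /=; case: left_of.
  rewrite IH -[1]addn0 iotaDl -map_comp; congr enc_seq; apply: eq_map => i /=.
  by rewrite /dnth iterSr.
rewrite /normD H /enc_set; congr enc_seq; set s := enum _.
have us : uniq s by apply: enum_uniq.
rewrite -(map_index_iota us).
by rewrite -map_comp; apply: eq_map => e /=; rewrite inE.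
Qed.

Lemma pt_indep X : pt X -> pt (fun w d => indepD w (X w d)).
Proof.
move=> pX; apply: pt_comp pX.
have [c [n [mk [s z t]]]] := pt_norm (@pt_id R).
apply: (@pt_intro _ _ (fun=> 3) (fun x => bd c x + bd c x + 5) n.+1
  (fun k => EIndep (ECall k.+1 (EVar 0)) :: mk k.+1)); try by polyt.
- by move=> k; rewrite /= s.
- by move=> w d; rewrite /indepD; case: (_ \in _).
- move=> B k /frag_cons[-> f1] w d.
  have [u1 b1 e1] := t _ _ f1 w d.
  exists ((1 + u1).+1 + dsz (enc_set (decset w d))).+1.
    by have := z w d; rewrite normDE; lia.
  by apply: eval_indep; apply: ev_call0; rewrite normDE in e1.
Qed.

Ltac pt_call12 := lazymatch goal with
  | |- pt (fun w _ => zerosD w) => exact: pt_zeros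
  | |- pt (fun w _ => indepD w _) => apply: pt_indep
  | |- _ => pt_call11
  end.
Ltac pt_call ::= pt_call12.

Lemma pt_greedy X Y : pt X -> pt Y -> pt (fun w d => greedyD w (X w d) (Y w d)).
Proof.
move=> pX pY; recSt (fun x : nat => x) (fun _ : nat => 0).
- have h := dsz_vor p (left_of (left_of l)).
  have : dsz (left_of (left_of l)) <= dsz l.
    exact: leq_trans (dsz_left _) (dsz_left _).
  by case: (indepD _ _) => /=; lia.
- by lia.
Qed.

Lemma pt_cost X : pt X -> pt (fun w d => costD w (X w d)).
Proof. by move=> pX; rewrite /costD; pts. Qed.

Lemma pt_prof X : pt X -> pt (fun w d => profD w (X w d)).
Proof. by move=> pX; rewrite /profD; pts. Qed.

Lemma catDE s t : catD (enc_seq s) (enc_seq t) = enc_seq (s ++ t).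
Proof. by elim: s => //= a s <-. Qed.

Lemma fmapE (T : eqType) (h : T -> data) f p (s : seq T) (g : T -> seq data) :
  {in s, forall x, f (Node p (h x)) = enc_seq (g x)} ->
  fmap f p (enc_seq (map h s)) = enc_seq (flatten (map g s)).
Proof.
elim: s => [|x s IH] //= fg.
transitivity (catD (f (Node p (h x))) (fmap f p (enc_seq (map h s)))) => //.
rewrite fg ?mem_head // IH ?catDE // => y ys; apply: fg.
by rewrite inE ys orbT.
Qed.

Lemma enc_nat_exp2 t : enc_nat (2 ^ t) = iter t (Node Leaf) (Node dtrue Leaf).
Proof.
have pE : nat_of_pos (iter t xO xH) = 2 ^ t.
  by elim: t => //= t ->; rewrite expnS mul2n NatTrec.doubleE.
rewrite /enc_nat /nat_bits -pE.
have -> : bin_of_nat (nat_of_pos (iter t xO xH)) = Npos (iter t xO xH).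
  exact: (nat_of_binK (Npos _)).
by elim: t {pE} => //= t ->.
Qed.

Lemma dsz_iter t : dsz (iter t (Node Leaf) (Node dtrue Leaf)) = 2 * t + 5.
Proof. by elim: t => //= t ->; lia. Qed.

Lemma ell_res w : ell w <= res w.
Proof.
rewrite /res; apply: leq_trans (leq_addl _ _); apply: ltnW.
apply: leq_ltn_trans (ltn_expl _ (ltnSn 1)); nia.
Qed.

Lemma logell_ell w : logell w < ell w.
Proof. exact: ltn_expl. Qed.

(** The only place where [eps] is consulted. The loop has no list to recurse on: it doubles until
    the comparison succeeds, and minimality of [logell] makes every earlier test fail, so it ends
    after [logell] rounds. The constant [six] has the digits 0, 1, 1. *)
Lemma pt_find : pt (fun w _ => findD w).
Proof.
pose six := ENode ELeaf (ENode (ENode ELeaf ELeaf)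
  (ENode (ENode ELeaf ELeaf) ELeaf)).
apply: (@pt_intro _ _ (fun x => 2 * x + 5) (fun x => x * (2 * x + 70) + 100) 2
  (fun k => [:: ECall k.+1 (ENode (ENode ELeaf ELeaf) ELeaf);
     EIf (ELeEps (ENode six (EVar 0))) (EVar 0)
       (ECall k.+1 (ENode ELeaf (EVar 0)))])); try by polyt.
- by move=> w d; rewrite dsz_iter; have := ell_res w; have := logell_ell w; lia.
- move=> B k /frag_cons[-> /frag_cons[Bk _]] w d.
  have H i : i <= logell w -> exists2 t,
      t <= i * (2 * logell w + 70) + 2 * logell w + 70
      & eval B (wK w) (weps w)
          [:: iter (logell w - i) (Node Leaf) (Node dtrue Leaf)]
          (body B k.+1) (findD w) t.
    have test j : eval B (wK w) (weps w) [:: iter j (Node Leaf) (Node dtrue Leaf)]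
        (ELeEps (ENode six (EVar 0)))
        (enc_bool (6%:R <= weps w * (2 ^ j)%:R)%R)
        (13 + dsz (Node (enc_nat 6) (enc_nat (2 ^ j)))).+1.
      apply: eval_le_eps; rewrite (_ : 13 = (11 + 1).+1) //.
      apply: eval_node; last by rewrite enc_nat_exp2; apply: ev_var.
      rewrite /six (_ : 11 = (1 + (3 + (3 + 1).+1).+1).+1) //.
      do 3! (try apply: eval_node); try exact: eval_leaf.
      - by apply: (eval_node (eval_leaf _ _ _ _) (eval_leaf _ _ _ _)).
      - by apply: (eval_node (eval_leaf _ _ _ _) (eval_leaf _ _ _ _)).
    have sz j : j <= logell w ->
        dsz (Node (enc_nat 6) (enc_nat (2 ^ j))) <= 2 * logell w + 20.
      by move=> jl; rewrite /= enc_nat_exp2 dsz_iter /=; lia.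
    elim: i => [_|i IH il].
      have h : (6%:R <= weps w * (2 ^ logell w)%:R)%R.
        by rewrite /logell; case: ex_minnP.
      eexists; last first.
        rewrite Bk subn0; apply: eval_if_true; last exact: ev_var.
        by have := test (logell w); rewrite h; apply.
      by have := sz _ (leqnn _); lia.
    have jl : logell w - i.+1 < logell w by lia.
    have h : (6%:R <= weps w * (2 ^ (logell w - i.+1))%:R)%R = false.
      apply/negP => h; move: jl; rewrite {2}/logell; case: ex_minnP => m _ hm.
      by rewrite ltnNge hm.
    have [t ht et] := IH (ltnW il).
    eexists; last first.
      rewrite Bk; apply: eval_if_false.
        by have := test (logell w - i.+1); rewrite h; apply.
      apply: eval_call et; rewrite (_ : logell w - i = (logell w - i.+1).+1); last by lia.
      by apply: eval_node; [exact: eval_leaf | exact: ev_var].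
    by have := sz _ (ltnW jl); nia.
  have [t ht et] := H _ (leqnn _); rewrite subnn in et.
  eexists; last first.
    apply: eval_call et; apply: eval_node; last exact: eval_leaf.
    by apply: eval_node; exact: eval_leaf.
  by have := ell_res w; have := logell_ell w; nia.
Qed.

Definition doubleD d : data :=
  rec (fun _ => dtrue) (fun d => par d) (fun d => catD (acc d) (acc d)) d Leaf.

Lemma doubleDE d : doubleD d = enc_seq (nseq (2 ^ dlen d) Leaf).
Proof.
rewrite /doubleD; elim: d => //= a _ d ->.
by rewrite catDE expnS mul2n -addnn nseqD.
Qed.

Lemma dlen_find w : dlen (right_of (findD w)) = logell w.
Proof.
rewrite /findD; case: (logell w) => //= t.
by elim: t => //= t ->.
Qed.

Lemma ellDE w : ellD w = enc_seq (nseq (ell w) Leaf).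
Proof. by rewrite -[LHS]/(doubleD _) doubleDE dlen_find. Qed.

Lemma dsz_units n : dsz (enc_seq (nseq n Leaf)) = (2 * n).+1.
Proof. by elim: n => //= n ->; lia. Qed.

(** Doubling is exponential in the number of rounds, but the final length [ell] is below [res]. *)
Lemma pt_ell : pt (fun w _ => ellD w).
Proof.
have pf := pt_find.
apply: (@pt_rec R (fun _ _ => dtrue) (fun _ d => par d)
  (fun _ d => catD (acc d) (acc d)) (fun w _ => right_of (findD w))
  (fun _ _ => Leaf) (fun x => 2 * x + 1)); pts; first by polyt.
move=> w d.
have : dlen (right_of (findD w)) <= logell w by rewrite dlen_find.
have : 2 ^ logell w <= res w := ell_res w.
move: (logell w) => t rt; elim: (right_of (findD w)) => [|a _ l IH] /=.
  by have := res_gt0 w; split=> //; lia.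
move=> lt; split=> //; last by apply: IH; lia.
rewrite -/(doubleD l) doubleDE catDE -nseqD addnn -mul2n -expnS dsz_units.
have : 2 ^ (dlen l).+1 <= 2 ^ t by rewrite leq_exp2l.
by lia.
Qed.

Ltac pt_call13 := lazymatch goal with
  | |- pt (fun w _ => greedyD w _ _) => apply: pt_greedy
  | |- pt (fun w _ => costD w _) => apply: pt_cost
  | |- pt (fun w _ => profD w _) => apply: pt_prof
  | |- pt (fun w _ => ellD w) => exact: pt_ell
  | |- pt (fun w _ => unitsD w) => rewrite /unitsD
  | |- _ => pt_call12
  end.
Ltac pt_call ::= pt_call13.

Lemma pt_basis X : pt X -> pt (fun w d => basisD w (X w d)).
Proof. by move=> pX; rewrite /basisD; pts. Qed.

Lemma pt_repr X : pt X -> pt (fun w d => reprD w (X w d)).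
Proof. by move=> pX; have pB := pt_basis; rewrite /reprD; pts; apply: pt_basis; pts. Qed.

Lemma pt_light X Y : pt X -> pt Y -> pt (fun w d => lightD w (X w d) (Y w d)).
Proof. by move=> pX pY; rewrite /lightD; pts. Qed.

Lemma pt_cand X Y Z : pt X -> pt Y -> pt Z ->
  pt (fun w d => candD w (X w d) (Y w d) (Z w d)).
Proof. by move=> pX pY pZ; rewrite /candD; pts. Qed.

Lemma pt_values : pt (fun w _ => valuesD w).
Proof. by rewrite /valuesD; pts. Qed.

Lemma pt_dirs : pt (fun w _ => dirsD w).
Proof. by rewrite /dirsD; pts. Qed.

Ltac pt_call14 := lazymatch goal with
  | |- pt (fun w _ => reprD w _) => apply: pt_repr
  | |- pt (fun w _ => lightD w _ _) => apply: pt_light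
  | |- pt (fun w _ => candD w _ _ _) => apply: pt_cand
  | |- pt (fun w _ => valuesD w) => exact: pt_values
  | |- pt (fun w _ => dirsD w) => exact: pt_dirs
  | |- _ => pt_call13
  end.
Ltac pt_call ::= pt_call14.

Lemma pt_candsVH X Y :
  pt X -> pt Y -> pt (fun w d => candsVHD w (X w d) (Y w d)).
Proof. by move=> pX pY; rewrite /candsVHD; pts. Qed.

Lemma pt_best X : pt X -> pt (fun w d => bestD w (X w d)).
Proof.
move=> pX; recSt (fun _ : nat => 0) (fun x : nat => x).
- by lia.
- have := dsz_left l.
  by case: (indepD _ _); case: (qleD _ _); case: (qleD _ _) => /=; lia.
Qed.

(** The bound for [guessD] is a hypothesis because it rests on counting the guessed sets, hence on
    the specification of [reprD]. *)
Lemma pt_main :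
  pt (fun w d => guessD w (reprD w d)) -> pt (fun w _ => mainD w).
Proof.
move=> pG; rewrite /mainD; apply: pt_best; rewrite /candsD; pts.
  by apply: pt_candsVH; pts.
by apply: (pt_comp pG); pts.
Qed.

End Worlds.

Local Open Scope ring_scope.

(** * Matroids and the greedy algorithm *)

Section StableSort.
Variable T : eqType.
Implicit Types (v : T -> rat) (s t : seq T).

(** A new element goes in front of its equals; since [vsort] inserts from the right end, the sort is
    stable. *)
Fixpoint vins v x s : seq T :=
  if s is a :: s' then if v a <= v x then x :: s else a :: vins v x s'
  else [:: x].

Definition vsort v s : seq T := foldr (vins v) [::] s.

Definition bef s (a b : T) : bool := (index a s < index b s)%N.

Lemma perm_vins v x s : perm_eq (vins v x s) (x :: s).
Proof.
elim: s => //= a s IH; case: ifP => // _.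
by rewrite -(perm_cons a) in IH; apply: perm_trans IH _; rewrite (perm_catCA [:: a] [:: x]).
Qed.

Lemma perm_vsort v s : perm_eq (vsort v s) s.
Proof.
elim: s => //= x s IH; apply: perm_trans (perm_vins _ _ _) _.
by rewrite perm_cons.
Qed.

Lemma mem_vsort v s : vsort v s =i s.
Proof. exact/perm_mem/perm_vsort. Qed.

Lemma vsort_uniq v s : uniq (vsort v s) = uniq s.
Proof. exact/perm_uniq/perm_vsort. Qed.

Lemma eq_vsort v v' s :
  (forall a b, (v a <= v b) = (v' a <= v' b)) -> vsort v s = vsort v' s.
Proof.
move=> vv; elim: s => //= x s ->; elim: (vsort v' s) => //= a t ->.
by rewrite vv.
Qed.

Lemma sorted_vins v x s : sorted (fun a b => v b <= v a) s ->
  sorted (fun a b => v b <= v a) (vins v x s).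
Proof.
have tr : transitive (fun a b => v b <= v a).
  by move=> a b d ab bd; apply: le_trans bd ab.
elim: s => //= a s IH ps; case: ifP => /= [-> //|nax].
have {nax} xa : v x <= v a by rewrite ltW // ltNge nax.
have := IH (path_sorted ps); rewrite (path_sortedE tr) => ->.
rewrite andbT (perm_all _ (perm_vins v x s)) /= xa /=.
by move: ps; rewrite (path_sortedE tr) => /andP[].
Qed.

Lemma sorted_vsort v s : sorted (fun a b => v b <= v a) (vsort v s).
Proof. by elim: s => //= x s; apply: sorted_vins. Qed.

Lemma bef_cons x s a b : a != x -> b != x -> bef (x :: s) a b = bef s a b.
Proof. by rewrite /bef /= !(eq_sym x) => /negPf-> /negPf->. Qed.

Lemma bef_vins v x s a b : sorted (fun a b => v b <= v a) s -> x \notin s ->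
  a \in s -> b \in s -> bef (vins v x s) a b = bef s a b.
Proof.
elim: s => // c s IH /= ps; rewrite inE negb_or => /andP[xc xs].
move=> ain bin; have ax : a != x.
  by apply: contraTneq ain => ->; rewrite inE negb_or xc.
have bx : b != x.
  by apply: contraTneq bin => ->; rewrite inE negb_or xc.
case: ifP => [_|_]; first exact: bef_cons.
have [-> | ac] := eqVneq a c; rewrite /bef /= ?eqxx.
  by have [//|bc] := eqVneq b c.
rewrite ![c == _]eq_sym (negPf ac).
have [// | bc] := eqVneq b c.
rewrite !ltnS; apply: IH => //; first exact: path_sorted ps.
- by move: ain; rewrite inE (negPf ac).
- by move: bin; rewrite inE (negPf bc).
Qed.

Lemma bef_vins_new v x s b : sorted (fun a b => v b <= v a) s -> x \notin s ->
  b \in s -> (bef (vins v x s) x b = (v b <= v x)) *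
             (bef (vins v x s) b x = (v x < v b)).
Proof.
have tr : transitive (fun a b => v b <= v a).
  by move=> a d e ad de; apply: le_trans de ad.
rewrite (ltNge (v x)).
elim: s => // c s IH ps; rewrite inE negb_or => /andP[xc xs] bin.
have /allP hc : all (fun y => v y <= v c) s.
  by move: ps; rewrite /= (path_sortedE tr) => /andP[].
have bx : b != x by apply: contraTneq bin => ->; rewrite inE negb_or xc.
rewrite /=; case: ifP => cx.
  have -> : v b <= v x.
    by move: bin; rewrite inE => /predU1P[-> // | /hc bc]; apply: le_trans bc cx.
  by rewrite /bef /= eqxx [x == b]eq_sym (negPf bx).
rewrite /bef /= ![c == _]eq_sym (negPf xc).
have [bc|bc] := eqVneq b c; first by rewrite bc cx.
rewrite !ltnS; apply: IH => //; first exact: path_sorted ps.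
by move: bin; rewrite inE (negPf bc).
Qed.

(** Stability as a lexicographic order. It reduces the comparison of two greedy orders for the same
    multiplier to their tie orders. *)
Lemma bef_vsort v t a b : uniq t -> a \in t -> b \in t ->
  bef (vsort v t) a b = (v b < v a) || (v a == v b) && bef t a b.
Proof.
elim: t => // x t IH /= /andP[xt ut].
have xs : x \notin vsort v t by rewrite mem_vsort.
have ss := sorted_vsort v t.
have irr s y : bef s y y = false by rewrite /bef ltnn.
rewrite !inE; have [-> _|ax /= ain] := eqVneq a x; have [->|bx /= bin] := eqVneq b x.
- by rewrite !irr ltxx andbF.
- rewrite (bef_vins_new ss xs) ?mem_vsort //.
  by rewrite /bef /= eqxx [x == b]eq_sym (negPf bx) andbT le_eqVlt [v b == _]eq_sym orbC.
- rewrite (bef_vins_new ss xs) ?mem_vsort // => _.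
  by rewrite /bef /= eqxx [x == a]eq_sym (negPf ax) ltn0 andbF orbF.
- by rewrite bef_vins ?mem_vsort // IH // bef_cons.
Qed.

Lemma bef_cat s1 s2 a b : uniq (s1 ++ s2) -> a \in s1 ++ s2 -> b \in s1 ++ s2 ->
  bef (s1 ++ s2) a b =
    if a \in s1 then (if b \in s1 then bef s1 a b else true)
    else (if b \in s1 then false else bef s2 a b).
Proof.
move=> u; rewrite /bef !index_cat !mem_cat.
case: (boolP (a \in s1)) => [a1 _|a1 a2]; case: (boolP (b \in s1)) => [b1 _|b1 b2] //.
- by apply: leq_trans (leq_addr _ _); rewrite index_mem.
- by apply/negbTE; rewrite -leqNgt; apply: leq_trans (leq_addr _ _); apply: index_size.
- by rewrite ltn_add2l.
Qed.

Lemma sorted_bef (r : rel T) s : uniq s ->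
  {in s &, forall a b, bef s a b -> r a b} -> sorted r s.
Proof.
case: s => // x0 s0; set s := x0 :: s0 => us h; apply/(sortedP x0) => i hi.
apply: h; rewrite ?mem_nth // ?(ltnW hi) //.
by rewrite /bef !index_uniq // ltnW.
Qed.

Lemma bef_take s a b : bef s a b -> a \in take (index b s) s.
Proof.
move=> ab; rewrite in_take_leq; first by [].
by rewrite index_size.
Qed.

End StableSort.

Section Greedy.
Variables (E : finType) (I : {set {set E}}).
Hypothesis hI : is_matroid I.
Implicit Types (A B C H X Y S : {set E}) (s : seq E).

Lemma indepS A B : A \subset B -> B \in I -> A \in I.
Proof. by have [_ h _] := hI; apply: h. Qed.

Lemma augment A B : A \in I -> B \in I ->
  exists2 C, C \in I & [/\ A \subset C, C \subset A :|: B & (#|B| <= #|C|)%N].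
Proof.
move=> AI BI; have [n le_n] := ubnP (#|B| - #|A|)%N.
elim: n => // n IH in A AI le_n *.
have [BA|AB] := leqP #|B| #|A|; first by exists A; rewrite ?subsetUl.
have [_ _ /(_ A B AI BI AB)[e]] := hI; rewrite inE => /andP[eA eB] eI.
have [|C CI [AC CB BC]] := IH _ eI; first by rewrite cardsU1 eA; lia.
exists C => //; split=> //; first exact: subset_trans (subsetUr _ _) AC.
apply: subset_trans CB _; rewrite !subUset subsetUl subsetUr andbT.
by rewrite sub1set inE eB orbT.
Qed.

Definition gstep X e : {set E} := if e |: X \in I then e |: X else X.
(** Starting from [H] is the greedy algorithm in the contraction by [H], without constructing that
    matroid. *)
Definition greedy H s : {set E} := foldl gstep H s.

Lemma greedy_indep H s : H \in I -> greedy H s \in I.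
Proof.
by elim: s H => //= e s IH H HI; apply: IH; rewrite /gstep; case: ifP.
Qed.

Lemma sub_gstep H e : H \subset gstep H e.
Proof. by rewrite /gstep; case: ifP => // _; apply: subsetUr. Qed.

Lemma sub_greedy H s : H \subset greedy H s.
Proof.
by elim: s H => //= e s IH H; apply: subset_trans (sub_gstep H e) (IH _).
Qed.

Lemma greedy_sub H s : greedy H s \subset H :|: [set e in s].
Proof.
elim: s H => [|e s IH] H /=; first exact: subsetUl.
apply: subset_trans (IH _) _; apply/subsetP => y.
rewrite /gstep !inE; case: ifP => _; rewrite ?inE => /orP[];
  by do ?[case/orP]; move=> ->; rewrite ?orbT.
Qed.

Lemma greedy_cat H s1 s2 : greedy H (s1 ++ s2) = greedy (greedy H s1) s2.
Proof. exact: foldl_cat. Qed.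

Lemma greedy_max H s e : e \in s -> e |: greedy H s \in I -> e \in greedy H s.
Proof.
elim: s H => //= a s IH H; rewrite inE => /predU1P[->|es]; last exact: IH.
move=> aI; apply: (subsetP (sub_greedy _ _)).
rewrite /gstep; have -> : a |: H \in I.
  apply: indepS aI; rewrite setUS //.
  exact: subset_trans (sub_gstep _ _) (sub_greedy _ _).
exact: setU11.
Qed.

Lemma greedy_catl H s1 s2 e : e \notin s2 ->
  (e \in greedy H (s1 ++ s2)) = (e \in greedy H s1).
Proof.
move=> es2; rewrite greedy_cat; apply/idP/idP.
  by move=> /(subsetP (greedy_sub _ _)); rewrite !inE (negPf es2) orbF.
exact/subsetP/sub_greedy.
Qed.

Lemma mem_greedy H s1 e s2 : e \notin H -> e \notin s1 -> e \notin s2 ->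
  (e \in greedy H (s1 ++ e :: s2)) = (e |: greedy H s1 \in I).
Proof.
move=> eH es1 es2; rewrite -cat_rcons greedy_catl // -cats1 greedy_cat /= /gstep.
case: ifP => _; first exact: setU11.
apply/negbTE/negP => /(subsetP (greedy_sub _ _)).
by rewrite !inE (negPf eH) (negPf es1).
Qed.

(** Monotonicity of closure: [Y] is a maximal independent subset of [B], so it spans all that [X]
    spans. *)
Lemma span_mono A B X Y e :
  X \in I -> X \subset A -> A \subset B -> e \notin B -> Y \subset B ->
  (forall b, b \in B -> b |: Y \in I -> b \in Y) ->
  e |: Y \in I -> e |: X \in I.
Proof.
move=> XI XA AB eB YB Ymax eYI.
have [D DI [XD DXY YD]] := augment XI eYI.
have [eD|eD] := boolP (e \in D).
  by apply: indepS DI; rewrite subUset sub1set eD.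
have eY : e \notin Y by apply: contra eB; apply/subsetP.
rewrite cardsU1 eY in YD.
have YI : Y \in I by apply: indepS eYI; apply: subsetUr.
have [_ _ /(_ Y D YI DI YD)[d]] := hI; rewrite inE => /andP[dY dD] dYI.
have dB : d \in B.
  have de : d != e by apply: contraNneq eD => <-.
  have := subsetP DXY d dD; rewrite !inE (negPf dY) (negPf de) !orbF => dX.
  exact: (subsetP AB) (subsetP XA _ dX).
by rewrite (Ymax _ dB dYI) in dY.
Qed.

(* The element None marks the end of the useful part of a list. *)
Implicit Type t : seq (option E).

Definition upto_none t : seq E := pmap id (take (index None t) t).

Definition ogreedy H t : {set E} := greedy H (upto_none t).

Lemma upto_none_cons e t : upto_none (Some e :: t) = e :: upto_none t.
Proof. by []. Qed.

Lemma upto_none_cat t1 t2 : None \notin t1 ->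
  upto_none (t1 ++ t2) = pmap id t1 ++ upto_none t2.
Proof. by elim: t1 => //= -[e|] t1 IH; rewrite inE //= => /IH <-. Qed.

Lemma mem_pmap_id e t : (e \in pmap id t) = (Some e \in t).
Proof. by rewrite mem_pmap map_id. Qed.

Lemma mem_upto_none e t : e \in upto_none t -> Some e \in t.
Proof. by rewrite mem_pmap_id; apply: mem_take. Qed.

Lemma ogreedy_sub H t e : e \in ogreedy H t -> e \notin H -> Some e \in t.
Proof.
move=> /(subsetP (greedy_sub _ _)); rewrite !inE => /orP[-> //|].
by move=> /mem_upto_none.
Qed.

Lemma mem_ogreedy H t1 e t2 : e \notin H -> uniq (t1 ++ Some e :: t2) ->
  (e \in ogreedy H (t1 ++ Some e :: t2)) =
    (None \notin t1) && (e |: greedy H (pmap id t1) \in I).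
Proof.
move=> eH; rewrite cat_uniq /= negb_or => /and3P[_ /andP[e1 _] /andP[e2 _]].
rewrite /ogreedy; have [N1|N1] /= := boolP (None \in t1).
  apply/negbTE/negP => /(subsetP (greedy_sub _ _)); rewrite !inE (negPf eH) /=.
  rewrite /upto_none index_cat N1 take_cat index_mem N1 mem_pmap_id.
  by move=> /mem_take; apply/negP.
rewrite upto_none_cat // upto_none_cons mem_greedy ?mem_pmap_id //.
by apply: contra e2; apply: mem_take.
Qed.

(** Acceptance of [e] depends only on the span of its predecessors and on whether [None] is among
    them. In [t] there are fewer predecessors than in [t']. *)
Lemma ogreedy_move H t t' e : H \in I -> uniq t -> uniq t' -> t =i t' ->
  e \notin H ->
  (forall y, y \in t -> bef t y (Some e) -> bef t' y (Some e)) ->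
  e \in ogreedy H t' -> e \in ogreedy H t.
Proof.
move=> HI ut ut' tt' eH mv et'.
have e't : Some e \in t' by apply: ogreedy_sub et' eH.
have et : Some e \in t by rewrite tt'.
case/splitPr: e't ut' tt' mv et' => t1' t2' ut' tt' mv.
case/splitPr: et ut tt' mv => t1 t2 ut tt' mv.
have sub y : y \in t1 -> y \in t1'.
  move=> y1; have e1 : Some e \notin t1.
    by apply: contraTN ut => e1; rewrite cat_uniq /= e1 /= andbF.
  have e1' : Some e \notin t1'.
    by apply: contraTN ut' => h; rewrite cat_uniq /= h /= andbF.
  have := mv y; rewrite mem_cat y1 => /(_ isT).
  rewrite /bef !index_cat y1 (negPf e1) (negPf e1') /= eqxx addn0 index_mem y1.
  move=> /(_ isT); case: ifP => // _; lia.
rewrite !mem_ogreedy // => /andP[N1' eI]; apply/andP; split.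
  by apply: contra N1'; apply: sub.
have e1' : Some e \notin t1'.
  by apply: contraTN ut' => h; rewrite cat_uniq /= h /= andbF.
apply: (@span_mono (H :|: [set y in pmap id t1]) (H :|: [set y in pmap id t1'])
   _ _ _ _ _ _ _ _ _ eI).
- exact: greedy_indep.
- exact: greedy_sub.
- rewrite setUS //; apply/subsetP => y; rewrite !inE !mem_pmap_id; exact: sub.
- by rewrite !inE (negPf eH) mem_pmap_id.
- exact: greedy_sub.
- move=> b; rewrite !inE => /orP[bH _|]; last exact: greedy_max.
  exact: (subsetP (sub_greedy _ _)).
Qed.

Lemma cards_cover1 A B e : A \subset e |: B -> e \in A -> e \notin B ->
  (#|B| <= #|A|)%N ->
  A = e |: B \/ exists2 d, d \in B & A = (e |: B) :\ d.
Proof.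
move=> AB eA eB BA; have [/eqP AeB|ne] := eqVneq A (e |: B); first by left; apply/eqP.
right; have /properP[_ [d deB dA]] : A \proper e |: B by rewrite properEneq ne.
have de : d != e by apply: contraNneq dA => ->.
have dB : d \in B by move: deB; rewrite !inE (negPf de).
exists d => //; apply/eqP; rewrite eqEcard subsetD1 AB dA /=.
have := cardsD1 d (e |: B); rewrite deB cardsU1 eB; lia.
Qed.

Lemma ogreedy_opt (v : option E -> rat) H t (T : {set E}) :
  v None = 0 -> None \in t -> sorted (fun a b => v b <= v a) t ->
  H \in I -> H \subset T -> T \in I ->
  (forall e, e \in T -> e \notin H -> Some e \in t) ->
  \sum_(e in T) v (Some e) <= \sum_(e in ogreedy H t) v (Some e).
Proof.
have tr : transitive (fun a b : option E => v b <= v a).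
  by move=> a b d ab bd; apply: le_trans bd ab.
move=> v0; elim: t H T => // -[a|] t IH H T Nt st HI HT TI Tt; last first.
  (* Everything after [None] has value at most 0, so stopping is optimal. *)
  have -> : ogreedy H (None :: t) = H by [].
  rewrite (big_setID H) /= (setIidPr HT) gerDl sumr_le0 // => e.
  rewrite !inE => /andP[eH eT]; have := Tt e eT eH; rewrite inE /= => et.
  by move: st; rewrite /= (path_sortedE tr) v0 => /andP[/allP/(_ _ et)].
have -> : ogreedy H (Some a :: t) = ogreedy (gstep H a) t by [].
have {}Nt : None \in t by move: Nt; rewrite inE.
move: (st); rewrite /= (path_sortedE tr) => /andP[/allP ha st'].
have a0 : 0 <= v (Some a) by rewrite -v0 ha.
rewrite /gstep; case: ifP => [aI|aI]; last first.
  apply: IH => // e eT eH; have := Tt e eT eH; rewrite inE => /orP[/eqP[ea]|//].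
  by move: aI; rewrite (indepS _ TI) // subUset sub1set -ea eT.
have [aT|aT] := boolP (a \in T).
  apply: IH => //; first by rewrite subUset sub1set aT.
  move=> e eT; rewrite !inE negb_or => /andP[ea eH]; have := Tt e eT eH.
  by rewrite inE => /orP[/eqP[/eqP]|//]; rewrite (negPf ea).
(* [C] contains [a] and lies in [a |: T], so it misses at most one element [d] of [T], which occurs
   after [a] in the list and thus has no larger value. *)
have [C CI [aC CT TC]] := augment aI TI.
have {}CT : C \subset a |: T by apply: subset_trans CT _; rewrite -setUA (setUidPr HT).
have aC' : a \in C by apply: (subsetP aC); apply: setU11.
have le_TC : \sum_(e in T) v (Some e) <= \sum_(e in C) v (Some e).
  have [->|[d dT Ce]] := cards_cover1 CT aC' aT TC.
    by rewrite big_setU1 //= lerDr.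
  have da : d != a by apply: contraNneq aT => <-.
  have dH : d \notin H.
    apply/negP => dH; have /(subsetP aC) : d \in a |: H by rewrite inE dH orbT.
    by rewrite Ce setD11.
  have dt : Some d \in t.
    have := Tt d dT dH; rewrite inE => /orP[/eqP[/eqP]|//].
    by rewrite (negPf da).
  have E1 : \sum_(e in a |: T) v (Some e) =
      v (Some d) + \sum_(e in C) v (Some e).
    by rewrite Ce; apply: big_setD1; apply: setU1r.
  rewrite big_setU1 //= in E1.
  have := ha _ dt; lra.
apply: le_trans le_TC _; apply: IH => // e eC.
rewrite !inE negb_or => /andP[ea eH].
have := subsetP CT _ eC; rewrite !inE (negPf ea) /= => eT.
have := Tt e eT eH; rewrite inE => /orP[/eqP[/eqP]|//].
by rewrite (negPf ea).
Qed.

End Greedy.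

(** * Lagrangian relaxation *)

Lemma seq_minP (s : seq rat) : s != [::] ->
  exists2 m, m \in s & {in s, forall y, m <= y}.
Proof.
elim: s => // a [|b s] IH _; first by exists a => [|y]; rewrite inE // => /eqP->.
have [//|m ms mm] := IH; have [am|ma] := leP a m.
  exists a => [|y]; first exact: mem_head.
  by rewrite inE => /predU1P[-> // | /mm my]; apply: le_trans am my.
exists m => [|y]; first by rewrite inE ms orbT.
by rewrite inE => /predU1P[-> | /mm //]; apply: ltW.
Qed.

Lemma seq_maxP (s : seq rat) : s != [::] ->
  exists2 m, m \in s & {in s, forall y, y <= m}.
Proof.
move=> s0; have [|m] := @seq_minP (map -%R s); first by case: s s0.
move=> /mapP[y ys ->] h; exists y => // z zs.
by rewrite -lerN2 h // map_f.
Qed.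

Section TieOrder.
Variables (T : eqType) (c : T -> rat).
Implicit Types (rp sf : seq T).

Definition torder rp sf : seq T :=
  vsort c rp ++ vsort (fun a => - c a) sf.

Lemma perm_torder rp sf : perm_eq (torder rp sf) (rp ++ sf).
Proof. by apply: perm_cat; apply: perm_vsort. Qed.

(** Only [x] changes its place, and it moves forward; all relations among the other elements
    persist. *)
Lemma bef_torder rp sf x y e : uniq (rp ++ x :: sf) ->
  y \in rp ++ x :: sf -> e \in rp ++ x :: sf -> e != x ->
  bef (torder rp (x :: sf)) y e -> bef (torder (x :: rp) sf) y e.
Proof.
move=> u yin ein ex.
have u' : uniq ((x :: rp) ++ sf) by rewrite -(perm_uniq (permEl (perm_catCA rp [:: x] sf))).
have m' z : (z \in (x :: rp) ++ sf) = (z \in rp ++ x :: sf).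
  exact: (perm_mem (permEl (perm_catCA [:: x] rp sf))).
have u1 := u; have u1' := u'.
rewrite -(perm_uniq (perm_torder _ _)) in u1.
rewrite -(perm_uniq (perm_torder _ _)) in u1'.
have mt z := perm_mem (perm_torder rp (x :: sf)) z.
have mt' z := perm_mem (perm_torder (x :: rp) sf) z.
rewrite !bef_cat //; last 4 first.
- by rewrite mt' m'.
- by rewrite mt' m'.
- by rewrite mt.
- by rewrite mt.
rewrite !mem_vsort ![_ \in x :: rp]inE (negPf ex) /=.
have xrp : x \notin rp.
  by apply: contraTN u => h; rewrite cat_uniq /= h /= andbF.
move: u; rewrite cat_uniq => /and3P[urp _ usf].
have urp' : uniq (x :: rp) by rewrite /= xrp.
have usf' : uniq sf by case/andP: usf.
have [yrp|yrp] := boolP (y \in rp); have [erp|erp] := boolP (e \in rp);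
  rewrite ?orbT //.
  have yx : y != x by apply: contraNneq xrp => <-.
  have [y1 e1] : y \in x :: rp /\ e \in x :: rp by rewrite !inE yrp erp !orbT.
  by rewrite (bef_vsort _ urp) // (bef_vsort _ urp') // bef_cons.
rewrite orbF; have [//|yx] := eqVneq y x.
have ysf : y \in sf by move: yin; rewrite mem_cat inE (negPf yrp) (negPf yx).
have esf : e \in sf by move: ein; rewrite mem_cat inE (negPf erp) (negPf ex).
have [y1 e1] : y \in x :: sf /\ e \in x :: sf by rewrite !inE ysf esf !orbT.
by rewrite (bef_vsort _ usf') // (bef_vsort _ usf) // bef_cons.
Qed.

Lemma torder_asc sf a b : uniq sf -> a \in sf -> b \in sf ->
  bef (torder [::] sf) a b -> c a <= c b.
Proof.
move=> u ain bin; rewrite /torder /= bef_vsort // ltrN2 eqr_opp.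
by case/orP=> [/ltW // | /andP[/eqP-> _]].
Qed.

Lemma torder_desc rp a b : uniq rp -> a \in rp -> b \in rp ->
  bef (torder rp [::]) a b -> c b <= c a.
Proof.
move=> u ain bin; rewrite /torder /= cats0 bef_vsort //.
by case/orP=> [/ltW // | /andP[/eqP-> _]].
Qed.

End TieOrder.

Section Lagrange.
Variables (E : finType) (I : {set {set E}}).
Hypothesis hI : is_matroid I.
Variables (H : {set E}) (c p : option E -> rat) (M : seq (option E)).
Variables (beta : rat) (T : {set E}) (Lam : seq rat).
Hypotheses (HI : H \in I) (c0 : c None = 0) (p0 : p None = 0).
Hypotheses (c_ge0 : forall a, 0 <= c a) (p_ge0 : forall a, 0 <= p a).
Hypotheses (uM : uniq M) (NM : None \in M).
Hypotheses (HT : H \subset T) (TI : T \in I).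
Hypothesis TM : forall e, e \in T -> e \notin H -> Some e \in M.
Hypothesis cT : \sum_(e in T) c (Some e) <= beta.
Hypotheses (Lam0 : 0 \in Lam) (Lam_ge0 : {in Lam, forall x, 0 <= x}).
(* Lam contains the multipliers at which two elements change places. *)
Hypothesis Lam_cross : {in M &, forall a b, c b < c a -> p b <= p a ->
  (p a - p b) / (c a - c b) \in Lam}.

Definition lval (x : rat) (a : option E) : rat := p a - x * c a.

Definition state (v : option E -> rat) rp sf := vsort v (torder c rp sf).

Definition stX x i : {set E} :=
  ogreedy I H (state (lval x) (rev (take i M)) (drop i M)).

Local Notation cs X := (\sum_(e in (X : {set E})) c (Some e)).
Local Notation ps X := (\sum_(e in (X : {set E})) p (Some e)).

Lemma perm_state v rp sf : perm_eq (state v rp sf) (rp ++ sf).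
Proof. exact: perm_trans (perm_vsort _ _) (perm_torder _ _ _). Qed.

Lemma perm_stM v i : perm_eq (state v (rev (take i M)) (drop i M)) M.
Proof.
apply: perm_trans (perm_state _ _ _) _.
by rewrite -{3}(cat_take_drop i M) perm_cat2r perm_rev.
Qed.

Lemma stX_indep x i : stX x i \in I.
Proof. exact: greedy_indep. Qed.

Lemma sub_stX x i : H \subset stX x i.
Proof. exact: sub_greedy. Qed.

Lemma mem_stX x i e : e \in stX x i -> e \notin H -> Some e \in M.
Proof.
by move=> eX eH; rewrite -(perm_mem (perm_stM (lval x) i)) (ogreedy_sub eX).
Qed.

Lemma sum_val x (X : {set E}) :
  \sum_(e in X) lval x (Some e) = ps X - x * cs X.
Proof. by rewrite sumrB mulr_sumr. Qed.

Lemma greedy_le (t : seq (option E)) x (X : {set E}) :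
  perm_eq t M -> sorted (fun a b => lval x b <= lval x a) t ->
  H \subset X -> X \in I ->
  (forall e, e \in X -> e \notin H -> Some e \in M) ->
  ps X - x * cs X <= ps (ogreedy I H t) - x * cs (ogreedy I H t).
Proof.
move=> tM st HX XI XM; rewrite -!sum_val.
apply: ogreedy_opt => //; rewrite ?(perm_mem tM) //.
  by rewrite /lval c0 p0 mulr0 subr0.
by move=> e eX eH; rewrite (perm_mem tM) XM.
Qed.

Lemma stX_opt x i :
  ps T - x * cs T <= ps (stX x i) - x * cs (stX x i).
Proof. by apply: greedy_le => //; [exact: perm_stM | exact: sorted_vsort]. Qed.

(* Moving an element forward in the greedy order can only evict others. *)
Lemma stX_step x i e : (i < size M)%N -> e \in stX x i.+1 -> e \notin H ->
  Some e != nth None M i -> e \in stX x i.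
Proof.
move=> iM eX eH ex; move: (eX); apply: (ogreedy_move hI HI) => //.
- by rewrite (perm_uniq (perm_stM _ _)).
- by rewrite (perm_uniq (perm_stM _ _)).
- by move=> y; rewrite !(perm_mem (perm_stM _ _)).
have eM := mem_stX eX eH.
move=> y; rewrite (perm_mem (perm_stM _ _)) => yM.
rewrite (take_nth None iM) rev_rcons (drop_nth None iM).
set rp := rev _; set sf := drop _ _; set y0 := nth _ _ _ in ex *.
have pM : perm_eq (rp ++ y0 :: sf) M.
  by rewrite -drop_nth // -{2}(cat_take_drop i M) perm_cat2r perm_rev.
have pM' : perm_eq ((y0 :: rp) ++ sf) M.
  by apply: perm_trans pM; rewrite (perm_catCA [:: y0] rp sf).
have q1 := perm_trans (perm_torder c rp (y0 :: sf)) pM.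
have q2 := perm_trans (perm_torder c (y0 :: rp) sf) pM'.
rewrite /state !bef_vsort ?(perm_uniq q1) ?(perm_uniq q2) //;
  try by rewrite ?(perm_mem q1) ?(perm_mem q2).
case/orP=> [-> // | /andP[-> /= h]]; apply/orP; right.
by apply: bef_torder h; rewrite ?(perm_uniq pM) ?(perm_mem pM).
Qed.

(** At the largest multiplier an element of positive cost has value at most 0, because its crossing
    with [None] lies in [Lam]; in a tie the cheaper [None] comes first. So only elements of cost 0
    join [H], which costs no more than [T]. *)
Lemma stX0_feasible : exists2 x, x \in Lam & cs (stX x 0) <= beta.
Proof.
have Lnz : Lam != [::] by case: (Lam) Lam0.
have [x xL xmax] := seq_maxP Lnz.
have x0 := Lam_ge0 xL.
exists x => //; apply: le_trans cT; apply: (@le_trans _ _ (cs H)); last first.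
  rewrite [leRHS](big_setID H) /= (setIidPr HT) lerDl sumr_ge0 //.
rewrite [leLHS](big_setID H) /= (setIidPr (sub_stX x 0)) gerDl sumr_le0 // => e.
rewrite inE => /andP[eH eX]; have eM := mem_stX eX eH.
move: eX; rewrite /stX take0 drop0 [rev _]/=.
have := perm_stM (lval x) 0; rewrite take0 drop0 [rev _]/=.
set t := state _ _ _ => tM.
have ut : uniq t by rewrite (perm_uniq tM).
have et : Some e \in t by rewrite (perm_mem tM).
have Nt : None \in t by rewrite (perm_mem tM).
have bN : bef t None (Some e) || bef t (Some e) None.
  rewrite /bef; case: ltngtP => // /(congr1 (nth None t)).
  by rewrite !nth_index.
have tE : t = take (index (Some e) t) t ++ Some e :: drop (index (Some e) t).+1 t.
  by rewrite -[LHS](cat_take_drop (index (Some e) t)) (drop_nth None)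
     ?index_mem // nth_index.
rewrite [X in ogreedy _ _ X]tE mem_ogreedy // -?tE //.
case/andP=> Ntake _.
have {bN} : bef t (Some e) None.
  by case/orP: bN => // /bef_take; rewrite (negPf Ntake).
have pt : perm_eq (torder c [::] M) M by apply: perm_torder.
rewrite bef_vsort ?(perm_uniq pt) ?(perm_mem pt) //.
rewrite {1 3}/lval c0 p0 mulr0 subr0 => ord.
have [//|ce] := leP (c (Some e)) 0.
have := Lam_cross eM NM; rewrite c0 p0 !subr0 => /(_ ce (p_ge0 _)) /xmax.
rewrite ler_pdivrMr // => pe.
case/orP: ord => [|/andP[_ h]]; first by rewrite /lval; lra.
by have := torder_asc uM eM NM h; rewrite c0 leNgt ce.
Qed.

(* No two elements change places strictly between y and x, so both solutions are
   optimal for the multiplier x and for the midpoint of y and x. *)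
Lemma cost_eq x y : y \in Lam -> y < x ->
  {in Lam, forall z, ~~ ((y < z) && (z < x))} ->
  cs (stX y 0) = cs (stX x (size M)).
Proof.
move=> yL yx gap; have y0 := Lam_ge0 yL.
(* An inversion at [z] would put the crossing of [a] and [b] below [x] and not below [y], hence at
   [y]. But a tie at [y] is broken by increasing cost, the order correct for larger multipliers. *)
have ord1 z : y < z -> z <= x ->
    sorted (fun a b => lval z b <= lval z a) (state (lval y) (rev (take 0 M)) (drop 0 M)).
  move=> yz zx; apply: sorted_bef.
    by rewrite (perm_uniq (perm_stM _ _)).
  move=> a b; rewrite !(perm_mem (perm_stM _ _)) => aM bM.
  rewrite take0 drop0 [rev _]/= /state.
  have pt : perm_eq (torder c [::] M) M by apply: perm_torder.
  rewrite bef_vsort ?(perm_uniq pt) ?(perm_mem pt) // => ord.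
  have [//|lt_ab] := leP (lval z b) (lval z a); rewrite /lval in ord lt_ab.
  have ge_y : y * (c a - c b) <= p a - p b.
    by case/orP: ord => [|/andP[/eqP + _]]; lra.
  have cab : c b < c a by nra.
  have pab : p b <= p a by nra.
  have := gap _ (Lam_cross aM bM cab pab).
  rewrite ltr_pdivrMr ?ltr_pdivlMr ?subr_gt0 //.
  have -> : p a - p b < x * (c a - c b) by nra.
  rewrite andbT -leNgt => le_y.
  case/orP: ord => [|/andP[_ h]]; first by nra.
  by have := torder_asc uM aM bM h; lra.
have ord2 z : y < z -> z <= x ->
    sorted (fun a b => lval z b <= lval z a)
      (state (lval x) (rev (take (size M) M)) (drop (size M) M)).
  move=> yz zx; apply: sorted_bef.
    by rewrite (perm_uniq (perm_stM _ _)).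
  move=> a b; rewrite !(perm_mem (perm_stM _ _)) => aM bM.
  rewrite take_size drop_size /state.
  have pt : perm_eq (torder c (rev M) [::]) M.
    by apply: perm_trans (perm_torder _ _ _) _; rewrite cats0 perm_rev.
  rewrite bef_vsort ?(perm_uniq pt) ?(perm_mem pt) // => ord.
  have [//|lt_ab] := leP (lval z b) (lval z a); rewrite /lval in ord lt_ab.
  have ge_x : x * (c a - c b) <= p a - p b.
    by case/orP: ord => [|/andP[/eqP + _]]; lra.
  have cab : c a < c b by nra.
  have pab : p a <= p b by nra.
  have := gap _ (Lam_cross bM aM cab pab).
  rewrite ltr_pdivrMr ?ltr_pdivlMr ?subr_gt0 //.
  have -> : y * (c b - c a) < p b - p a by nra.
  rewrite /= -leNgt => le_x.
  case/orP: ord => [|/andP[_ h]]; first by nra.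
  have uR : uniq (rev M) by rewrite rev_uniq.
  by have := torder_desc uR _ _ h; rewrite !mem_rev => /(_ aM bM); lra.
have eq z : y < z -> z <= x ->
    ps (stX y 0) - z * cs (stX y 0) =
    ps (stX x (size M)) - z * cs (stX x (size M)).
  move=> yz zx; apply/eqP; rewrite eq_le; apply/andP; split.
    apply: greedy_le; [exact: perm_stM | exact: ord2 | exact: sub_stX
      | exact: stX_indep | exact: mem_stX].
  apply: greedy_le; [exact: perm_stM | exact: ord1 | exact: sub_stX
      | exact: stX_indep | exact: mem_stX].
(* The difference of the two Lagrangian values is affine in the multiplier; it vanishes at two
   points, so its slope, the difference of the costs, is zero. *)
have h1 := eq x yx (lexx _).
have [m1 m2] : y < (x + y) / 2 /\ (x + y) / 2 < x by split; lra.
have h2 := eq _ m1 (ltW m2).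
have : (x - y) * (cs (stX y 0) - cs (stX x (size M))) = 0 by lra.
by move/eqP; rewrite mulf_eq0 !subr_eq0 (gt_eqF yx) /= => /eqP.
Qed.

Definition cand v rp o sf : {set E} :=
  ogreedy I H (state v (o :: rp) sf) :\: [set e | Some e == o].

Lemma candE x i : (i < size M)%N ->
  cand (lval x) (rev (take i M)) (nth None M i) (drop i.+1 M)
  = stX x i.+1 :\: [set e | Some e == nth None M i].
Proof. by move=> iM; rewrite /cand /stX (take_nth None iM) rev_rcons. Qed.

(** The infeasible solution after the critical step maximises [p - x c] and costs more than [T], so
    its profit is at least that of [T]; without the moved element it lies inside the preceding
    feasible solution. The multiplier is the least one whose starting solution is feasible: if its
    last solution were feasible too and [x > 0], [cost_eq] would make the next smaller multiplier
    start feasibly. *)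
Theorem lagrangian_candidate : exists x i,
  let Z := cand (lval x) (rev (take i M)) (nth None M i) (drop i.+1 M) in
  [/\ x \in Lam, (i < size M)%N, Z \in I, cs Z <= beta
    & ps T - p (nth None M i) <= ps Z].
Proof.
have M0 : (0 < size M)%N by case: (M) NM.
suff [x [i [xL iM cZ pY]]] : exists x i, [/\ x \in Lam, (i < size M)%N,
    cs (stX x i.+1 :\: [set e | Some e == nth None M i]) <= beta
    & ps T <= ps (stX x i.+1)].
  exists x, i; rewrite candE //; split=> //.
    by apply: (indepS hI) (stX_indep x i.+1); apply: subsetDl.
  rewrite lerBlDr; apply: le_trans pY _.
  set D := [set e | _]; rewrite (big_setID D) /= addrC lerD2l.
  have sD e : e \in stX x i.+1 :&: D -> Some e = nth None M i.
    by rewrite !inE => /andP[_ /eqP].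
  have [->|[e eD]] := set_0Vmem (stX x i.+1 :&: D); first by rewrite big_set0.
  rewrite -(sD e eD) (_ : _ :&: _ = [set e]) ?big_set1 //.
  apply/setP=> y; rewrite in_set1; apply/idP/eqP => [yD|-> //].
  by have := sD y yD; rewrite -(sD e eD) => -[].
have subD x i : cs (stX x i.+1 :\: [set e | Some e == nth None M i])
    <= cs (stX x i.+1).
  set D := [set e | _]; rewrite [leRHS](big_setID D) /= lerDr sumr_ge0 //.
have [x' x'L x'F] := stX0_feasible.
pose s := [seq x <- Lam | cs (stX x 0) <= beta].
have [|x] := @seq_minP s.
  apply: contraTneq x'L => s0; apply/negP => x'L.
  by have : x' \in s; [rewrite mem_filter x'F | rewrite s0].
rewrite mem_filter => /andP[xF xL] xmin.
have [Fn|nFn] := leP (cs (stX x (size M))) beta.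
  (* At multiplier 0 a feasible last solution has maximal profit. It arises from the last move,
     whence the index [(size M).-1]. *)
  have [x0|xn0] := eqVneq x 0.
    exists 0, (size M).-1; split=> //.
    - by rewrite prednK.
    - by rewrite x0 in Fn; apply: le_trans (subD _ _) _; rewrite prednK.
    - by rewrite prednK //; have := stX_opt 0 (size M); rewrite !mul0r !subr0.
  have xgt0 : 0 < x by rewrite lt_neqAle eq_sym xn0 Lam_ge0.
  have [|y] := @seq_maxP [seq y <- Lam | y < x].
    apply: contraTneq Lam0 => s0; apply/negP => h0.
    by have : 0 \in [seq y <- Lam | y < x]; [rewrite mem_filter xgt0 | rewrite s0].
  rewrite mem_filter => /andP[yx yL] ymax.
  have nFy : ~~ (cs (stX y 0) <= beta).
    apply: contraTN yx => Fy; rewrite -leNgt xmin //.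
    by rewrite mem_filter Fy.
  rewrite (cost_eq yL yx) ?Fn // in nFy.
  move=> z zL; apply/negP => /andP[yz zx].
  by have := ymax z; rewrite mem_filter zx zL leNgt yz => /(_ isT).
have [i iF iN] : exists2 i, (i < size M)%N &
    cs (stX x i) <= beta < cs (stX x i.+1).
  have := nFn; elim: (size M) => [|n IH nF]; first by rewrite ltNge xF.
  have [Fn|/IH[i ni hi]] := leP (cs (stX x n)) beta.
    by exists n; rewrite // Fn.
  by exists i => //; apply: ltnW.
case/andP: iN => Fi nFi; exists x, i; split=> //.
  apply: le_trans Fi; set D := [set e | _].
  have sub : stX x i.+1 :\: D \subset stX x i.
    apply/subsetP => e; rewrite !inE => /andP[ex eX].
    have [eH|eH] := boolP (e \in H); first exact: (subsetP (sub_stX x i)).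
    exact: stX_step eX eH ex.
  rewrite [leRHS](big_setID (stX x i.+1 :\: D)) /= (setIidPr sub) lerDl.
  by apply: sumr_ge0 => e _; apply: c_ge0.
have : 0 <= x * (cs (stX x i.+1) - cs T).
  apply: mulr_ge0; first exact: Lam_ge0.
  by rewrite subr_ge0 ltW // (le_lt_trans cT).
by have := stX_opt x i.+1; rewrite mulrBr; lra.
Qed.

End Lagrange.

(** * Representatives of the profitable elements *)

Section Substitution.
Variables (E : finType) (I : {set {set E}}).
Hypothesis hI : is_matroid I.
Variables (c p : E -> rat) (beta V : rat) (L : nat).
Hypotheses (c_ge0 : forall e, 0 <= c e) (p_ge0 : forall e, 0 <= p e).
Hypotheses (V_gt0 : 0 < V) (L_gt1 : (1 < L)%N).

Local Notation cs X := (\sum_(e in (X : {set E})) c e).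
Local Notation ps X := (\sum_(e in (X : {set E})) p e).

Definition feas (X : {set E}) : bool := (X \in I) && (cs X <= beta).

Hypothesis V_max : forall X, feas X -> ps X <= V.

Local Notation U := (L ^ 2)%N.

(** The classes are nested, given by a lower bound on the profit only: a replacement of larger
    profit is welcome as long as it is cheap. *)
Definition basis (th : rat) : seq E :=
  let s := vsort (fun e => - c e) [seq e <- enum E | th <= p e] in
  take U [seq e <- s | e \in greedy I set0 s].

Definition inR (e : E) : bool :=
  has (fun j => e \in basis (j%:R * V / U%:R)) (iota 1 U).

Lemma mem_basis th b : b \in basis th -> th <= p b.
Proof.
by move=> /mem_take; rewrite mem_filter mem_vsort mem_filter => /and3P[].
Qed.

(** There are two ways to be left out: [U] elements were kept before [h] was reached, or the greedy
    algorithm rejected [h], since the elements accepted earlier span it. Elements in front of [h]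
    are not more expensive. *)
Lemma basisP th h : th <= p h -> h \notin basis th ->
  exists B : {set E}, [/\ {subset B <= basis th},
    forall b, b \in B -> c b <= c h, B \in I
    & #|B| = U \/ h |: B \notin I].
Proof.
move=> thh; rewrite /basis; set s := vsort _ _.
have us : uniq s by rewrite vsort_uniq filter_uniq ?enum_uniq.
have hs : h \in s by rewrite mem_vsort mem_filter thh mem_enum.
have ss : sorted (fun a b => - c b <= - c a) s by apply: sorted_vsort.
case/splitPr: hs us ss => s1 s2 us ss.
have tr : transitive (fun a b => - c b <= - c a).
  by move=> a b d ab bd; apply: le_trans bd ab.
have c1 b : b \in s1 -> c b <= c h.
  move: ss; rewrite (sorted_pairwise tr) pairwise_cat /= allrelC.
  by case/and3P=> /allrelP ss _ _ b1; rewrite -lerN2 ss ?mem_head.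
set G := greedy _ _ _; rewrite filter_cat.
have GI : G \in I.
  by apply: greedy_indep; have [] := hI.
set f1 := [seq e <- s1 | e \in G].
have uf : uniq f1.
  by rewrite filter_uniq //; move: us; rewrite cat_uniq => /and3P[].
have [Uf|fU] := leqP U (size f1).
  rewrite takel_cat // => _; exists [set e in take U f1]; split.
  - by move=> b; rewrite inE.
  - by move=> b; rewrite inE => /mem_take; rewrite mem_filter => /andP[_ /c1].
  - apply: (indepS hI) GI; apply/subsetP => b; rewrite inE => /mem_take.
    by rewrite mem_filter => /andP[].
  - left; rewrite cardsE; have /card_uniqP -> := take_uniq U uf.
    by rewrite size_takel.
have [h1 h2] : h \notin s1 /\ h \notin s2.
  move: us; rewrite cat_uniq /= negb_or => /and3P[_ /andP[-> _] /andP[-> _]].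
  by [].
rewrite take_cat ltnNge (ltnW fU) /= mem_cat negb_or => /andP[_ hf].
have hG : h \notin G.
  apply: contra hf => hG; rewrite hG.
  by case: (U - size f1)%N (subn_gt0 (size f1) U) fU => [|n] <- // _; rewrite mem_head.
have f1G b : b \in greedy I set0 s1 -> b \in f1.
  move=> bG; have := subsetP (greedy_sub I set0 s1) b bG.
  rewrite !inE /= mem_filter => bs1; rewrite bs1 andbT.
  by rewrite /G greedy_cat; apply: (subsetP (sub_greedy _ _ _)).
exists (greedy I set0 s1); split.
- by move=> b /f1G bf; rewrite mem_cat bf.
- by move=> b /f1G; rewrite mem_filter => /andP[_ /c1].
- by apply: greedy_indep; have [] := hI.
- by right; move: hG; rewrite /G mem_greedy // inE.
Qed.

Lemma sub_sum (f : E -> rat) (A B : {set E}) : (forall e, 0 <= f e) ->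
  A \subset B -> \sum_(e in A) f e <= \sum_(e in B) f e.
Proof.
move=> f0 AB; rewrite [leRHS](big_setID A) /= (setIidPr AB) lerDl.
by rewrite sumr_ge0.
Qed.

(* An element h outside of the representative set can be exchanged for a
   cheaper representative b of nearly the same profit: either the basis of the
   class of h contains so many elements that one of them extends the elements
   of S of noticeable profit, and then at most one element of small profit has
   to be dropped, or the elements of the basis that are cheaper than h span
   h. *)
Lemma substitute S h : feas S -> h \in S -> V / L%:R < p h -> ~~ inR h ->
  exists b (S' : {set E}), [/\ inR b, S' \subset b |: (S :\ h), feas S'
    & ps S - 2 * V / U%:R <= ps S'].
Proof.
move=> fS hS ph hR; have /andP[SI cS] := fS.
have L0 : (0 : rat) < L%:R by rewrite ltr0n; lia.
have UE : (U%:R : rat) = L%:R * L%:R by rewrite natrX expr2.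
have U0 : (0 : rat) < U%:R by rewrite UE mulr_gt0.
have L2 : (2 : rat) <= L%:R by rewrite ler_nat.
(* In units of [V / U] the profit of [h] is [x]; rounding down gives its class [j], whose threshold
   is at most one unit below [p h]. *)
set x := U%:R * p h / V.
have x0 : 0 <= x by rewrite divr_ge0 ?mulr_ge0 // ltW.
have /andP[jx xj] := truncn_itv x0; set j := Num.truncn x in jx xj.
have phS : p h <= V.
  apply: le_trans (V_max fS); rewrite (big_setD1 h) //= lerDl.
  by rewrite sumr_ge0.
have jU : (j <= U)%N.
  rewrite -(ler_nat rat); apply: le_trans jx _.
  by rewrite /x ler_pdivrMr // ler_pM2l.
have xL : L%:R < x.
  by rewrite /x ltr_pdivlMr // UE -mulrA ltr_pM2l // mulrC -ltr_pdivrMr.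
have j2 : (1 < j)%N.
  rewrite -ltnS -(ltr_nat rat); apply: le_lt_trans xj.
  by apply: le_trans L2 _; apply: ltW.
set d := V / U%:R; have d0 : 0 < d by rewrite divr_gt0.
set th := j%:R * V / U%:R.
have thE : th = j%:R * d by rewrite /th /d mulrA.
have pE : p h = x * d.
  by rewrite /x /d mulrACA; field; rewrite !gt_eqF.
have th_h : th <= p h by rewrite thE pE ler_pM2r.
have h_th : p h <= th + d.
  by rewrite thE pE -{3}[d]mul1r -mulrDl ler_pM2r // ltW // natr1.
(* Since [j >= 2], every representative of this class has profit above [d]; so one that lies in [A]
   already belongs to the set [N] below. *)
have d_th : d < th.
  by rewrite thE -{1}[d]mul1r ltr_pM2r // ltr1n.
have jin : j \in iota 1 U by rewrite mem_iota add1n ltnS jU (ltnW j2).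
have hb : h \notin basis th by apply: contra hR => hb; apply/hasP; exists j.
have [B [Bb cB BI Bcase]] := basisP th_h hb.
set A := S :\ h.
have AI : A \in I by apply: (indepS hI) SI; apply: subD1set.
have SA : S = h |: A by rewrite setD1K.
have hA : h \notin A by rewrite !inE eqxx.
suff [b [C [bB CI CA pC]]] : exists b (C : {set E}), [/\ b \in B, C \in I,
    C \subset b |: A & ps A + p b - d <= ps C].
  have bb := Bb _ bB.
  exists b, C; split=> //.
  - by apply/hasP; exists j.
  - rewrite /feas CI /=; apply: le_trans cS.
    apply: le_trans (sub_sum c_ge0 CA) _.
    have [bA|bA] := boolP (b \in A).
      by rewrite (setUidPr _) ?sub1set //; apply: (sub_sum c_ge0); apply: subD1set.
    by rewrite big_setU1 //= SA big_setU1 //= lerD2r cB.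
  - have := mem_basis bb; rewrite {1}SA big_setU1 //=.
    by rewrite -mulrA -/d; lra.
case: Bcase => [BU|hB].
  pose N := [set a in A | d < p a].
  have NA : N \subset A by apply/subsetP => a; rewrite inE => /andP[].
  have NI : N \in I by apply: (indepS hI) AI.
  have NU : (#|N| < #|B|)%N.
    rewrite BU ltnNge; apply/negP => UN.
    have [a aN] : exists a, a \in N 
      by apply/card_gt0P; apply: leq_trans UN; rewrite expn_gt0 (ltnW L_gt1).
    have psN : ps N <= V.
      apply: le_trans (V_max fS); apply: (sub_sum p_ge0).
      by apply: subset_trans NA (subD1set _ _).
    have lt : #|N|%:R * d < ps N.
      rewrite mulr_natl -sumr_const; apply: ltr_sum.
        by apply/hasP; exists a; rewrite ?mem_index_enum.
      by move=> e; rewrite inE => /andP[].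
    have : U%:R * d <= #|N|%:R * d by rewrite ler_pM2r // ler_nat.
    have : U%:R * d = V by rewrite /d mulrC divfK // gt_eqF.
    by lra.
  have [_ _ /(_ N B NI BI NU)[b]] := hI; rewrite inE => /andP[bN bB] bI.
  have bA : b \notin A.
    apply: contra bN => bA; rewrite inE bA /=.
    exact: lt_le_trans d_th (mem_basis (Bb _ bB)).
  have [C CI [NC CNA AC]] := augment hI bI AI.
  have CA : C \subset b |: A.
    by apply: subset_trans CNA _; rewrite -setUA (setUidPr NA).
  have bC : b \in C by apply: (subsetP NC); apply: setU11.
  exists b, C; split=> //.
  have [->|[y yA Cy]] := cards_cover1 CA bC bA AC.
    by rewrite big_setU1 //=; lra.
  have py : p y <= d.
    rewrite leNgt; apply/negP => dy.
    have : y \in C by apply: (subsetP NC); apply: setU1r; rewrite inE yA.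
    by rewrite Cy setD11.
  have : ps (b |: A) = p y + ps C by rewrite Cy; apply: big_setD1; apply: setU1r.
  by rewrite big_setU1 //=; lra.
(* [D] extends [B] by elements of [S] and avoids [h], which [B] spans. The element with which [D]
   augments [A] must then come from [B]. *)
have [D DI [BD DBS SD]] := augment hI BI SI.
have hD : h \notin D.
  by apply: contra hB => hD; apply: (indepS hI) DI; rewrite subUset sub1set hD.
have AD : (#|A| < #|D|)%N by move: SD; rewrite {1}SA cardsU1 hA.
have [_ _ /(_ A D AI DI AD)[b]] := hI; rewrite inE => /andP[bA bD] bI.
exists b, (b |: A); split=> //; last by rewrite big_setU1 //=; lra.
have := subsetP DBS b bD; rewrite inE => /orP[//|bS].
by move: bA; rewrite !inE bS andbT negbK => /eqP bh; rewrite -bh bD in hD.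
Qed.

Definition heavy (S : {set E}) : {set E} := [set e in S | V / L%:R < p e].

Lemma card_heavy S : feas S -> (#|heavy S| <= L)%N.
Proof.
move=> fS; have L0 : (0 : rat) < L%:R by rewrite ltr0n; lia.
have t0 : 0 < V / L%:R by rewrite divr_gt0.
rewrite -(ler_nat rat) -(ler_pM2r t0) [leRHS]mulrC divfK ?gt_eqF //.
apply: le_trans (V_max fS).
apply: (@le_trans _ _ (ps (heavy S))); last first.
  by apply: (sub_sum p_ge0); apply/subsetP => a; rewrite inE => /andP[].
rewrite mulr_natl -sumr_const; apply: ler_sum => e; rewrite inE => /andP[_].
exact: ltW.
Qed.

(** Each exchange removes a heavy element that is no representative and adds only a representative,
    so the number of the former decreases. *)
Lemma substitute_all n S : feas S ->
  (#|[set e in heavy S | ~~ inR e]| <= n)%N ->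
  exists S' : {set E}, [/\ feas S', {in heavy S', forall e, inR e}
    & ps S - n%:R * (2 * V / U%:R) <= ps S'].
Proof.
elim: n S => [|n IH] S fS.
  rewrite leqn0 cards_eq0 => /eqP bad; exists S; split=> //; last first.
    by rewrite mul0r subr0.
  move=> e eS; apply/negPn/negP => eR.
  by have := in_set0 e; rewrite -bad inE eS eR.
set W := [set e in _ | _] => Wn.
have [W0|[h]] := set_0Vmem W.
  have [|S' [fS' hS' pS']] := IH S fS; first by rewrite -/W W0 cards0.
  exists S'; split=> //; apply: le_trans pS'; rewrite lerD2l lerN2.
  by rewrite ler_wpM2r ?ler_nat // divr_ge0 // mulr_ge0 // ltW.
rewrite inE => /andP[]; rewrite inE => /andP[hS ph] hR.
have [b [S1 [bR sub fS1 pS1]]] := substitute fS hS ph hR.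
have [|S' [fS' hS' pS']] := IH S1 fS1.
  have hW : h \in W by rewrite !inE hS ph hR.
  rewrite (cardsD1 h) hW add1n ltnS in Wn; apply: leq_trans Wn.
  apply: subset_leq_card; apply/subsetP => e; rewrite !inE.
  case/andP=> /andP[eS1 pe] eR.
  have := subsetP sub e eS1; rewrite !inE => /orP[/eqP eb|/andP[-> ->]].
    by rewrite eb bR in eR.
  by rewrite pe eR.
exists S'; split=> //; apply: le_trans pS'.
by rewrite -natr1 mulrDl mul1r; lra.
Qed.

(** At most [L] exchanges at [2V / L^2] each: the width [V / L^2] of the classes is chosen for this
    total of [2V / L]. *)
Lemma substitution S : feas S -> exists S' : {set E},
  [/\ feas S', {in heavy S', forall e, inR e} & ps S - 2 * V / L%:R <= ps S'].
Proof.
move=> fS; have [|S' [fS' hS' pS']] := @substitute_all L S fS.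
  apply: leq_trans (card_heavy fS); apply: subset_leq_card.
  by apply/subsetP => e; rewrite inE => /andP[].
exists S'; split=> //; apply: le_trans pS'; rewrite lerD2l lerN2.
rewrite natrX le_eqVlt; apply/orP; left; apply/eqP; field.
by rewrite pnatr_eq0; lia.
Qed.

End Substitution.

(** * Correctness of the algorithm *)

Lemma dif_bool b x y : dif (enc_bool b) x y = if b then x else y.
Proof. by case: b. Qed.

Lemma isn_bool b : isn (enc_bool b) = b.
Proof. by case: b. Qed.

(** Any node counts as the digit one and leading zeros are allowed, so the arithmetic lemmas hold on
    all data. *)
Fixpoint nval (d : data) : nat :=
  if d is Node a r then (isn a + (nval r).*2)%N else 0%N.

Lemma nval_enc n : nval (enc_nat n) = n.
Proof.
rewrite /enc_nat /nat_bits -[RHS]bin_of_natK; case: (bin_of_nat n) => //= q.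
by elim: q => //= q ->; rewrite NatTrec.doubleE.
Qed.

Lemma nval_inc y c : nval (incD y c) = (nval y + isn c)%N.
Proof.
rewrite /incD; elim: y c => [|a _ y IH] c /=; first by case: c.
by rewrite IH; case: c => [|? ?]; case: a => [|? ?] //=; lia.
Qed.

Lemma nval_add x y c : nval (addD x y c) = (nval x + nval y + isn c)%N.
Proof.
rewrite /addD; elim: x y c => [|a _ x IH] y c /=; first exact: nval_inc.
rewrite IH; case: y => [|b y] /=.
  by case: c => [|? ?]; case: a => [|? ?] //=; lia.
by case: c => [|? ?]; case: a => [|? ?]; case: b => [|? ?] //=; lia.
Qed.

Lemma nval_mul x y : nval (mulD x y) = (nval x * nval y)%N.
Proof.
elim: x => [|a _ x IH] //; rewrite mulD_cons; case: a => [|? ?].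
  by rewrite /= IH; nia.
by rewrite nval_add /= IH; nia.
Qed.

Lemma nzDE y : nzD y = enc_bool (0 < nval y)%N.
Proof.
rewrite /nzD; elim: y => //= a _ y ->; case: a => [|? ?] //=.
by rewrite double_gt0.
Qed.

Lemma leDE x y : leD x y = enc_bool (nval x <= nval y)%N.
Proof.
(* A false verdict on the lower digits acts like a borrow and adds one to the left side. *)
suff H b : rec (fun p => dif (nzD (left_of p)) dtrue (right_of p))
    (fun d => Node (right_of (left_of (par d)))
       (dif (nhd d)
          (dif (left_of (left_of (par d))) (right_of (par d)) Leaf)
          (dif (left_of (left_of (par d))) dtrue (right_of (par d)))))
    (fun d => acc d) x (Node y (enc_bool b)) = enc_bool (nval x + ~~ b <= nval y)%N.
  by rewrite /leD (H true) addn0.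
elim: x y b => [|a _ x IH] y b.
  by rewrite /= nzDE dif_bool; case: b; case: (nval y).
have IH0 y' : _ := IH y' false; have IH1 y' : _ := IH y' true.
rewrite /= in IH0 IH1.
case: y => [|b0 y]; move vE: (_ <= _)%N => v; rewrite /=.
  by case: a vE => [|? ?]; case: b => vE; rewrite /= ?IH0 ?IH1;
     congr enc_bool; rewrite -vE /=; lia.
by case: a vE => [|? ?]; case: b; case: b0 => [|? ?] vE;
   rewrite /= ?IH0 ?IH1; congr enc_bool; rewrite -vE /=; lia.
Qed.

Lemma nval_num s : nval (numD (enc_seq s)) = size s.
Proof.
rewrite /numD; elim: s => //= a s IH.
by rewrite nval_inc IH addn1.
Qed.

Definition qval (d : data) : rat :=
  (nval (left_of d))%:R / (nval (right_of d))%:R.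

Definition qpos (d : data) : bool := (0 < nval (right_of d))%N.

Lemma qpos_neq0 d : qpos d -> (nval (right_of d))%:R != 0 :> rat.
Proof. by rewrite /qpos pnatr_eq0 -lt0n. Qed.

Lemma qleDE x y : qpos x -> qpos y -> qleD x y = enc_bool (qval x <= qval y).
Proof.
move=> px py; rewrite /qleD leDE !nval_mul; congr enc_bool.
rewrite /qval ler_pdivrMr ?ltr0n // mulrAC ler_pdivlMr ?ltr0n //.
by rewrite -!natrM ler_nat.
Qed.

Lemma qpos_add x y : qpos x -> qpos y -> qpos (qaddD x y).
Proof. by rewrite /qpos /qaddD /= nval_mul muln_gt0 => -> ->. Qed.

Lemma qpos_mul x y : qpos x -> qpos y -> qpos (qmulD x y).
Proof. by rewrite /qpos /qmulD /= nval_mul muln_gt0 => -> ->. Qed.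

Lemma qval_add x y : qpos x -> qpos y -> qval (qaddD x y) = qval x + qval y.
Proof.
move=> /qpos_neq0 px /qpos_neq0 py.
rewrite /qval /qaddD /= nval_add !nval_mul addn0 natrD !natrM.
by field; rewrite px py.
Qed.

Lemma qval_mul x y : qpos x -> qpos y -> qval (qmulD x y) = qval x * qval y.
Proof.
move=> /qpos_neq0 px /qpos_neq0 py.
rewrite /qval /qmulD /= !nval_mul !natrM.
by field; rewrite px py.
Qed.

Lemma sumDE s : all qpos s ->
  qval (sumD (enc_seq s)) = \sum_(x <- s) qval x /\ qpos (sumD (enc_seq s)).
Proof.
elim: s => [|a s IH] /=; first by rewrite big_nil.
case/andP=> pa /IH[es ps].
rewrite -[sumD _]/(qaddD a (sumD (enc_seq s))) big_cons -es.
by rewrite qval_add // qpos_add.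
Qed.

Lemma qpos_enc q : qpos (enc_rat q).
Proof. by rewrite /qpos /= nval_enc absz_gt0 denq_eq0. Qed.

Lemma qval_enc q : 0 <= q -> qval (enc_rat q) = q.
Proof.
move=> q0; rewrite /qval /= !nval_enc -[RHS]divq_num_den.
by rewrite !natr_absz ger0_norm ?numq_ge0 // gtr0_norm ?denq_gt0.
Qed.

Lemma qval_zero : qval zeroD = 0.
Proof. by rewrite /qval /= mul0r. Qed.

Lemma qval_one : qval oneD = 1.
Proof. by rewrite /qval /= divr1. Qed.

Lemma vsort_map (T1 T2 : eqType) (f : T1 -> T2) v s :
  vsort v (map f s) = map f (vsort (v \o f) s).
Proof.
elim: s => //= x s ->; elim: (vsort _ s) => //= a t IH.
by case: ifP => //= _; rewrite IH.
Qed.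

Lemma fmap_filter (T : eqType) (h : T -> data) f p s (P : pred T) :
  {in s, forall x, f (Node p (h x)) = if P x then Node (h x) Leaf else Leaf} ->
  fmap f p (enc_seq (map h s)) = enc_seq (map h (filter P s)).
Proof.
move=> fP; rewrite (@fmapE _ _ _ _ _ (fun x => if P x then [:: h x] else [::])).
  by congr enc_seq; elim: s {fP} => //= x s ->; case: (P x).
by move=> x xs; rewrite fP //; case: (P x).
Qed.

Lemma splitsDE s : splitsD (enc_seq s) = enc_seq
  [seq Node (enc_seq (rev (take i s))) (enc_seq (drop i s)) | i <- iota 0 (size s)].
Proof.
suff H rp : rec (fun _ => Leaf) (fun d => Node (nhd d) (par d))
    (fun d => Node (Node (par d) (lst d)) (acc d)) (enc_seq s) (enc_seq rp)
  = enc_seq [seq Node (enc_seq (catrev (take i s) rp)) (enc_seq (drop i s))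
              | i <- iota 0 (size s)] by rewrite /splitsD (H [::]).
elim: s rp => //= a s IH rp; congr Node.
rewrite (IH (a :: rp)) -[1%N]addn0 iotaDl -map_comp.
by congr enc_seq; apply: eq_map.
Qed.

Lemma firstDE k (s : seq data) : firstD (enc_seq (nseq k Leaf)) (enc_seq s) = enc_seq (take k s).
Proof.
rewrite /firstD; elim: s k => [|a s IH] [|k] //=.
by rewrite IH.
Qed.

Lemma fmap_units s : fmap (fun _ => dtrue) Leaf (enc_seq s)
  = enc_seq (nseq (size s) Leaf).
Proof. by elim: s => //= a s <-. Qed.

Section Specs.
Variables (R : realType) (w : world R).
Local Notation E := (ground (wK w)).
Local Notation I := (indep (wK w)).
Implicit Types X Y H : {set E}.

Lemma vorDE X Y : vorD (enc_set X) (enc_set Y) = enc_set (X :|: Y).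
Proof.
rewrite /enc_set /vorD; elim: (enum E) => //= e s ->; congr Node.
by rewrite in_setU !dif_bool; case: (e \in X); case: (e \in Y).
Qed.

Lemma vdiffDE X Y : vdiffD (enc_set X) (enc_set Y) = enc_set (X :\: Y).
Proof.
rewrite /enc_set /vdiffD; elim: (enum E) => //= e s ->; congr Node.
by rewrite in_setD !dif_bool; case: (e \in X); case: (e \in Y).
Qed.

Lemma vdiffD0 X : vdiffD (enc_set X) Leaf = enc_set X.
Proof.
rewrite /enc_set /vdiffD; elim: (enum E) => //= e s ->; congr Node.
by rewrite dif_bool; case: (e \in X).
Qed.

Lemma disjDE e X : disjD (enc_set [set e]) (enc_set X) = enc_bool (e \notin X).
Proof.
have H s : disjD (enc_seq [seq enc_bool (y \in [set e]) | y <- s])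
    (enc_seq [seq enc_bool (y \in X) | y <- s])
    = enc_bool (all (fun y => (y != e) || (e \notin X)) s).
  rewrite /disjD; elim: s => //= y s ->; rewrite inE.
  have [->|_] := eqVneq y e; last by case: (y \in X).
  by case: (e \in X) => //=; case: (all _ _).
rewrite /enc_set H; congr enc_bool; apply/allP/idP => [|eX y _].
  by move/(_ e); rewrite mem_enum eqxx; apply.
by rewrite eX orbT.
Qed.

Lemma dnth_enc s i : dnth (enc_seq s) i = nth Leaf s i.
Proof.
elim: s i => [|a s IH] i.
  by rewrite nth_nil /dnth (_ : iter i _ _ = Leaf) //; elim: i => //= i ->.
by case: i => //= i; rewrite -IH /dnth iterSr.
Qed.

Lemma decsetE X : decset w (enc_set X) = X.
Proof.
apply/setP=> e; rewrite inE dnth_enc.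
have es : (index e (enum E) < size (enum E))%N by rewrite index_mem mem_enum.
by rewrite (nth_map e) // nth_index ?mem_enum // isn_bool.
Qed.

Lemma indepDE X : indepD w (enc_set X) = enc_bool (X \in I).
Proof. by rewrite /indepD decsetE. Qed.

(** The vector of [botD] is a [Leaf], whereas that of an actual element is a node because the ground
    set is nonempty; [cutD] recognises [None] by this. *)
Definition encE (o : option E) : data :=
  if o is Some e then
    Node (enc_set [set e]) (Node (enc_rat (cost e)) (enc_rat (profit e)))
  else botD.

Local Notation encS := (fun e => encE (Some e)).

Lemma enc_set1 s1 e s2 : enum E = s1 ++ e :: s2 ->
  enc_set [set e] = enc_seq (nseq (size s1) Leaf ++ Node Leaf Leaf :: nseq (size s2) Leaf).
Proof.
move=> Es; have := enum_uniq E; rewrite Es cat_uniq /= negb_or.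
case/and3P=> _ /andP[e1 _] /andP[e2 _].
have H s : e \notin s -> [seq enc_bool (y \in [set e]) | y <- s] = nseq (size s) Leaf.
  elim: s => //= y s IH; rewrite inE negb_or => /andP[ey /IH ->].
  by rewrite eq_sym (negPf ey).
by rewrite /enc_set Es map_cat /= !H // in_set1 eqxx.
Qed.

Lemma elemsDE : elemsD w = enc_seq [seq encS e | e <- enum E].
Proof.
rewrite /elemsD /ctx /enc_bmi [right_of _]/=.
suff H s1 s2 : enum E = s1 ++ s2 ->
  rec (fun _ => Leaf) (fun d => Node Leaf (par d))
    (fun d => Node (Node (catD (par d)
         (Node dtrue (fmap (fun _ => dtrue) Leaf (right_of (lst d)))))
       (hd d)) (acc d))
    (enc_seq [seq Node (enc_rat (cost e)) (enc_rat (profit e)) | e <- s2])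
    (enc_seq (nseq (size s1) Leaf)) = enc_seq [seq encS e | e <- s2].
  by rewrite (H [::]).
elim: s2 s1 => // e s2 IH s1 Es /=; congr Node; last first.
  have := IH (rcons s1 e); rewrite size_rcons; apply.
  by rewrite Es cat_rcons.
by rewrite fmap_units size_map (enc_set1 Es) -catDE.
Qed.

Lemma zerosDE : zerosD w = enc_set (set0 : {set E}).
Proof.
rewrite /zerosD elemsDE fmap_units size_map /enc_set; congr enc_seq.
by elim: (enum E) => //= e s ->; rewrite inE.
Qed.

Lemma unitsDE : unitsD w = enc_seq (nseq (ell w ^ 2) Leaf).
Proof.
rewrite /unitsD ellDE; have H a : fmap (fun _ => dtrue) Leaf (enc_seq (nseq a Leaf))
    = enc_seq (nseq a Leaf) by rewrite fmap_units size_nseq.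
have -> : forall n, fmap (fun _ => fmap (fun _ => dtrue) Leaf (enc_seq (nseq (ell w) Leaf)))
   Leaf (enc_seq (nseq n Leaf)) = enc_seq (nseq (n * ell w) Leaf).
  move=> n; rewrite H; elim: n => // n IH.
  transitivity (catD (enc_seq (nseq (ell w) Leaf)) (enc_seq (nseq (n * ell w) Leaf))).
    by rewrite -IH.
  by rewrite catDE -nseqD mulSn.
by rewrite -mulnn.
Qed.

Definition cO (o : option E) : rat := if o is Some e then cost e else 0.
Definition pO (o : option E) : rat := if o is Some e then profit e else 0.

Lemma cO_ge0 o : 0 <= cO o.
Proof. by case: o => //= e; have /andP[] := cost_bounds e. Qed.

Lemma pO_ge0 o : 0 <= pO o.
Proof. by case: o => //= e; apply: profit_ge0. Qed.

Lemma dcostE o : qval (dcost (encE o)) = cO o /\ qpos (dcost (encE o)).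
Proof.
case: o => [e|] /=; last by rewrite qval_zero.
by rewrite qval_enc ?qpos_enc // (cO_ge0 (Some e)).
Qed.

Lemma dprofE o : qval (dprof (encE o)) = pO o /\ qpos (dprof (encE o)).
Proof.
case: o => [e|] /=; last by rewrite qval_zero.
by rewrite qval_enc ?qpos_enc // (pO_ge0 (Some e)).
Qed.

Definition alpha (q : data) : rat :=
  qval (dcost (left_of q)) - qval (dcost (right_of q)).
Definition gam (q : data) : rat :=
  qval (dprof (left_of q)) - qval (dprof (right_of q)).
(** For [alpha q > 0] this is [alpha q] times the Lagrangian value at the multiplier
    [gam q / alpha q], hence induces the same order. *)
Definition vq (q : data) (o : option E) : rat := alpha q * pO o - gam q * cO o.

Definition eok (e : data) : bool := qpos (dcost e) && qpos (dprof e).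
Definition qok (q : data) : bool := eok (left_of q) && eok (right_of q).

Lemma eok_enc o : eok (encE o).
Proof. by rewrite /eok (dcostE o).2 (dprofE o).2. Qed.

(** [cmpD] brings all negative terms to the other side, which leaves two sums of four nonnegative
    products. *)
Lemma cmpDE q a b : qok q ->
  cmpD q (encE a) (encE b) = enc_bool (vq q b <= vq q a).
Proof.
case/andP=> /andP[e1 e2] /andP[f1 f2].
have [ca ca'] := dcostE a; have [cb cb'] := dcostE b.
have [pa pa'] := dprofE a; have [pb pb'] := dprofE b.
rewrite /cmpD qleDE; try by rewrite !qpos_add // !qpos_mul.
rewrite !qval_add ?qpos_add ?qpos_mul // !qval_mul // ca cb pa pb.
congr enc_bool; rewrite /vq /alpha /gam; apply/idP/idP; lra.
Qed.

Lemma insDE q x s : qok q ->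
  insD q (encE x) (enc_seq (map encE s)) = enc_seq (map encE (vins (vq q) x s)).
Proof.
move=> qq; elim: s => //= a s IH.
by rewrite insD_cons cmpDE // dif_bool; case: ifP => //= _; rewrite IH.
Qed.

Lemma sortDE q s : qok q ->
  sortD q (enc_seq (map encE s)) = enc_seq (map encE (vsort (vq q) s)).
Proof.
by move=> qq; rewrite /sortD; elim: s => //= a s ->; rewrite insDE.
Qed.

Lemma cutDE s :
  cutD (enc_seq (map encE s)) = enc_seq (map encS (upto_none s)).
Proof.
rewrite /cutD; elim: s => // -[e|] s IH //=.
rewrite IH; have -> : forall x, dif (enc_set [set e]) x Leaf = x.
  move=> x; rewrite /enc_set; case Es : (enum E) => [|y s'] //=.
  by have := mem_enum E e; rewrite Es.
by [].
Qed.

Lemma greedyDE s X :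
  greedyD w (enc_seq (map encS s)) (enc_set X) = enc_set (greedy I X s).
Proof.
rewrite /greedyD; elim: s X => //= e s IH X.
rewrite vorDE indepDE dif_bool setUC -IH /gstep.
by case: ifP.
Qed.

Lemma uprof_botE o : vq (Node uprofD botD) o = - cO o.
Proof. by rewrite /vq /alpha /gam /= !qval_zero qval_one; ring. Qed.

Lemma bot_uprofE o : vq (Node botD uprofD) o = cO o.
Proof. by rewrite /vq /alpha /gam /= !qval_zero qval_one; ring. Qed.

Lemma candDE H q rp x sf : qok q ->
  candD w (enc_set H) q
    (Node (enc_seq (map encE rp)) (enc_seq (map encE (x :: sf))))
  = enc_set (cand I H cO (vq q) rp x sf).
Proof.
move=> qq; rewrite /candD /= -[Node (encE x) _]/(enc_seq (map encE (x :: rp))).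
rewrite !sortDE // catDE -map_cat sortDE // cutDE greedyDE.
rewrite [vsort (vq (Node botD _)) _](eq_vsort (v' := cO)); last by move=> a b; rewrite !bot_uprofE.
rewrite [vsort (vq (Node uprofD _)) _](eq_vsort (v' := fun a => - cO a)); last first.
  by move=> a b; rewrite !uprof_botE.
case: x => [e|] /=; last first.
  rewrite vdiffD0 /cand; congr enc_set; apply/setP=> y.
  by rewrite !inE andTb.
rewrite vdiffDE /cand; congr enc_set; congr (_ :\: _).
by apply/setP=> y; rewrite !inE (inj_eq (@Some_inj _)).
Qed.

Lemma sum_setD (f : data -> data) (g : E -> rat) X :
  (forall e, qval (f (encS e)) = g e /\ qpos (f (encS e))) ->
  let l := fmap (fun d => dif (disjD (dvec (right_of d)) (left_of d)) Leaf
     (Node (f (right_of d)) Leaf)) (enc_set X) (elemsD w) in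
  qval (sumD l) = \sum_(e in X) g e /\ qpos (sumD l).
Proof.
move=> hf l.
have -> : l = enc_seq [seq f (encS e) | e <- enum E & e \in X].
  rewrite /l elemsDE.
  rewrite (@fmapE _ _ _ _ _ (fun e => if e \in X then [:: f (encS e)] else [::])).
    by congr enc_seq; elim: (enum E) => //= e s ->; case: (e \in X).
  move=> e _; rewrite [left_of _]/= [dvec _]/= disjDE dif_bool if_neg.
  by case: ifP.
have qs : all qpos [seq f (encS e) | e <- enum E & e \in X].
  by rewrite all_map; apply/allP => e _ /=; have [] := hf e.
have [-> ->] := sumDE qs.
split=> //; rewrite big_map big_filter big_enum_cond /=.
by apply: eq_bigr => e _; have [] := hf e.
Qed.

Lemma costDE X : qval (costD w (enc_set X)) = set_cost X /\ qpos (costD w (enc_set X)).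
Proof.
by apply: (sum_setD (f := fun d => dcost d)) => e; have [-> ->] := dcostE (Some e).
Qed.

Lemma profDE X : qval (profD w (enc_set X)) = set_profit X /\ qpos (profD w (enc_set X)).
Proof.
by apply: (sum_setD (f := fun d => dprof d)) => e; have [-> ->] := dprofE (Some e).
Qed.

End Specs.

(** * Membership in encoded lists *)

Fixpoint dIn (x l : data) : Prop :=
  if l is Node a l' then x = a \/ dIn x l' else False.

Lemma dIn_cat x l1 l2 : dIn x (catD l1 l2) <-> dIn x l1 \/ dIn x l2.
Proof.
rewrite /catD; elim: l1 => [|a _ l1 IH] /=; first by split=> [|[]//]; right.
by rewrite IH; tauto.
Qed.

Lemma dIn_fmap y f p l :
  dIn y (fmap f p l) <-> exists2 a, dIn a l & dIn y (f (Node p a)).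
Proof.
rewrite /fmap; elim: l => [|a _ l IH] /=; first by split=> // -[].
rewrite dIn_cat IH; split.
  by move=> [ya|[b bl yb]]; [exists a; [left|] | exists b; [right|]].
by move=> [b [->|bl] yb]; [left | right; exists b].
Qed.

Lemma dIn_enc (T : eqType) (h : T -> data) y (s : seq T) :
  dIn y (enc_seq (map h s)) <-> exists2 x, x \in s & y = h x.
Proof.
elim: s => [|x s IH] /=; first by split=> // -[].
rewrite IH; split.
  move=> [->|[z zs ->]]; first by exists x; rewrite ?mem_head.
  by exists z => //; rewrite inE zs orbT.
move=> [z]; rewrite inE => /predU1P[-> -> | zs ->]; first by left.
by right; exists z.
Qed.

(** Meaningful for zero denominators too: the time for guessing must be bounded for every [V], so
    the description of [reprD] cannot presuppose valid fractions. *)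
Definition qleb (x y : data) : bool :=
  (nval (left_of x) * nval (right_of y) <= nval (left_of y) * nval (right_of x))%N.

Lemma qleDb x y : qleD x y = enc_bool (qleb x y).
Proof. by rewrite /qleD leDE !nval_mul. Qed.

Lemma qlebE x y : qpos x -> qpos y -> qleb x y = (qval x <= qval y).
Proof. by move=> px py; apply: enc_bool_inj; rewrite -qleDb qleDE. Qed.

(** * Enumeration of the profitable elements *)

Section Guesses.
Variable (E : finType).
Implicit Types (r : seq E) (X : {set E}).

Fixpoint guesses r n : seq {set E} :=
  if n is n'.+1 then
    guesses r n' ++ flatten [seq [seq e |: X | X <- guesses r n'] | e <- r]
  else [:: set0].

Lemma size_guesses r n : size (guesses r n) = ((size r).+1 ^ n)%N.
Proof.
elim: n => //= n IH; rewrite size_cat size_flatten expnS mulSn -IH; congr addn.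
set a := guesses r n; elim: r {IH} a => //= e r IH a.
by rewrite size_map IH mulSn.
Qed.

Lemma mem_guesses r n X :
  {subset X <= r} -> (#|X| <= n)%N -> X \in guesses r n.
Proof.
elim: n X => [|n IH] X Xr Xn.
  by rewrite inE -cards_eq0 -leqn0.
have [->|[e eX]] := set_0Vmem X.
  by rewrite mem_cat IH // ?cards0 // => y; rewrite inE.
rewrite mem_cat; apply/orP; right; apply/flatten_mapP; exists e; first exact: Xr.
apply/mapP; exists (X :\ e); last by rewrite setD1K.
apply: IH; first by move=> y; rewrite inE => /andP[_ /Xr].
by move: Xn; rewrite (cardsD1 e) eX.
Qed.

End Guesses.

Section Algorithm.
Variables (R : realType) (w : world R).
Local Notation E := (ground (wK w)).
Local Notation I := (indep (wK w)).
Local Notation encS := (fun e : E => encE (Some e)).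
Implicit Types X Y H : {set E}.

Definition gbasis (P : pred E) : seq E :=
  let s := vsort (fun e => - cost e) [seq e <- enum E | P e] in
  take (ell w ^ 2) [seq e <- s | e \in greedy I set0 s].

Lemma basisDE th : basisD w th
  = enc_seq (map encS (gbasis (fun e => qleb th (enc_rat (profit e))))).
Proof.
rewrite /basisD elemsDE.
rewrite (@fmap_filter _ _ _ _ _ (fun e : E => qleb th (enc_rat (profit e))));
  last by move=> e _; rewrite /= qleDb dif_bool.
have sE (s : seq E) : sortD (Node uprofD botD) (enc_seq (map encS s)) =
    enc_seq (map encS (vsort (fun e => - cost e) s)).
  rewrite (map_comp (@encE R w) Some) sortDE //.
  rewrite (eq_vsort (v' := fun o => - cO o)); last by move=> a b; rewrite !uprof_botE.
  by rewrite vsort_map -map_comp.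
rewrite sE zerosDE greedyDE unitsDE.
set s := vsort _ _; rewrite (@fmap_filter _ _ _ _ _ (mem (greedy I set0 s))).
  by rewrite firstDE map_take.
by move=> e _; rewrite [left_of _]/= [dvec _]/= disjDE dif_bool if_neg.
Qed.

Definition thD (V : data) (i : nat) : data :=
  Node (mulD (numD (enc_seq (drop i (nseq (ell w ^ 2) Leaf)))) (left_of V))
    (mulD (numD (unitsD w)) (right_of V)).

Definition reps (V : data) : seq E :=
  flatten [seq gbasis (fun e => qleb (thD V i) (enc_rat (profit e)))
            | i <- iota 0 (ell w ^ 2)].

Lemma reprDE V : reprD w V = enc_seq (map encS (reps V)).
Proof.
rewrite /reprD unitsDE splitsDE size_nseq map_flatten -map_comp.
apply: fmapE => i _; rewrite basisDE /thD unitsDE.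
by rewrite [right_of _]/= [left_of _]/=.
Qed.

Lemma size_reps V : (size (reps V) <= (ell w ^ 2) * (ell w ^ 2))%N.
Proof.
rewrite /reps size_flatten -{2}(size_iota 0 (ell w ^ 2)).
elim: (iota _ _) => //= i s IH; rewrite mulSn leq_add //.
by rewrite size_take; case: ltnP.
Qed.

Lemma guessDE (r : seq E) n :
  rec (fun _ => Node (zerosD w) Leaf) (fun d => par d)
    (fun d => catD (acc d)
       (fmap (fun d1 => fmap (fun d2 =>
             Node (vorD (dvec (left_of d2)) (right_of d2)) Leaf)
           (right_of d1) (left_of d1)) (acc d) (par d)))
    (enc_seq (nseq n Leaf)) (enc_seq (map encS r))
  = enc_seq [seq enc_set X | X <- guesses r n].
Proof.
elim: n => [|n IH]; first by rewrite /= zerosDE.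
rewrite [rec _ _ _ _ _]/= IH.
rewrite (@fmapE _ _ _ _ _ (fun e => [seq enc_set (e |: X) | X <- guesses r n])).
  rewrite catDE /= map_cat; congr (enc_seq (_ ++ _)).
  rewrite map_flatten -map_comp; congr flatten; apply: eq_map => e /=.
  by rewrite -map_comp.
move=> e _; rewrite [right_of _]/= [left_of _]/=.
rewrite (@fmapE _ _ _ _ _ (fun X => [:: enc_set (e |: X)])).
  by congr enc_seq; elim: (guesses r n) => //= X s ->.
by move=> X _; rewrite /= vorDE.
Qed.

Lemma dsz_enc_set X : (dsz (enc_set X) <= 4 * #|E| + 1)%N.
Proof.
rewrite /enc_set cardE; elim: (enum E) => //= e s IH.
by case: (e \in X) => /=; lia.
Qed.

Lemma card_res : (#|E| <= res w)%N.
Proof.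
rewrite /res; apply: leq_trans (leq_addr _ _); rewrite /bmi_size /enc_bmi cardE.
apply: (@leq_trans (dsz (enc_seq [seq Node (enc_rat (cost e)) (enc_rat (profit e))
      | e <- enum E]))); last exact: leq_trans (leq_addl _ _) (leqnSn _).
by elim: (enum E) => //= e s IH; lia.
Qed.

(** [ell ^ 2] thresholds with at most [ell ^ 2] elements each give [ell ^ 4] representatives, and
    [ell ^ 4 + 1 <= 2 ^ (4 * ell)]. This is the origin of the exponent in [res]. *)
Lemma guesses_res V n : (n <= ell w)%N ->
  (size (guesses (reps V) n) <= res w)%N.
Proof.
move=> nl; rewrite size_guesses; apply: leq_trans (leq_addl _ _).
have h1 : ((size (reps V)).+1 <= 2 ^ (4 * ell w))%N.
  apply: leq_trans (_ : _ <= (ell w ^ 4).+1)%N _.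
    by rewrite ltnS; apply: leq_trans (size_reps V) _; rewrite -expnD.
  by rewrite mulnC expnM ltn_exp2r // ltn_expl.
apply: leq_trans (_ : _ <= (2 ^ (4 * ell w)) ^ n)%N _; first exact: leq_exp.
by rewrite -expnM leq_exp2l // -mulnn mulnA leq_mul2l nl orbT.
Qed.

Lemma dsz_guesses (s : seq {set E}) : (size s <= res w)%N ->
  (dsz (enc_seq [seq enc_set X | X <- s]) <= res w * (4 * res w + 2) + 1)%N.
Proof.
move=> sr; apply: (@leq_trans (size s * (4 * res w + 2) + 1)); last first.
  by rewrite leq_add2r leq_mul2r sr orbT.
elim: s {sr} => //= X s IH; have := dsz_enc_set X; have := card_res; lia.
Qed.

End Algorithm.

(** Each round multiplies the number of sets, so growth per step gives no useful bound. The
    intermediate lists are identified with [guesses] and counted, which uses the bound on the number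
    of representatives. *)
Lemma pt_guess (R : realType) : pt (fun (w : world R) d => guessD w (reprD w d)).
Proof.
have pr := pt_repr (@pt_id R); have [c [n0 [mk [_ z _]]]] := pr.
have pE := @pt_ell R; have pz := @pt_zeros R.
apply: (pt_rec (f := fun x => bd c x + (x * (4 * x + 2) + 1))%N) => //.
- by apply: pt_node => //; apply: pt_leaf.
- by apply: pt_left; apply: pt_id.
- apply: pt_cat; first by do 2! apply: pt_right; apply: pt_id.
  apply: pt_fmap.
  + apply: pt_fmap.
    * apply: pt_node; last exact: pt_leaf.
      by apply: pt_vor; [do 2! apply: pt_left; apply: pt_id | apply: pt_right; apply: pt_id].
    * by apply: pt_right; apply: pt_id.
    * by apply: pt_left; apply: pt_id.
  + by do 2! apply: pt_right; apply: pt_id.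
  + by apply: pt_left; apply: pt_id.
- by do ?[apply: poly_add | apply: poly_mul | exact: poly_id | exact: poly_const
         | exact: poly_bd].
move=> w d; set x := (res w + dsz d)%N; have rx : (res w <= x)%N by apply: leq_addr.
have pN : (dsz (reprD w d) <= bd c x)%N by apply: z.
rewrite ellDE reprDE in pN *.
have [n nE] : exists n, n = ell w by exists (ell w).
rewrite -[in nseq _ _]nE; have: (n <= ell w)%N by rewrite nE.
elim: n {nE} => [|n IH] nl.
  split=> //; last first.
    rewrite (guessDE _ 0); apply: leq_trans (leq_addl _ _).
    apply: leq_trans (dsz_guesses _) _; first exact: guesses_res.
    by rewrite leq_add2r leq_mul // leq_add2r leq_mul2l rx.
  by apply: leq_trans pN (leq_addr _ _).
split; first by apply: leq_trans pN (leq_addr _ _).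
  rewrite (guessDE _ n.+1); apply: leq_trans (leq_addl _ _).
  have h := @dsz_guesses _ w _ (guesses_res d nl); apply: leq_trans h _.
  by rewrite leq_add2r leq_mul // leq_add2r leq_mul2l rx.
exact: IH (ltnW nl).
Qed.

(** * Existence of a good candidate *)

Section Correctness.
Variables (R : realType) (w : world R).
Local Notation E := (ground (wK w)).
Local Notation I := (indep (wK w)).
Local Notation encS := (fun e : E => encE (Some e)).
Implicit Types X Y H Z S : {set E}.

Definition lightP (V : data) (e : E) : bool :=
  qleb (enc_rat (profit e)) (Node (left_of V) (mulD (numD (ellD w)) (right_of V))).

Definition lights V H : seq (option E) :=
  None :: [seq Some e | e <- enum E & lightP V e && (e \notin H)].

Lemma lightDE V H : Node botD (lightD w V (enc_set H))
  = enc_seq (map (@encE R w) (lights V H)).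
Proof.
rewrite /lightD elemsDE.
rewrite (@fmap_filter _ _ _ _ _ (fun e => lightP V e && (e \notin H))).
  by rewrite /= -map_comp.
move=> e _; rewrite [right_of _]/= ![left_of _]/= [dvec _]/= disjDE qleDb !dif_bool.
by rewrite -[qleb _ _]/(lightP V e); case: (lightP V e).
Qed.

Lemma dIn_candsVH z V H : dIn z (candsVHD w V (enc_set H)) <->
  exists2 q, dIn q (dirsD w) & exists2 i, (i < size (lights V H))%N
    & z = candD w (enc_set H) q
       (Node (enc_seq (map (@encE R w) (rev (take i (lights V H)))))
             (enc_seq (map (@encE R w) (drop i (lights V H))))).
Proof.
rewrite /candsVHD lightDE dIn_fmap.
have sE : splitsD (enc_seq (map (@encE R w) (lights V H))) = enc_seq
   [seq Node (enc_seq (map (@encE R w) (rev (take i (lights V H)))))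
             (enc_seq (map (@encE R w) (drop i (lights V H))))
    | i <- iota 0 (size (lights V H))].
  rewrite splitsDE size_map; congr enc_seq; apply: eq_map => i.
  by rewrite map_rev map_take map_drop.
split=> [[q qin]|[q qin [i il ->]]].
  rewrite [right_of (left_of _)]/= sE dIn_fmap => -[s].
  rewrite dIn_enc => -[i]; rewrite mem_iota /= add0n => il ->.
  by rewrite /= => -[->|//]; exists q => //; exists i.
exists q => //; rewrite [right_of (left_of _)]/= sE dIn_fmap.
eexists; first by rewrite dIn_enc; exists i; [rewrite mem_iota | reflexivity].
by left.
Qed.

Lemma qok_dirs q : dIn q (dirsD w) -> qok q.
Proof.
have okl a : dIn a (Node botD (Node ucostD (elemsD w))) -> eok a.
  rewrite elemsDE /= => -[->|[->|]] //.
  by rewrite dIn_enc => -[e _ ->]; exact: (eok_enc (Some e)).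
rewrite /dirsD dIn_fmap => -[a ain]; rewrite dIn_fmap => -[b bin].
by rewrite /= => -[->|//]; rewrite /qok /= !okl.
Qed.

Lemma cand_enc z V H : dIn z (candsVHD w V (enc_set H)) -> exists Z, z = enc_set Z.
Proof.
rewrite dIn_candsVH => -[q /qok_dirs qq [i il ->]].
by rewrite (drop_nth None il) candDE //; eexists.
Qed.

Lemma dIn_cands z : dIn z (candsD w) <->
  exists2 V, dIn V (valuesD w) & exists2 H, H \in guesses (reps w V) (ell w)
    & dIn z (candsVHD w V (enc_set H)).
Proof.
have gE V : guessD w (reprD w V) = enc_seq [seq enc_set X | X <- guesses (reps w V) (ell w)].
  by rewrite /guessD reprDE ellDE guessDE.
rewrite /candsD dIn_fmap; split=> [[V Vin]|[V Vin [H Hin zin]]].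
  rewrite dIn_fmap [right_of (Node _ _)]/= gE => -[h].
  rewrite dIn_enc => -[H Hin ->].
  cbv beta iota delta [left_of right_of] => zin.
  by exists V; [exact: Vin | exists H; [exact: Hin | exact: zin]].
exists V; first exact: Vin.
rewrite dIn_fmap [right_of (Node _ _)]/= gE; exists (enc_set H).
  by rewrite dIn_enc; exists H.
cbv beta iota delta [left_of right_of]; exact: zin.
Qed.

Lemma solution0 : solution (set0 : {set E}).
Proof.
rewrite /solution /set_cost big_set0 (ltW (budget_gt0 _)) andbT.
by have [] := indep_matroid (wK w).
Qed.

Lemma best_spec l : (forall z, dIn z l -> exists Z, z = enc_set Z) ->
  exists X, [/\ bestD w l = enc_set X, solution X
    & forall Z, dIn (enc_set Z) l -> solution Z -> set_profit Z <= set_profit X].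
Proof.
elim: l => [|z _ l IH] hl.
  by exists set0; rewrite /bestD /= zerosDE; split=> //; apply: solution0.
have [X [eX sX mX]] := IH (fun y yl => hl y (or_intror yl)).
have [Z zE] := hl z (or_introl erefl); subst z.
have -> : bestD w (Node (enc_set Z) l) =
    if solution Z && (set_profit X <= set_profit Z) then enc_set Z else enc_set X.
  transitivity (dif (indepD w (enc_set Z))
     (dif (qleD (costD w (enc_set Z)) (left_of (ctx w)))
       (dif (qleD (profD w (bestD w l)) (profD w (enc_set Z))) (enc_set Z) (bestD w l))
         (bestD w l)) (bestD w l)) => //.
  have [cE cP] := costDE Z; have [pE pP] := profDE Z; have [pX pXP] := profDE X.
  rewrite eX indepDE !qleDE ?qpos_enc // cE pE pX [left_of _]/= qval_enc; last first.
    exact: ltW (budget_gt0 _).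
  rewrite !dif_bool /solution; case: (Z \in I) => //=.
  by case: (_ <= budget _).
case: ifP => [/andP[sZ XZ]|XZ].
  exists Z; split=> // Y /= [/enc_set_inj -> //|Yl] sY.
  exact: le_trans (mX Y Yl sY) XZ.
exists X; split=> // Y /= [/enc_set_inj ->|Yl] sY; last exact: mX.
by move: XZ; rewrite sY /= => /negbT; rewrite -ltNge => /ltW.
Qed.

Lemma main_spec : exists X, [/\ mainD w = enc_set X, solution X
  & forall Z, dIn (enc_set Z) (candsD w) -> solution Z ->
      set_profit Z <= set_profit X].
Proof.
apply: best_spec => z; rewrite dIn_cands => -[V _ [H _]]; exact: cand_enc.
Qed.

(** A device of the proof: the program handles only directions. Pairs with [None] give the
    multipliers at which the value of an element vanishes. *)
Definition multipliers : seq rat := 0 ::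
  [seq (pO ab.1 - pO ab.2) / (cO ab.1 - cO ab.2) |
     ab <- enum {: option E * option E}
     & (cO ab.2 < cO ab.1) && (pO ab.2 <= pO ab.1)].

Lemma multipliers_ge0 : {in multipliers, forall x, 0 <= x}.
Proof.
move=> x; rewrite inE => /predU1P[-> //|/mapP[[a b]]].
rewrite mem_filter /= => /andP[/andP[ca pa] _] ->.
by rewrite divr_ge0 // subr_ge0 // ltW.
Qed.

Lemma dir_of_multiplier x : x \in multipliers ->
  exists2 q, dIn q (dirsD w) &
    exists2 a, 0 < a & forall o : option E, vq q o = a * lval (@cO R w) (@pO R w) x o.
Proof.
have inl (o : option E) : dIn (encE o) (Node botD (Node ucostD (elemsD w))).
  case: o => [e|]; last by left.
  by right; right; rewrite elemsDE dIn_enc; exists e; rewrite ?mem_enum.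
have inq a b : dIn a (Node botD (Node ucostD (elemsD w))) ->
    dIn b (Node botD (Node ucostD (elemsD w))) -> dIn (Node a b) (dirsD w).
  by move=> al bl; rewrite dIn_fmap; exists a => //; rewrite dIn_fmap; exists b => //; left.
rewrite inE => /predU1P[->|/mapP[[a b]]].
  exists (Node ucostD botD); first by apply: inq; [right; left | left].
  exists 1 => // o; rewrite /vq /alpha /gam /= !qval_zero qval_one /lval; ring.
rewrite mem_filter /= => /andP[/andP[cab pab] _] ->.
exists (Node (encE a) (encE b)); first exact: inq.
exists (cO a - cO b); rewrite ?subr_gt0 // => o.
rewrite /vq /alpha /gam [left_of _]/= [right_of (Node _ _)]/=.
rewrite !(dcostE _).1 !(dprofE _).1 /lval mulrBr mulrA.
by rewrite [X in _ = _ - X * _]mulrC divfK // subr_eq0 gt_eqF.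
Qed.

Lemma dIn_values g i : (0 < i <= #|E|)%N -> exists V,
  [/\ dIn V (valuesD w), qval V = i%:R * profit (g : E) & qpos V].
Proof.
move=> /andP[i0 iE].
pose s := drop (#|E| - i) [seq encS e | e <- enum E].
have ss : size s = i by rewrite size_drop size_map -cardE subKn.
exists (Node (mulD (numD (enc_seq s)) (left_of (enc_rat (profit g))))
   (right_of (enc_rat (profit g)))); split.
- rewrite /valuesD dIn_fmap elemsDE; exists (encS g).
    by rewrite dIn_enc; exists g; rewrite ?mem_enum.
  rewrite dIn_fmap splitsDE; eexists.
    by rewrite dIn_enc; exists (#|E| - i)%N; [|reflexivity];
       rewrite mem_iota size_map -cardE ltn_subrL i0 (leq_trans i0 iE).
  by left.
- rewrite /qval [left_of (Node _ _)]/= [right_of (Node _ _)]/= nval_mul natrM.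
  rewrite nval_num ss -mulrA; congr (_ * _).
  by rewrite -[RHS](qval_enc (profit_ge0 g)).
- exact: qpos_enc.
Qed.

(** Let [g] be the most profitable element of [S] and [i] least such that [i] times its profit
    reaches the profit of [S]. Then [i - 1] times falls short, and one more profit of [g] is at most
    the profit of [S]. *)
Lemma best_guess S : solution S ->
  (forall Y, solution Y -> set_profit Y <= set_profit S) -> 0 < set_profit S ->
  exists V, [/\ dIn V (valuesD w), qpos V & set_profit S <= qval V <= 2 * set_profit S].
Proof.
move=> sS mS pS.
have [e0 e0S] : exists e, e \in S.
  apply/set0Pn; apply: contraTneq pS => ->.
  by rewrite /set_profit big_set0 ltxx.
pose g := [arg max_(e > e0 in S) profit e]%O.
have [gS gmax] : g \in S /\ forall e, e \in S -> profit e <= profit g.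
  by rewrite /g; case: arg_maxP => // e eS he; split.
have le_n : set_profit S <= #|S|%:R * profit g.
  by rewrite mulr_natl -sumr_const; apply: ler_sum.
have ex : exists i, set_profit S <= i%:R * profit g by exists #|S|.
case: (ex_minnP ex) => i iS imin.
have i0 : (0 < i)%N.
  by case: i iS {imin} => //; rewrite mul0r leNgt pS.
have iE : (i <= #|E|)%N.
  by apply: leq_trans (imin _ le_n) _; apply: max_card.
have [|V [Vin VE Vp]] := @dIn_values g i; first by rewrite i0.
exists V; split=> //; rewrite VE iS /=.
have lt : i.-1%:R * profit g < set_profit S.
  rewrite ltNge; apply/negP => /imin; lia.
have gle : profit g <= set_profit S.
  by rewrite /set_profit (big_setD1 g) //= lerDl sumr_ge0 // => e _; apply: profit_ge0.
by rewrite -(prednK i0) -natr1 mulrDl mul1r; lra.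
Qed.

Lemma ell_gt1 : (1 < ell w)%N.
Proof.
have /andP[e0 e1] := weps_bounds w.
have : (6 <= weps w * (ell w)%:R) by rewrite /ell /logell; case: ex_minnP.
rewrite ltnNge => h; apply/negP => el.
have : ((ell w)%:R : R) <= 1 by rewrite -(ler_nat R) in el.
have : (0 : R) <= (ell w)%:R by []. 
by move: h e0 e1; nra.
Qed.

Lemma thDE V i : qpos V -> (i < ell w ^ 2)%N ->
  qval (thD w V i) = (ell w ^ 2 - i)%:R * qval V / (ell w ^ 2)%:R /\ qpos (thD w V i).
Proof.
move=> Vp iU; rewrite /qval /qpos /thD [left_of (Node _ _)]/= [right_of (Node _ _)]/=.
rewrite unitsDE !nval_mul !nval_num size_drop !size_nseq muln_gt0 (Vp : (0 < _)%N) andbT; split.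
  by rewrite !natrM invfM !mulrA mulrAC.
by lia.
Qed.

Lemma gbasisE (P : pred E) th : (forall e, P e = (th <= profit e)) ->
  gbasis P = basis I (@cost _) (@profit _) (ell w) th.
Proof. by move=> PE; rewrite /gbasis /basis (eq_filter PE). Qed.

(** The relaxation is compared with the substituted solution, whose heavy part is one of the
    guesses. Every element of [M] has profit at most [V / ell], so the total loss is [3V / ell] with
    [V] at most twice the profit of [S]. *)
Lemma good_candidate S : solution S ->
  (forall Y, solution Y -> set_profit Y <= set_profit S) -> 0 < set_profit S ->
  exists Z, [/\ dIn (enc_set Z) (candsD w), solution Z
    & set_profit S - 6 * set_profit S / (ell w)%:R <= set_profit Z].
Proof.
move=> sS mS pS; have [V [Vin Vp /andP[SV VS]]] := best_guess sS mS pS.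
have hI := indep_matroid (wK w).
have c0 (e : E) : 0 <= cost e by have /andP[] := cost_bounds e.
have p0 (e : E) : 0 <= profit e by apply: profit_ge0.
have V0 : 0 < qval V by apply: lt_le_trans SV.
have Vmax X : feas I (@cost _) (budget (wK w)) X -> \sum_(e in X) profit e <= qval V.
  by move=> fX; apply: le_trans SV; apply: mS.
have l0 : (0 < ell w)%N by apply: ltnW ell_gt1.
have L0 : (0 : rat) < (ell w)%:R by rewrite ltr0n.
have [S' [fS' hS' pS']] := substitution hI c0 p0 V0 ell_gt1 Vmax sS.
set H := heavy (@profit _) (qval V) (ell w) S' in hS'.
have HS : H \subset S' by apply/subsetP => e; rewrite inE => /andP[].
have lightE e : lightP V e = (profit e <= qval V / (ell w)%:R).
  have nE : nval (numD (ellD w)) = ell w by rewrite ellDE nval_num size_nseq.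
  rewrite /lightP qlebE ?qpos_enc // ?qval_enc //; last first.
    by rewrite /qpos /= nval_mul nE muln_gt0 (Vp : (0 < _)%N) andbT.
  rewrite /qval /= nval_mul nE natrM invfM mulrA mulrAC.
  by congr (_ <= _); rewrite mulrAC.
have Hg : H \in guesses (reps w V) (ell w).
  apply: mem_guesses; last exact: (card_heavy p0 V0 ell_gt1 Vmax fS').
  move=> e /hS' /hasP[j]; rewrite mem_iota add1n ltnS => /andP[j1 jU] ej.
  (* Split number [i] leaves a suffix of length [ell w ^ 2 - i], so threshold [j] sits at the
     complementary index. *)
  have iU : (ell w ^ 2 - j < ell w ^ 2)%N by rewrite ltn_subrL j1 (leq_trans j1 jU).
  apply/flatten_mapP; exists (ell w ^ 2 - j)%N; first by rewrite mem_iota.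
  have [thE thp] := thDE Vp iU.
  rewrite (@gbasisE _ (j%:R * qval V / (ell w ^ 2)%:R)) // => e'.
  by rewrite qlebE ?qpos_enc // thE qval_enc // subKn.
have sS' : solution S' by [].
have /andP[SI' cS'] := fS'.
have HI : H \in I by apply: (indepS hI) SI'.
set M := lights V H.
have MP o : o \in M -> pO o <= qval V / (ell w)%:R.
  rewrite inE => /predU1P[->|/mapP[e]]; first by rewrite /= divr_ge0 // ltW.
  by rewrite mem_filter lightE => /andP[/andP[le _] _] ->.
have uM : uniq M.
  rewrite cons_uniq map_inj_uniq; last by move=> a b [].
  by rewrite filter_uniq ?enum_uniq // andbT; apply/mapP => -[].
have TM e : e \in S' -> e \notin H -> Some e \in M.
  move=> eS eH; rewrite inE /=; apply/mapP; exists e => //.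
  rewrite mem_filter mem_enum eH lightE !andbT.
  by move: eH; rewrite inE eS /= -leNgt.
have cross : {in M &, forall a b, cO b < cO a -> pO b <= pO a ->
    (pO a - pO b) / (cO a - cO b) \in multipliers}.
  move=> a b _ _ cab pab; rewrite inE; apply/orP; right; apply/mapP.
  by exists (a, b); rewrite // mem_filter /= cab pab mem_enum.
have [] := lagrangian_candidate hI HI (erefl : @cO R w None = 0) (erefl : @pO R w None = 0)
  (@cO_ge0 R w) (@pO_ge0 R w) uM (mem_head _ _) HS SI' TM cS'
  (mem_head _ _) multipliers_ge0 cross.
move=> x [i [xL iM ZI cZ pZ]].
set Z := cand _ _ _ _ _ _ _ in ZI cZ pZ.
have [q qin [a a0 qE]] := dir_of_multiplier xL.
exists Z; split.
- rewrite dIn_cands; exists V; first exact: Vin.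
  exists H; first exact: Hg.
  rewrite dIn_candsVH; exists q; first exact: qin.
  exists i; first exact: iM.
  rewrite (drop_nth None iM) candDE; last exact: qok_dirs.
  rewrite /Z /cand /state.
  rewrite (eq_vsort (v' := lval (@cO R w) (@pO R w) x)) // => b1 b2.
  by rewrite !qE ler_pM2l.
- by rewrite /solution ZI.
have pn : pO (nth None M i) <= qval V / (ell w)%:R by apply: MP; apply: mem_nth.
have pZ' : set_profit S' - pO (nth None M i) <= set_profit Z := pZ.
have pS2 : set_profit S - 2 * qval V / (ell w)%:R <= set_profit S' := pS'.
have VL : qval V / (ell w)%:R <= 2 * set_profit S / (ell w)%:R.
  by rewrite ler_pM2r ?invr_gt0.
by lra.
Qed.

End Correctness.

(** * Approximation ratio and running time *)

Lemma optimal_solution (K : bmi) : exists S : {set ground K}, [/\ solution S,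
  forall Y : {set ground K}, solution Y -> set_profit Y <= set_profit S & OPT K <= set_profit S].
Proof.
have s0 : solution (set0 : {set ground K}).
  rewrite /solution /set_cost big_set0 (ltW (budget_gt0 _)) andbT.
  by have [] := indep_matroid K.
pose S := [arg max_(X > (set0 : {set ground K}) | solution X) set_profit X]%O.
have [sS mS] : solution S /\ forall Y : {set ground K}, solution Y -> set_profit Y <= set_profit S.
  by rewrite /S; case: arg_maxP.
exists S; split=> //; rewrite /OPT; apply: bigmax_le => //.
by rewrite sumr_ge0 // => e _; apply: profit_ge0.
Qed.

(** By minimality half of [ell] fails the test against 6; the exponent 0 is settled by the bounds on
    [eps]. *)
Lemma ell_le (R : realType) (w : world R) : (ell w)%:R <= 12 / weps w.
Proof.
have /andP[e0 e1] := weps_bounds w.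
rewrite ler_pdivlMr // mulrC /ell.
have : (6 <= weps w * (2 ^ logell w)%:R) by rewrite /logell; case: ex_minnP.
rewrite /logell; case: ex_minnP => -[|t] ht hmin h6.
  by rewrite expn0 mulr1 in ht *; lra.
have : weps w * (2 ^ t)%:R < 6.
  by rewrite ltNge; apply/negP => /hmin; rewrite ltnn.
by rewrite expnS natrM; lra.
Qed.

Lemma linear_poly (k : nat) :
  exists P : {poly nat}, forall s, P.[s] = ((k.+2 * s) ^ k)%N.
Proof.
exists ((k.+2 ^ k)%N *: 'X^k) => s.
by rewrite hornerZ hornerXn expnMn.
Qed.

(** [576 = 4 * 12 ^ 2] combines the exponent [4 * ell ^ 2] in [res] with [ell <= 12 / eps]. As
    [eps < 1/2], the factor [ln (1 / eps) / ln 2] is at least 1 and may be multiplied in. The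
    polynomial part uses [s + G + k <= G * ((k + 2) * s)] for positive [s] and [G]. *)
Lemma time_bound (R : realType) (k : nat) : exists C : R, forall (w : world R) t,
  (t <= (res w + k) ^ k)%N ->
  t%:R <= 2 `^ (C * (weps w ^- 2 * ln (weps w)^-1))
          * (((k.+2 * bmi_size (wK w)) ^ k)%N)%:R :> R.
Proof.
exists (576 * k%:R / ln 2) => w t ht.
have /andP[e0 e1] := weps_bounds w.
set s := bmi_size _; set G := (2 ^ (4 * ell w ^ 2))%N.
have s0 : (0 < s)%N by apply: dsz_gt0.
have G0 : (0 < G)%N by rewrite expn_gt0.
have {}ht : (t <= G ^ k * (k.+2 * s) ^ k)%N.
  apply: leq_trans ht _; rewrite -expnMn; apply: leq_exp; rewrite /res -/s -/G; nia.
apply: le_trans (_ : (G ^ k * (k.+2 * s) ^ k)%:R <= _); first by rewrite ler_nat.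
rewrite natrM ler_wpM2r // natrX /G natrX -exprM -[2 ^+ _]powR_mulrn //.
have ln2 : 0 < ln 2 :> R by rewrite ln_gt0 // ltr1n.
apply: ler_powR; first by rewrite ler1n.
have le2 : 1 <= ln (weps w)^-1 / ln 2.
  rewrite ler_pdivlMr // mul1r ler_ln ?posrE ?invr_gt0 //.
  by rewrite -[2]invrK lef_pV2 ?posrE ?invr_gt0 // ltW.
have le1 : (4 * ell w ^ 2 * k)%:R <= 576 * k%:R * weps w ^- 2 :> R.
  rewrite natrM [(4 * _)%:R]natrM (natrX _ (ell w) 2).
  have := ell_le w; set l : R := (ell w)%:R => hl.
  have l0 : 0 <= l by [].
  have : l ^+ 2 <= 144 * weps w ^- 2.
    apply: le_trans (_ : (12 / weps w) ^+ 2 <= _).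
      by rewrite lerXn2r ?nnegrE // divr_ge0 // ltW.
    by rewrite exprMn exprVn (_ : 12 ^+ 2 = 144) // -natrX.
  have : (0 : R) <= k%:R by [].
  move: (weps w ^- 2) (k%:R : R) (l ^+ 2) => a b d b0 da.
  have := ler_wpM2r b0 da; lra.
apply: le_trans le1 _.
have -> : 576 * k%:R / ln 2 * (weps w ^- 2 * ln (weps w)^-1) =
   (576 * k%:R * weps w ^- 2) * (ln (weps w)^-1 / ln 2) by field; rewrite (gt_eqF ln2) (gt_eqF e0).
apply: ler_peMr => //; apply: mulr_ge0; first exact: mulr_ge0.
by rewrite invr_ge0 exprn_ge0 // ltW.
Qed.

Theorem theorem1p1 (R : realType) :
  exists (A : program) (C : R) (P : {poly nat}),
    forall (K : bmi) (eps : R), 0 < eps < 2^-1 ->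
      exists (X : {set ground K}) (t : nat),
        [/\ outputs A eps X t,
            solution X,
            (1 - eps) * ratr (OPT K) <= ratr (set_profit X)
          & t%:R <= 2 `^ (C * (eps ^- 2 * ln eps^-1)) * (P.[bmi_size K])%:R].
Proof.
have [c [n [mk [_ _ tm]]]] := pt_main (@pt_guess R).
(* Function 0 pairs the instance with a dummy argument, the form of input that the code of a [pt]
   function expects, and calls function 1. *)
pose A : program := ECall 1 (ENode (EVar 0) ELeaf) :: mk 1%N.
(* The surplus 12 in the exponent turns the additive overhead of the first call, estimated by a
   factor 5, into part of the power. *)
pose k := (c + 12)%N.
have [C hC] := time_bound R k.
have [P hP] := linear_poly k.
exists A, C, P => K eps epsb; pose w : world R := World K epsb.
have fA : frag A 1 (mk 1%N) by move=> i hi; rewrite /body add1n.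
have [X [mE sX mX]] := main_spec w.
have [t ht et] := tm A 1%N fA w Leaf.
exists X, ((1 + 1).+1 + t).+1; split.
- rewrite /outputs; apply: (@eval_call _ A K eps _ 1 _ (Node (ctx w) Leaf)); last first.
    by rewrite -mE; exact: et.
  by apply: eval_node; [exact: (ev_var A w) | exact: eval_leaf].
- exact: sX.
- have [S [sS mS OS]] := optimal_solution K.
  have /andP[e0 e1] := epsb.
  have eps1 : 0 <= 1 - eps by lra.
  apply: le_trans (_ : (1 - eps) * ratr (set_profit S) <= _).
    by rewrite ler_wpM2l // ler_rat.
  have S0 : 0 <= set_profit S by rewrite sumr_ge0 // => e _; apply: profit_ge0.
  (* Guessing the optimum up to a factor 2 presupposes that it is positive; if it is 0, any solution
     is good enough. *)
  have [S00|Sn0] := eqVneq (set_profit S) 0.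
    rewrite S00 rmorph0 mulr0 ler0q.
    by rewrite sumr_ge0 // => e _; apply: profit_ge0.
  have Spos : 0 < set_profit S by rewrite lt_neqAle eq_sym Sn0.
  have [Z [Zin sZ pZ]] := @good_candidate R w S sS mS Spos.
  have pX : set_profit S - 6 * set_profit S / (ell w)%:R <= set_profit X.
    exact: le_trans pZ (mX Z Zin sZ).
  have l0 : 0 < (ell w)%:R :> R by rewrite ltr0n expn_gt0.
  have h6 : 6 <= eps * (ell w)%:R by rewrite /ell /logell; case: ex_minnP.
  apply: le_trans (_ : ratr (set_profit S - 6 * set_profit S / (ell w)%:R) <= _);
    last by rewrite ler_rat.
  rewrite rmorphB !rmorphM fmorphV /= !ratr_nat mulrBl mul1r lerD2l lerN2.
  rewrite ler_pdivrMr // mulrAC ler_wpM2r // ler0q //.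
- have := hC w ((1 + 1).+1 + t).+1; rewrite hP; apply.
  apply: (@leq_trans (bd c (res w + 1) + 4)); first by move: ht => /=; lia.
  have h1 : (bd c (res w + 1) <= (res w + k) ^ c)%N by apply: leq_exp; rewrite /k; lia.
  have h2 : (0 < (res w + k) ^ c)%N by rewrite expn_gt0 /k; lia.
  rewrite {2}/k addnC expnD mulnC.
  have h3 : (5 <= (res w + k) ^ 12)%N.
    apply: (@leq_trans ((res w + k) ^ 1)); first by rewrite expn1 /k; lia.
    by rewrite leq_pexp2l // /k; lia.
  apply: leq_trans (_ : _ <= 5 * (res w + k) ^ c)%N _; first by lia.
  by rewrite leq_mul2r h3 orbT.
Qed.
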